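(* Let $v$ satisfy hypothesis (H) with constants $L,M,K$, and let $\mu_0\in\mathcal{P}^{ac}_c$ be given. Let $\mu^{(3)}=\mu^{(3)}_{[0,T]}$ be computed via Scheme 3 from $\mu_0$ with parameters $\Delta x>0$ and $\Delta t=T/2^k$, $k\in\mathbb{N}$, and let $\mu$ be the exact solution of the Cauchy problem $\partial_t\mu+\nabla\cdot(v[\mu]\mu)=0$, $\mu_{|t=0}=\mu_0$. Then, for sufficiently small $\Delta t$, $$d(\mu,\mu^{(3)})\le \Delta x\,\sqrt{n}\,(2e)^{\lceil T\max\{2L,8K\}\rceil}+4KM\,\Delta t\,\frac{e^{T(4L+4K)}-1}{4L+4K}.$$ In particular, $\mu^{(3)}$ converges weakly to $\mu$ in $C([0,T],\mathcal{P}^{ac}_c)$ for $\Delta x,\Delta t\to 0$.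
   Context: Fix $p\ge 1$, $n\in\mathbb{N}$, $T>0$. $\mathcal{P}_p$ is the space of Radon probability measures on $\mathbb{R}^n$ with finite $p$-moment, endowed with the Wasserstein distance $W_p$; for absolutely continuous measures $W_p(\mu,\nu)=\inf\{(\int|\gamma(x)-x|^p d\mu)^{1/p}:\gamma\#\mu=\nu\}$, where $\gamma\#\mu(E)=\mu(\gamma^{-1}(E))$. $\mathcal{P}^{ac}_c\subset\mathcal{P}_p$ is the set of probability measures with compact support that are absolutely continuous with respect to Lebesgue measure. On $C([0,T],\mathcal{P}_p)$ set $d(\mu,\nu)=\sup_{t\in[0,T]}W_p(\mu_t,\nu_t)$. Hypothesis (H): $v:\mathcal{P}_p\to C^1(\mathbb{R}^n)\cap L^\infty(\mathbb{R}^n)$, $\mu\mapsto v[\mu]$ (vector fields on $\mathbb{R}^n$), and there are constants $L,M,K$ such that for all $\mu,\nu\in\mathcal{P}_p$, $x,y\in\mathbb{R}^n$: $|v[\mu](x)-v[\mu](y)|\le L|x-y|$, $|v[\mu](x)|\le M$, $\|v[\mu]-v[\nu]\|_{C^0}\le K\,W_p(\mu,\nu)$. Here $4L+4K>0$. Solution: $\mu\in C([0,T],\mathcal{P}^{ac}_c)$ with $\mu_{|t=0}=\mu_0$ and $\int_0^T\int_{\mathbb{R}^n}(\partial_t f+\nabla f\cdot v[\mu_t])\,d\mu_t\,dt=0$ for all $f\in C_c^\infty((0,T)\times\mathbb{R}^n)$. Under (H) it exists and is unique for each $\mu_0\in\mathcal{P}^{ac}_c$. Flow: $\Phi^w_t$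 is the flow at time $t$ of a Lipschitz bounded vector field $w$. Grid discretization: divide $\mathbb{R}^n$ into a grid of hypercubes $\square$ of side $\Delta x$ with sides parallel to the axes. For a measure $\mu$, $\mathrm{grid}[\mu]$ is the measure with density $\sum_{\square}\frac{\mu(\square)}{(\Delta x)^n}\chi_\square$, i.e. constant on each hypercube with the same mass as $\mu$. Scheme 3 (Lagrangian, semi-discrete in time, initial discretization in space): $\mu^{(3)}_0:=\mathrm{grid}[\mu_0]$. Given $\mu^{(3)}_{i\Delta t}$, let $v_{i\Delta t}:=v[\mu^{(3)}_{i\Delta t}]$ and, for $t\in[i\Delta t,(i+1)\Delta t]$, $\mu^{(3)}_t:=\Phi^{v_{i\Delta t}}_{t-i\Delta t}\#\mu^{(3)}_{i\Delta t}$. Stop at $T$. Weak convergence in $C([0,T],\mathcal{P}^{ac}_c)$: for each bounded continuous $\varphi$ on $\mathbb{R}^n$, $\int\varphi\,d\mu^{(3)}_t\to\int\varphi\,d\mu_t$ uniformly in $t\in[0,T]$. *)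

(* Defs.v *)
From HB Require Import structures.
From mathcomp Require Import all_boot all_order all_algebra.
From mathcomp Require Import all_classical all_reals all_analysis.
From mathcomp Require Import measurable_realfun.

Set Implicit Arguments.
Unset Strict Implicit.
Unset Printing Implicit Defensive.

Import Order.TTheory GRing.Theory Num.Theory.
Import numFieldNormedType.Exports.

Local Open Scope classical_set_scope.
Local Open Scope ring_scope.

Definition rV_display : measure_display.
Proof. exact: default_measure_display. Qed.

HB.instance Definition _ (R : realType) (m n : nat) :=
  @isMeasurable.Build rV_display 'M[R]_(m, n) <<s @open 'M[R]_(m, n) >>
    (@sigma_algebra0 _ setT _) (@sigma_algebraC _ _)
    (@sigma_algebra_bigcup _ setT _).

Section lebesgue_measure_rV.
Context (R : realType).

Lemma measurable_rowP d (T : measurableType d) n (f : T -> 'rV[R]_n) :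
  (forall i, measurable_fun setT (fun x => f x ord0 i)) ->
  measurable_fun setT f.
Proof.
move=> mf; apply: (@measurability _ _ _ _ _ f (@open 'rV[R]_n)) => //.
move=> _ [ O oO <-]; rewrite setTI.
pose near_rat := fun q : 'rV[rat]_n * nat =>
  [set x : 'rV[R]_n | forall i, `|ratr (q.1 ord0 i) - x ord0 i| < q.2.+1%:R^-1].
have -> : f @^-1` O =
    \bigcup_(q in [set q | near_rat q `<=` O]) (f @^-1` near_rat q).
  apply/seteqP; split=> [x /= Ofx|x [q /= qO Bx]]; last exact: qO.
  have /nbhs_ballP[e /= e0 eO] := open_nbhs_nbhs (conj oO Ofx).
  have [k ke] : exists k : nat, k.+1%:R^-1 < e / 2.
    have e2 : 0 < e / 2 by rewrite divr_gt0.
    have /ltr_add_invr[k] : 0 < e / 2 by [].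
    by rewrite add0r => ke; exists k.
  have kp : (0 : R) < k.+1%:R^-1 by rewrite invr_gt0.
  have H i : exists q : rat, `|ratr q - f x ord0 i| < k.+1%:R^-1.
    have /rat_in_itvoo[q] : f x ord0 i < f x ord0 i + k.+1%:R^-1.
      by rewrite ltrDl.
    rewrite in_itv /= => /andP[q1 q2]; exists q.
    by rewrite gtr0_norm ?subr_gt0 // ltrBlDl.
  have /choice[g gP] := H.
  exists (\row_i g i, k) => /=; last by move=> i; rewrite mxE; exact: gP.
  move=> y By; apply: eO; split => // i j; rewrite (ord1 i).
  have := By j; rewrite mxE /= => yj.
  rewrite /ball /= -(subrKA (ratr (g j))) (le_lt_trans (ler_normD _ _))//.
  rewrite (splitr e) ltrD//; last exact: lt_trans ke.
  by rewrite distrC; exact: lt_trans (gP j) ke.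
have -> : \bigcup_(q in [set q | near_rat q `<=` O]) f @^-1` near_rat q =
    \bigcup_(q : 'rV[rat]_n * nat)
      (if `[< near_rat q `<=` O >] then f @^-1` near_rat q else set0).
  apply/seteqP; split=> [x [q /= qO Bx]|x [q _]].
    by exists q => //; rewrite asboolT.
  by case: asboolP => // qO Bx; exists q.
apply: countable_bigcupT_measurable => [|q]; first exact: countableP.
case: ifP => // _.
have -> : f @^-1` near_rat q = \bigcap_(i in [set: 'I_n])
    (fun x => f x ord0 i) @^-1` (ball (ratr (q.1 ord0 i) : R) q.2.+1%:R^-1).
  by apply/seteqP; split=> x /= Bx i => [_|]; apply: Bx.
apply: fin_bigcap_measurable => // i _.
rewrite -[X in measurable X]setTI; apply: mf => //.
by apply: open_measurable; exact: ball_open.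
Qed.

Lemma measurable_coord n (i : 'I_n) :
  measurable_fun setT (fun x : 'rV[R]_n => x ord0 i).
Proof.
apply: (@measurability _ _ _ _ _ _ (@RGenOInfty.G R)).
  exact: RGenOInfty.measurableE.
move=> _ [_ [a ->] <-]; rewrite setTI; apply: sub_sigma_algebra.
apply: open_comp; last exact: interval_open.
by move=> x _; exact: coord_continuous.
Qed.

Definition rV_cons n (xy : R * 'rV[R]_n) : 'rV[R]_n.+1 :=
  row_mx (const_mx xy.1 : 'rV_1) xy.2.

Lemma measurable_rV_cons n : measurable_fun setT (@rV_cons n).
Proof.
apply: measurable_rowP => i; rewrite /rV_cons.
case: (@splitP 1 n i) => j ij.
  rewrite (_ : (fun _ => _) = fst); first exact: measurable_fst.
  apply/funext => -[x y] /=.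
  have -> : i = lshift n j :> 'I_(1 + n) by apply/val_inj; rewrite /= ij.
  by rewrite [LHS](row_mxEl (const_mx x : 'rV_1) y) mxE.
rewrite (_ : (fun _ => _) = (fun y : 'rV[R]_n => y ord0 j) \o snd).
  by apply: measurableT_comp (measurable_coord j) measurable_snd.
apply/funext => -[x y] /=.
have -> : i = rshift 1 j :> 'I_(1 + n) by apply/val_inj; rewrite /= ij.
exact: (row_mxEr (const_mx x : 'rV_1) y).
Qed.

Section lebesgue_step.
Variables (n : nat) (m : {sigma_finite_measure set 'rV[R]_n -> \bar R}).

Let prodm := (@lebesgue_measure R \x m)%E.

Definition lebesgue_step := pushforward prodm (@rV_cons n).

Let mcons := @measurable_rV_cons n.

Let lebesgue_step0 : lebesgue_step set0 = 0%E.
Proof. exact: measure0. Qed.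

Let lebesgue_step_ge0 A : (0 <= lebesgue_step A)%E.
Proof. exact: measure_ge0. Qed.

Let lebesgue_step_sigma_additive : semi_sigma_additive lebesgue_step.
Proof. exact: measure_semi_sigma_additive. Qed.

HB.instance Definition _ := isMeasure.Build _ _ _ lebesgue_step
  lebesgue_step0 lebesgue_step_ge0 lebesgue_step_sigma_additive.

Let lebesgue_step_sigma_finite : sigma_finite setT lebesgue_step.
Proof.
have /sigma_finiteP[F [FT ndF Foo]] := sigma_finiteT (@lebesgue_measure R).
have /sigma_finiteP[G [GT ndG Goo]] := sigma_finiteT m.
have FGT : [set: R * 'rV[R]_n] = \bigcup_k (F k `*` G k).
  apply/seteqP; split => // -[x y] _.
  have [i _ Fx] : (\bigcup_k F k) x by rewrite -FT.
  have [j _ Gy] : (\bigcup_k G k) y by rewrite -GT.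
  exists (maxn i j) => //; split.
    by move: Fx; exact/subsetPset/ndF/leq_maxl.
  by move: Gy; exact/subsetPset/ndG/leq_maxr.
pose g (z : 'rV[R]_(1 + n)) := (z ord0 (lshift n ord0), rsubmx z).
have mg : measurable_fun setT g.
  apply/measurable_fun_pairP; split; first exact: measurable_coord.
  apply: measurable_rowP => i.
  rewrite (_ : (fun _ => _) = fun z : 'rV[R]_(1 + n) => z ord0 (rshift 1 i)).
    exact: measurable_coord.
  by apply/funext => z /=; rewrite mxE.
have gK : cancel (@rV_cons n) g.
  move=> [x y]; congr pair; last exact: row_mxKr.
  by rewrite [LHS](row_mxEl (const_mx x : 'rV_1) y) mxE.
exists (fun k => g @^-1` (F k `*` G k)).
  by rewrite -preimage_bigcup -FGT preimage_setT.
move=> k; have [mF Fk] := Foo k; have [mG Gk] := Goo k; split.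
  by rewrite -[X in measurable X]setTI; apply: mg => //; exact: measurableX.
rewrite /lebesgue_step /pushforward (_ : _ @^-1` _ = F k `*` G k); last first.
  apply/funext => x; rewrite -[LHS]/((F k `*` G k) (g (rV_cons x))).
  by rewrite gK.
by rewrite /prodm product_measure1E// lte_mul_pinfty// ge0_fin_numE.
Qed.

HB.instance Definition _ := Measure_isSigmaFinite.Build _ _ _ lebesgue_step
  lebesgue_step_sigma_finite.

End lebesgue_step.

(* Lebesgue measure on R^n, as the iterated product of the one on R. *)
Fixpoint lebesgue_rV (n : nat) :
    {sigma_finite_measure set 'rV[R]_n -> \bar R} :=
  match n with
  | 0 => dirac (0 : 'rV[R]_0)
  | n'.+1 => lebesgue_step (lebesgue_rV n')
  end.

End lebesgue_measure_rV.

(* Euclidean norm: the norm `|x| of the library on 'rV[R]_n is the sup norm. *)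
Definition enorm (R : realType) (n : nat) (x : 'rV[R]_n) : R :=
  Num.sqrt (\sum_(i < n) x ord0 i ^+ 2).

Section wasserstein.
Context (R : realType).

Record Pp (p : R) (n : nat) := MkPp {
  Pp_prob :> probability 'rV[R]_n R ;
  Pp_moment : (\int[Pp_prob]_x (enorm x `^ p)%:E < +oo)%E }.

Definition coupling (n : nat) (mu nu : probability 'rV[R]_n R)
    (pi : probability ('rV[R]_n * 'rV[R]_n)%type R) : Prop :=
  (forall A, measurable A -> pi (A `*` setT) = mu A) /\
  (forall A, measurable A -> pi (setT `*` A) = nu A).

(* Kantorovich form, which makes sense on the whole of Pp and agrees with the
   infimum over transport maps for absolutely continuous measures. *)
Definition Wp (p : R) (n : nat) (mu nu : probability 'rV[R]_n R) : \bar R :=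
  ereal_inf [set ((\int[pi]_z (enorm (z.1 - z.2) `^ p)%:E) `^ p^-1)%E
            | pi in coupling mu nu].

Definition dist_curve (p T : R) (n : nat) (mu nu : R -> Pp p n) : \bar R :=
  ereal_sup [set Wp p (mu t) (nu t) | t in `[0, T]].

Definition Pac_c (n : nat) (mu : probability 'rV[R]_n R) : Prop :=
  mu `<< lebesgue_rV R n /\ exists2 C, compact C & mu (~` C) = 0%E.

End wasserstein.

(* On finite-dimensional spaces this is the class C^k: all iterated directional
   derivatives up to order k exist and are continuous. *)
Fixpoint class_C (R : realType) (V W : normedModType R) (k : nat) (f : V -> W)
    : Prop :=
  match k with
  | 0 => continuous f
  | k'.+1 => (forall x u, derivable f x u) /\
             (forall u, class_C k' (fun x => 'D_u f x))
  end.

Section transport_equation.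
Context (R : realType) (p : R) (n : nat).
Implicit Type v : Pp p n -> 'rV[R]_n -> 'rV[R]_n.

(* L^oo membership is the bound by M; the C^0 norm is the supremum below. *)
Record hypothesis_H v (L M K : R) : Prop := {
  hypH_C1 : forall mu : Pp p n, class_C 1 (v mu) ;
  hypH_lip : forall (mu : Pp p n) x y,
    enorm (v mu x - v mu y) <= L * enorm (x - y) ;
  hypH_bound : forall (mu : Pp p n) x, enorm (v mu x) <= M ;
  hypH_dep : forall mu nu : Pp p n,
    (ereal_sup [set (enorm (v mu x - v nu x))%:E | x in setT]
       <= K%:E * Wp p mu nu)%E }.

(* Elements of C_c^oo(]0, T[ x R^n), extended by 0 to R x R^n. *)
Definition test_function (T : R) (f : R * 'rV[R]_n -> R) : Prop :=
  (forall k, class_C k f) /\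
  exists C : set (R * 'rV[R]_n),
    [/\ compact C, C `<=` `]0, T[ `*` setT & forall z, ~ C z -> f z = 0].

Definition dt_test (f : R * 'rV[R]_n -> R) (z : R * 'rV[R]_n) : R :=
  'D_(1, 0) f z.

Definition grad_test (f : R * 'rV[R]_n -> R) (z : R * 'rV[R]_n) : 'rV[R]_n :=
  \row_i 'D_(0, delta_mx ord0 i) f z.

(* Library measures are functions on all sets, so that equality of measures is
   stated on measurable sets only. *)
Definition is_solution v (T : R) (mu0 : Pp p n) (mu : R -> Pp p n)
    : Prop :=
  [/\ forall t, t \in `[0, T] -> Pac_c (mu t),
      forall t, t \in `[0, T] ->
        (fun s => Wp p (mu s) (mu t)) @ within `[0, T] (nbhs t) --> 0%E,
      forall A, measurable A -> mu 0 A = mu0 A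
    & forall f, test_function T f ->
        \int[lebesgue_measure]_(t in `[0, T]) (\int[mu t]_x
          (dt_test f (t, x) +
           \sum_(i < n) grad_test f (t, x) ord0 i * v (mu t) x ord0 i)) = 0].

Definition is_flow (w : 'rV[R]_n -> 'rV[R]_n) (Phi : R -> 'rV[R]_n -> 'rV[R]_n)
    : Prop :=
  (forall x, Phi 0 x = x) /\
  (forall (t : R) x, is_derive t (1 : R) (fun s => Phi s x) (w (Phi t x))).

(* The origin o of the grid is arbitrary. Cells are half-open, to get a
   partition of R^n; this is immaterial for absolutely continuous measures. *)
Definition cell (o : 'rV[R]_n) (dx : R) (k : 'rV[int]_n) : set 'rV[R]_n :=
  [set x | forall i, o ord0 i + (k ord0 i)%:~R * dx <= x ord0 i
                       < o ord0 i + (k ord0 i + 1)%:~R * dx].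

Definition grid (o : 'rV[R]_n) (dx : R) (mu : probability 'rV[R]_n R)
    : set 'rV[R]_n -> \bar R :=
  fun A => (\int[lebesgue_rV R n]_(x in A)
    \esum_(k in [set: 'rV[int]_n])
      (mu (cell o dx k) * ((dx ^+ n)^-1)%:E * (\1_(cell o dx k) x)%:E))%E.

(* The time step is dt = T / 2^k, so that T is reached after 2^k steps. *)
Definition scheme3 v (T : R) (mu0 : Pp p n) (o : 'rV[R]_n) (dx : R) (k : nat)
    (mu : R -> Pp p n) : Prop :=
  let dt := T / 2 ^+ k in
  (forall A, measurable A -> mu 0 A = grid o dx mu0 A) /\
  (forall i : nat, (i < 2 ^ k)%N ->
     exists2 Phi, is_flow (v (mu (i%:R * dt))) Phi &
       forall t, i%:R * dt <= t <= i.+1%:R * dt ->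
       forall A, measurable A ->
         mu t A = pushforward (mu (i%:R * dt)) (Phi (t - i%:R * dt)) A).

End transport_equation.

(* Main.v *)
(* A curve of measures mu_t that solves the equation is the image of mu_0 under
   the characteristics X_t of the field v[mu_t], now regarded as a given
   Lipschitz field. For a Lipschitz, compactly supported phi, let
   g_t = phi o X_(t -> tau); mollifying g_t in space at scale kappa gives a test
   function whose mean under mu_t moves by at most O(kappa) on [0, tau], because
   g_t is constant along characteristics; then kappa -> 0.

   The scheme is, in the same way, the image of grid[mu_0] under a composition
   Y_t of flows. A coupling of mu_0 and grid[mu_0] that moves no mass out of its
   cell is supported on |x - y| <= D = sqrt n dx, and its images under X_s x Y_r
   bound every Wasserstein distance that enters the velocities. So the supremum
   S_t of |X_t x - Y_t y| over |x - y| <= D satisfies a Gronwall inequality of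
   rate L + K with source K M dt, whence
   S_t <= (D + c) e^(2 (L + K) t) - c with c = K M dt / (L + K). *)
From HB Require Import structures.
From mathcomp Require Import all_boot all_order all_algebra.
From mathcomp Require Import all_classical all_reals all_analysis.
From mathcomp Require Import measurable_realfun lra ring.
Require Import Defs.

Set Implicit Arguments.
Unset Strict Implicit.
Unset Printing Implicit Defensive.

Import Order.TTheory GRing.Theory Num.Theory.
Import numFieldNormedType.Exports.

Local Open Scope classical_set_scope.
Local Open Scope ring_scope.

(** * Euclidean norm *)

Section enorm_theory.
Context {R : realType} {n : nat}.
Implicit Types x y : 'rV[R]_n.

(** The field is Lipschitz in space but has no controlled second derivative, so [g_t] is only
    Lipschitz and cannot itself be tested with. Mollifying it costs a commutator: an average over
    |u| <= kappa sees the field at [u + x] instead of [x], an error at most L |u|, and this is the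
    O(kappa). At each time the mollified function is frozen and its mean expanded to first order;
    replacing g_t by g_s then cancels the advection term, so test functions eta(t) f(x) suffice. All
    integral inequalities are closed alike: under an exponential weight of twice the rate the
    integral operator halves, and a finite quantity at most d plus half of itself is at most 2 d.
    Hence the exponent 2 (L + K) instead of L + K; a further integration restores the constant in
    front. The target leaves room for this: with m = max(2L, 8K), 2 (L + K) <= 5 m / 4 and e^(5/4)
    <= 2 e, while K / (L + K) = 4 K / (4 L + 4 K) and 2 (L + K) <= 4 (L + K). Suprema run over all
    pairs |x - y| <= D since a velocity depends on the whole measure, and such a supremum dominates
    W_p for every p. *)

Definition dotv x y : R := \sum_(i < n) x ord0 i * y ord0 i.

Lemma enorm_ge0 x : 0 <= enorm x.
Proof. exact: sqrtr_ge0. Qed.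

Lemma sqr_enorm x : enorm x ^+ 2 = dotv x x.
Proof.
rewrite sqr_sqrtr; first by apply: eq_bigr => i _; rewrite expr2.
by apply: sumr_ge0 => i _; exact: sqr_ge0.
Qed.

Lemma dotvC x y : dotv x y = dotv y x.
Proof. by apply: eq_bigr => i _; rewrite mulrC. Qed.

Lemma dotvDl x y z : dotv (x + y) z = dotv x z + dotv y z.
Proof. by rewrite -big_split /=; apply: eq_bigr => i _; rewrite mxE mulrDl. Qed.

Lemma dotvZl (a : R) x y : dotv (a *: x) y = a * dotv x y.
Proof. by rewrite mulr_sumr; apply: eq_bigr => i _; rewrite mxE mulrA. Qed.

Lemma dotvDr x y z : dotv x (y + z) = dotv x y + dotv x z.
Proof. by rewrite dotvC dotvDl !(dotvC x). Qed.

Lemma dotvZr (a : R) x y : dotv x (a *: y) = a * dotv x y.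
Proof. by rewrite dotvC dotvZl dotvC. Qed.

Lemma enormZ (a : R) x : enorm (a *: x) = `|a| * enorm x.
Proof.
rewrite /enorm -sqrtr_sqr -sqrtrM ?sqr_ge0// mulr_sumr; congr Num.sqrt.
by apply: eq_bigr => i _; rewrite mxE exprMn.
Qed.

Lemma enorm0 : enorm (0 : 'rV[R]_n) = 0.
Proof. by rewrite -(scale0r (0 : 'rV[R]_n)) enormZ normr0 mul0r. Qed.

Lemma enormN x : enorm (- x) = enorm x.
Proof. by rewrite -scaleN1r enormZ normrN1 mul1r. Qed.

Lemma enormC x y : enorm (x - y) = enorm (y - x).
Proof. by rewrite -enormN opprB. Qed.

Lemma coord_le_enorm x i : `|x ord0 i| <= enorm x.
Proof.
rewrite -sqrtr_sqr ler_wsqrtr// (bigD1 i)//= lerDl.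
by apply: sumr_ge0 => j _; exact: sqr_ge0.
Qed.

Lemma enorm_eq0 x : enorm x = 0 -> x = 0.
Proof.
move=> x0; apply/rowP => i; rewrite mxE; apply/eqP; rewrite -normr_le0 -x0.
exact: coord_le_enorm.
Qed.

(** Cauchy-Schwarz: the squared norm of |y| x - |x| y expands to 2 |x| |y| (|x| |y| - x.y), and the
    factor |x| |y| is positive once both vectors are nonzero. *)
Lemma dotv_le x y : dotv x y <= enorm x * enorm y.
Proof.
have [->|x0] := eqVneq x 0; first by rewrite -{1}(scale0r y) dotvZl mul0r enorm0 mul0r.
have [->|y0] := eqVneq y 0; first by rewrite dotvC -{1}(scale0r x) dotvZl mul0r enorm0 mulr0.
have xp : 0 < enorm x.
  by rewrite lt_neqAle enorm_ge0 andbT eq_sym; apply: contra_neq x0 => /enorm_eq0.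
have yp : 0 < enorm y.
  by rewrite lt_neqAle enorm_ge0 andbT eq_sym; apply: contra_neq y0 => /enorm_eq0.
have : 0 <= enorm (enorm y *: x + (- enorm x) *: y) ^+ 2 by exact: sqr_ge0.
rewrite sqr_enorm dotvDl !dotvDr !dotvZl !dotvZr -!sqr_enorm (dotvC y x) => h.
have xy : 0 < enorm x * enorm y by rewrite mulr_gt0.
rewrite -(ler_pM2l xy); nra.
Qed.

Lemma ler_enormD x y : enorm (x + y) <= enorm x + enorm y.
Proof.
rewrite -(@ler_pXn2r _ 2)// ?nnegrE ?addr_ge0 ?enorm_ge0//.
rewrite sqr_enorm dotvDl !dotvDr (dotvC y x) -!sqr_enorm.
by have := dotv_le x y; nra.
Qed.

Lemma ler_enorm_sub x y z : enorm (x - z) <= enorm (x - y) + enorm (y - z).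
Proof. by rewrite -{1}(subrK y x) -addrA; exact: ler_enormD. Qed.

Lemma normr_le_enorm x : `|x| <= enorm x.
Proof.
rewrite /Num.norm/= mx_normrE; apply: bigmax_le; first exact: enorm_ge0.
by move=> [i j] _ /=; rewrite (ord1 i) coord_le_enorm.
Qed.

Lemma coord_le_norm x i : `|x ord0 i| <= `|x|.
Proof.
by rewrite [leRHS]/Num.norm/= mx_normrE; apply: (le_bigmax _ _ (ord0, i)).
Qed.

Lemma enorm_le_coord x (a : R) : 0 <= a -> (forall i, `|x ord0 i| <= a) ->
  enorm x <= Num.sqrt n%:R * a.
Proof.
move=> a0 xa; rewrite -[X in _ * X](ger0_norm a0) -sqrtr_sqr -sqrtrM ?ler0n//.
apply: ler_wsqrtr; rewrite mulr_natl.
apply: (@le_trans _ _ (\sum_(i < n) a ^+ 2)); last by rewrite sumr_const card_ord.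
by apply: ler_sum => i _; rewrite -real_normK ?num_real// ler_pXn2r// nnegrE.
Qed.

Lemma enorm_le_norm x : enorm x <= Num.sqrt n%:R * `|x|.
Proof. by apply: enorm_le_coord => // i; exact: coord_le_norm. Qed.

End enorm_theory.

Lemma enorm_delta (R : realType) n (i : 'I_n) :
  enorm (delta_mx ord0 i : 'rV[R]_n) = 1.
Proof.
rewrite /enorm (bigD1 i)//= big1 ?addr0; last first.
  by move=> j ji; rewrite mxE eqxx (negbTE ji) expr0n.
by rewrite mxE !eqxx expr1n sqrtr1.
Qed.

(** * Differentiable curves and the mean value inequality *)

Section curves.
Context {R : realType} {n : nat}.
Implicit Types (g : R -> 'rV[R]_n) (t : R).

(** Coordinatewise, because the curves below are built by integrating each coordinate separately. *)
Definition has_velocity g t (w : 'rV[R]_n) :=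
  forall i, is_derive t (1 : R) (fun s => g s ord0 i) (w ord0 i).

Lemma is_derive_has_velocity g t w : is_derive t (1 : R) g w -> has_velocity g t w.
Proof.
move=> [dg <-] i; rewrite derive_mx// mxE; apply: DeriveDef => //.
by move/derivable_mxP : dg; apply.
Qed.

Lemma has_velocityB g1 g2 t w1 w2 : has_velocity g1 t w1 ->
  has_velocity g2 t w2 -> has_velocity (fun s => g1 s - g2 s) t (w1 - w2).
Proof.
move=> h1 h2 i; rewrite [X in is_derive _ _ X _](_ : _ =
  (fun s => g1 s ord0 i) - (fun s => g2 s ord0 i)); last first.
  by apply/funext => s; rewrite !mxE.
by rewrite !mxE; have := h1 i; have := h2 i => ? ?; exact: is_deriveB.
Qed.

Lemma is_derive_dotv g t w u : has_velocity g t w ->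
  is_derive t (1 : R) (fun s => dotv u (g s)) (dotv u w).
Proof.
move=> gw; rewrite [X in is_derive _ _ X _](_ : _ =
  \sum_(i < n) (fun s => u ord0 i *: g s ord0 i)); last first.
  by apply/funext => s; rewrite fct_sumE.
have H i : is_derive t (1 : R) (fun s => u ord0 i *: g s ord0 i) (u ord0 i *: w ord0 i).
  by apply: is_deriveZ; exact: gw.
exact: is_derive_sum.
Qed.

Lemma derivable_is_derive (f : R -> R) t d :
  is_derive t (1 : R) f d -> derivable f t 1.
Proof. by case. Qed.

Lemma is_derive_continuous (f : R -> R) t d :
  is_derive t (1 : R) f d -> {for t, continuous f}.
Proof. by case=> df _; apply/differentiable_continuous/derivable1_diffP. Qed.

Lemma le_is_derive (f df : R -> R) (a b : R) : a <= b ->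
  (forall t, a <= t <= b -> is_derive t (1 : R) f (df t)) ->
  (forall t, a <= t <= b -> df t <= 0) -> f b <= f a.
Proof.
move=> ab fdf df0; have sub t : t \in `]a, b[ -> a <= t <= b.
  by rewrite in_itv/= => /andP[/ltW-> /ltW->].
apply: (@ler0_derive1_nincr _ f a b) => //.
- by move=> t /sub/fdf[].
- by move=> t /sub tab; rewrite derive1E (@derive_val _ _ _ _ _ _ _ (fdf t tab)) df0.
- apply: derivable_within_continuous => t; rewrite in_itv/= => /fdf; exact: derivable_is_derive.
Qed.

(* mean value inequality: project on the direction of [g b - g a] *)
Lemma enorm_le_majorant g (g' : R -> 'rV[R]_n) (h dh : R -> R) (a b : R) :
  a <= b ->
  (forall t, a <= t <= b -> has_velocity g t (g' t)) ->
  (forall t, a <= t <= b -> is_derive t (1 : R) h (dh t)) ->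
  (forall t, a <= t <= b -> enorm (g' t) <= dh t) ->
  enorm (g b - g a) <= h b - h a.
Proof.
move=> ab gg' hdh le; set u := g b - g a; set r := enorm u.
have := @le_is_derive (fun s => dotv u (g s) - r * h s)
  (fun s => dotv u (g' s) - r * dh s) a b ab.
have -> : (fun s => dotv u (g s) - r * h s) =
  (fun s => dotv u (g s)) - (r *: h) by [].
move=> /(_ _ _)/=; rewrite !fctE /= => H.
have {H} : dotv u (g b) - r * h b <= dotv u (g a) - r * h a.
  apply: H => t tab.
    have := is_derive_dotv u (gg' t tab); have := hdh t tab => ? ?.
    by apply: is_deriveB.
  rewrite subr_le0 (le_trans (dotv_le _ _))// ler_wpM2l ?enorm_ge0//; exact: le.
have -> : dotv u (g b) = dotv u (g a) + r ^+ 2.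
  by rewrite sqr_enorm -dotvDr addrC subrK.
have [r0|r0] := eqVneq r 0.
  rewrite r0 => _; rewrite subr_ge0 -lerN2.
  apply: (@le_is_derive (- h) (- dh)) => // t tab.
    by have := hdh t tab => ?; exact: is_deriveN.
  by rewrite /= oppr_le0 (le_trans (enorm_ge0 (g' t)))// le.
have rp : 0 < r by rewrite lt_neqAle eq_sym r0 enorm_ge0.
by move=> H; rewrite -(ler_pM2l rp); nra.
Qed.
End curves.

(** * Flows of Lipschitz fields *)

Section bootstrap.
Context {R : realType}.
Implicit Types E : set R.

(** Take [A] to be the supremum of [E]. The bound [B] only makes this supremum finite, so that half
    of it can be absorbed; its value is lost. *)
Lemma half_bootstrap E (d B : R) : (forall e, E e -> e <= B) ->
  (forall A, (forall e, E e -> e <= A) -> forall e, E e -> e <= d + A / 2) ->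
  forall e, E e -> e <= 2 * d.
Proof.
move=> EB boot e Ee.
have hE : has_sup E by split; [exists e|exists B => x /EB].
have supE x : E x -> x <= sup E by move=> Ex; exact: sup_upper_bound.
have : sup E <= d + sup E / 2.
  by apply: ge_sup; [exists e|move=> x Ex; exact: (boot (sup E))].
by have := supE _ Ee; lra.
Qed.

Lemma le_div2X (a b c : R) : (forall m : nat, a <= b + c / 2 ^+ m) -> a <= b.
Proof.
move=> H; apply/ler_addgt0Pr => e e0.
have [c0|c0] := leP c 0.
  by apply: (le_trans (H 0%N)); rewrite expr0 divr1; lra.
have [m cm] : exists m : nat, c / e < 2 ^+ m.
  exists (Num.bound (c / e)); rewrite -natrX; apply: (lt_trans (archi_boundP _)).
    by rewrite divr_ge0// ltW.
  by rewrite ltr_nat ltn_expl.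
apply: (le_trans (H m)); rewrite lerD2l ler_pdivrMr ?exprn_gt0//.
by move: cm; rewrite ltr_pdivrMr// mulrC => /ltW.
Qed.

(** With [r m] the tail of the geometric series, [a m - r m] increases and [a m + r m] decreases;
    the supremum of the lower sequence is the limit, and the rate comes with it. *)
Lemma geometric_limit (a : nat -> R) (C : R) :
  (forall m, `|a m.+1 - a m| <= C / 2 ^+ m) ->
  exists l, forall m, `|a m - l| <= 2 * C / 2 ^+ m.
Proof.
move=> H; pose r m : R := 2 * C / 2 ^+ m.
have rS m : r m - r m.+1 = C / 2 ^+ m.
  by rewrite /r exprS; field; rewrite expf_neq0.
have up m k : a m - r m <= a (k + m)%N - r (k + m)%N.
  elim: k => // k /le_trans; apply; rewrite addSn.
  by have := H (k + m)%N; have := rS (k + m)%N; rewrite ler_norml; lra.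
have dn m k : a (k + m)%N + r (k + m)%N <= a m + r m.
  elim: k => // k; apply: le_trans; rewrite addSn.
  by have := H (k + m)%N; have := rS (k + m)%N; rewrite ler_norml; lra.
have r0 m : 0 <= r m.
  by rewrite divr_ge0 ?exprn_ge0// mulr_ge0//; have := H 0%N; rewrite expr0 divr1;
     exact: le_trans.
have cross m k : a k - r k <= a m + r m.
  have := up k m; have := dn m k; rewrite addnC; have := r0 (m + k)%N; lra.
pose E := [set a m - r m | m in [set: nat]].
have hE : has_sup E.
  by split; [exists (a 0%N - r 0%N), 0%N|exists (a 0%N + r 0%N) => _ [k _ <-]].
exists (sup E) => m.
have h1 : a m - r m <= sup E by apply: sup_upper_bound => //; exists m.
have h2 : sup E <= a m + r m.
  by apply: ge_sup; [case: hE|move=> _ [k _ <-]].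
by rewrite ler_norml -/(r m); lra.
Qed.

Lemma continuous_pointP (f : R -> R) t :
  (forall e, 0 < e -> exists2 d, 0 < d & forall s, `|s - t| < d -> `|f s - f t| <= e) ->
  {for t, continuous f}.
Proof.
move=> H; apply/cvgrPdist_le => e /H[d d0 dP].
near=> s; rewrite distrC; apply: dP; rewrite distrC; near: s.
exact: cvgr_dist_lt.
Unshelve. all: by end_near. Qed.

Lemma antiderivative (f : R -> R) (a : R) : continuous f ->
  exists2 F, F a = 0 & forall t, a <= t -> is_derive t (1 : R) F (f t).
Proof.
move=> cf.
(* Starting at [a - 1] makes [a] an interior point, so that the derivative is two-sided at [t = a]
   too. *)
pose G x := (\int[lebesgue_measure]_(t in `[(a - 1)%R, x]) f t)%R.
exists (fun x => G x - G a); first by rewrite subrr.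
move=> t at_.
have tu : t < t + 1 by rewrite ltrDl.
have lt : a - 1 < t by rewrite (lt_le_trans _ at_)// ltrBlDr ltrDl.
have intf : lebesgue_measure.-integrable `[(a - 1)%R, t + 1] (EFin \o f).
  apply: continuous_compact_integrable; first exact: segment_compact.
  exact: continuous_subspaceT.
have [dG GE] : derivable G t 1 /\ 'D_1 G t = f t.
  by rewrite -derive1E; exact: (continuous_FTC1_closed tu intf lt (cf t)).
have Gt : is_derive t (1 : R) G (f t) by exact: DeriveDef.
rewrite -[f t]subr0; apply: is_deriveB.
Qed.

Lemma is_derive_expR_affine (c g a t : R) :
  is_derive t (1 : R) (fun r => c * expR (g * (r - a))) (c * g * expR (g * (t - a))).
Proof.
have H : is_derive t (1 : R) (fun r => g * (r - a)) g.
  have -> : (fun r => g * (r - a)) = g *: (id - cst a) by [].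
  by apply: is_derive_eq; rewrite subr0 /GRing.scale/= mulr1.
have := @is_derive1_comp _ expR (fun r => g * (r - a)) t _ _ (is_derive_expR (g * (t - a))) H.
rewrite (_ : _ \o _ = fun r => expR (g * (r - a))) // => H2.
have -> : (fun r => c * expR (g * (r - a))) = c *: (fun r => expR (g * (r - a))) by [].
by apply: is_derive_eq; rewrite /GRing.scale/=; ring.
Qed.

End bootstrap.

(** * Existence and stability for Lipschitz differential equations *)

Section ode.
Context {R : realType} {n : nat}.
Implicit Types (W : R -> 'rV[R]_n -> 'rV[R]_n) (g : R -> 'rV[R]_n).

(** Continuity in time is uniform in [x]: this is what Wasserstein continuity of the curve of
    measures and the [K]-Lipschitz dependence of the velocity on the measure provide. *)
Record regular_field W (L M : R) : Prop := RegularField {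
  field_L : 0 <= L ;
  field_lip : forall t x y, enorm (W t x - W t y) <= L * enorm (x - y) ;
  field_bound : forall t x, enorm (W t x) <= M ;
  field_cont : forall t e, 0 < e -> exists2 d, 0 < d &
    forall s, `|s - t| < d -> forall x, enorm (W s x - W t x) <= e }.

Definition solves W (a : R) g :=
  forall t, a <= t -> has_velocity g t (W t (g t)).

Definition lipschitz_from (a M : R) g :=
  forall s t, a <= s -> a <= t -> enorm (g s - g t) <= M * `|s - t|.

Lemma lipschitz_from_velocity (a M : R) g (g' : R -> 'rV[R]_n) :
  (forall t, a <= t -> has_velocity g t (g' t)) ->
  (forall t, enorm (g' t) <= M) -> lipschitz_from a M g.
Proof.
move=> gg' gM; have H s t : a <= s -> s <= t -> enorm (g t - g s) <= M * (t - s).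
  move=> as_ st; have := @enorm_le_majorant _ _ g g' (M *: id) (fun=> M) s t st.
  rewrite !fctE/= mulrBr; apply.
  - by move=> r /andP[sr _]; apply: gg'; exact: le_trans sr.
  - by move=> r _; apply: is_derive_eq; rewrite /GRing.scale/= mulr1.
  - by [].
move=> s t as_ at_; have [st|/ltW ts] := leP s t.
  by rewrite enormC distrC ger0_norm ?subr_ge0//; exact: H.
by rewrite ger0_norm ?subr_ge0//; exact: H.
Qed.

Lemma picard_step W L M (a : R) x g : regular_field W L M -> lipschitz_from a M g ->
  exists h, [/\ h a = x, lipschitz_from a M h &
    forall t, a <= t -> has_velocity h t (W t (g t))].
Proof.
move=> rW gM.
(* Freezing [g] before time [a] makes the integrand continuous on the whole line, as
   [antiderivative] requires. *)
pose f i t := W t (g (Num.max a t)) ord0 i.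
have cf i : continuous (f i).
  move=> t; apply: continuous_pointP => e e0.
  have e2 : 0 < e / 2 by rewrite divr_gt0.
  have [d d0 dP] := field_cont rW t e2.
  have LM : 0 < L * M + 1.
    rewrite ltr_wpDl// mulr_ge0//; first exact: (field_L rW).
    exact: le_trans (enorm_ge0 _) (field_bound rW t x).
  exists (Num.min d (e / 2 / (L * M + 1))); first by rewrite lt_min d0 divr_gt0.
  move=> s; rewrite lt_min => /andP[sd se].
  apply: (@le_trans _ _ (enorm (W s (g (Num.max a s)) - W t (g (Num.max a t))))).
    by have := coord_le_enorm (W s (g (Num.max a s)) - W t (g (Num.max a t))) i; rewrite !mxE.
  rewrite (splitr e) (le_trans (ler_enorm_sub _ (W t (g (Num.max a s))) _))// lerD//.
    exact: dP.
  apply: (le_trans (field_lip rW _ _ _)).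
  apply: (@le_trans _ _ (L * (M * `|s - t|))).
    rewrite ler_wpM2l ?(field_L rW)//.
    apply: (le_trans (gM _ _ _ _)); rewrite ?le_max ?lexx//.
    rewrite ler_wpM2l//; first exact: le_trans (enorm_ge0 _) (field_bound rW t x).
    have [sa|sa] := leP s a; have [ta|ta] := leP t a; rewrite ?subrr ?normr0//.
    - by rewrite distrC [leRHS]distrC !ger0_norm; lra.
    - by rewrite !ger0_norm; lra.
  rewrite mulrA; move: se; rewrite ltr_pdivlMr// => /ltW; apply: le_trans.
  by rewrite mulrC ler_wpM2l// lerDl.
have /choice[F FP] : forall i, exists Fi : R -> R, Fi a = 0 /\
    forall t, a <= t -> is_derive t (1 : R) Fi (f i t).
  by move=> i; have [Fi Fa Fd] := antiderivative a (cf i); exists Fi.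
pose h t : 'rV[R]_n := \row_i (x ord0 i + F i t).
have hv t : a <= t -> has_velocity h t (W t (g t)).
  move=> at_ i; have [_ /(_ t at_)] := FP i.
  rewrite /f (max_idPr at_) => Fd.
  have -> : (fun s => h s ord0 i) = cst (x ord0 i) + F i.
    by apply/funext => s; rewrite mxE.
  by apply: is_derive_eq; rewrite add0r.
exists h; split => //.
  by apply/rowP => i; rewrite mxE (FP i).1 addr0.
by apply: (lipschitz_from_velocity hv) => t; exact: field_bound rW _ _.
Qed.

(** Integrating [L * C] times the weight of rate 2 L + 1 gives the factor L / (2 L + 1) <= 1/2: the
    Picard map is a contraction on an interval of any length. The [+ 1] keeps the rate positive when
    [L] is 0. *)
Lemma contraction_step W L M (a C : R) g1 g2 h1 h2 : regular_field W L M ->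
  (forall t, a <= t -> has_velocity h1 t (W t (g1 t))) ->
  (forall t, a <= t -> has_velocity h2 t (W t (g2 t))) ->
  forall T, (forall t, a <= t <= T -> enorm (g1 t - g2 t) <= C * expR ((2 * L + 1) * (t - a))) ->
  forall t, a <= t <= T -> enorm (h1 t - h2 t) <=
    enorm (h1 a - h2 a) + C / 2 * expR ((2 * L + 1) * (t - a)).
Proof.
move=> rW H1 H2 T g12 t /andP[at_ tT].
set gam := 2 * L + 1.
have L0 := field_L rW.
have gp : 0 < gam by rewrite /gam; lra.
have C0 : 0 <= C.
  have := g12 a; rewrite lexx subrr mulr0 expR0 mulr1 => /(_ (le_trans at_ tT)).
  exact: le_trans (enorm_ge0 _).
pose k r := L * C / gam * expR (gam * (r - a)).
have kd r : is_derive r (1 : R) k (L * C * expR (gam * (r - a))).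
  have := is_derive_expR_affine (L * C / gam) gam a r.
  by rewrite mulfVK ?gt_eqF.
have -> : h1 t - h2 t = ((h1 t - h2 t) - (h1 a - h2 a)) + (h1 a - h2 a) by rewrite subrK.
rewrite (le_trans (ler_enormD _ _))// addrC lerD2l.
apply: (@le_trans _ _ (k t - k a)).
  apply: (@enorm_le_majorant _ _ (fun r => h1 r - h2 r)
    (fun r => W r (g1 r) - W r (g2 r)) k (fun r => L * C * expR (gam * (r - a)))) => //.
    move=> r /andP[ar _]; apply: has_velocityB; [exact: H1|exact: H2].
  move=> r /andP[ar rt]; apply: (le_trans (field_lip rW _ _ _)).
  by rewrite -mulrA ler_wpM2l// g12// ar (le_trans rt).
rewrite lerBlDr; apply: (@le_trans _ _ (C / 2 * expR (gam * (t - a)))); last first.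
  by rewrite lerDl /k mulr_ge0 ?expR_ge0// divr_ge0 ?mulr_ge0// ltW.
rewrite /k ler_wpM2r ?expR_ge0// ler_pdivrMr//.
by rewrite /gam; nra.
Qed.

(** Solutions are fixed points of the Picard map, so [contraction_step] bounds the weighted supremum
    by the initial gap plus half of itself; hence the factor 2. The speed bound [M] makes the
    supremum over [a, T] finite. *)
Lemma solves_stable W L M (a : R) g1 g2 : regular_field W L M ->
  solves W a g1 -> solves W a g2 ->
  forall t, a <= t -> enorm (g1 t - g2 t) <=
    2 * enorm (g1 a - g2 a) * expR ((2 * L + 1) * (t - a)).
Proof.
move=> rW s1 s2 T aT.
have M0 : 0 <= M by exact: le_trans (enorm_ge0 _) (field_bound rW a (g1 a)).
pose E := [set expR (- ((2 * L + 1) * (t - a))) * enorm (g1 t - g2 t) | t in `[a, T]].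
have key : expR (- ((2 * L + 1) * (T - a))) * enorm (g1 T - g2 T) <= 2 * enorm (g1 a - g2 a).
  apply: (@half_bootstrap _ E _ (enorm (g1 a - g2 a) + 2 * M * (T - a))); last first.
  - by exists T => //=; rewrite in_itv/= aT lexx.
  - move=> A HA _ [t /= tT <-]; move: tT; rewrite in_itv/= => tT.
    have H r : a <= r <= T -> enorm (g1 r - g2 r) <= A * expR ((2 * L + 1) * (r - a)).
      move=> rT; have := HA (expR (- ((2 * L + 1) * (r - a))) * enorm (g1 r - g2 r)).
      move=> /(_ _)/wrap[|]; first by exists r => //=; rewrite in_itv.
      by rewrite expRN mulrC ler_pdivrMr// expR_gt0.
    have H1 := contraction_step rW s1 s2 H tT.
    rewrite expRN mulrC ler_pdivrMr ?expR_gt0// mulrDl; apply: (le_trans H1).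
    rewrite lerD2r ler_peMr ?enorm_ge0// -[leLHS]expR0 ler_expR.
    by have := field_L rW; move: tT => /andP[at_ _]; nra.
  - move=> _ [t /= tT <-]; move: tT; rewrite in_itv/= => /andP[at_ tT].
    apply: (@le_trans _ _ (enorm (g1 t - g2 t))).
      rewrite ler_piMl ?enorm_ge0// -[leRHS]expR0 ler_expR oppr_le0.
      by have := field_L rW; nra.
    have l1 := @lipschitz_from_velocity a M g1 _ s1 (fun t => field_bound rW _ _).
    have l2 := @lipschitz_from_velocity a M g2 _ s2 (fun t => field_bound rW _ _).
    have -> : g1 t - g2 t = (g1 t - g1 a) + ((g1 a - g2 a) + (g2 a - g2 t)).
      by apply/rowP => i; rewrite !mxE; ring.
    apply: (le_trans (ler_enormD _ _)).
    have h := ler_enormD (g1 a - g2 a) (g2 a - g2 t).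
    have h1 := l1 t a at_ (lexx _); have h2 := l2 a t (lexx _) at_.
    have ta : `|t - a| = t - a by rewrite ger0_norm// subr_ge0.
    rewrite ta in h1; rewrite distrC ta in h2.
    by have := ler_wpM2l M0 tT; nra.
by move: key; rewrite expRN mulrC ler_pdivrMr// expR_gt0.
Qed.

Lemma picard W L M (a : R) x : regular_field W L M ->
  exists2 g, g a = x & solves W a g.
Proof.
move=> rW.
have L0 := field_L rW.
have M0 : 0 <= M by exact: le_trans (enorm_ge0 _) (field_bound rW a x).
pose good g := g a = x /\ lipschitz_from a M g.
(* The iterates carry their Lipschitz bound along, since [picard_step] takes it as input and returns
   it. *)
have /choice[next nextP] : forall g : {g | good g}, exists h : {h | good h},
    forall t, a <= t -> has_velocity (sval h) t (W t (sval g t)).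
  move=> [g [ga gl]]; have [h [ha hl hv]] := picard_step x rW gl.
  by exists (exist _ h (conj ha hl)).
have good0 : good (fun=> x).
  by split => // s t _ _; rewrite subrr enorm0 mulr_ge0.
pose u m := iter m next (exist _ _ good0).
have ua m : sval (u m) a = x by case: (svalP (u m)).
have ul m : lipschitz_from a M (sval (u m)) by case: (svalP (u m)).
have uv m t : a <= t -> has_velocity (sval (u m.+1)) t (W t (sval (u m) t)).
  exact: nextP.
pose ex t := expR ((2 * L + 1) * (t - a)).
have cauchy m t : a <= t -> enorm (sval (u m.+1) t - sval (u m) t) <= M / 2 ^+ m * ex t.
  elim: m t => [t at_|m IH t at_].
    rewrite expr0 divr1 -[sval (u 0%N) t]/x -(ua 1%N).
    apply: (le_trans (ul 1%N _ _ at_ (lexx a))); rewrite ler_wpM2l//.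
    rewrite ger0_norm ?subr_ge0//; apply: le_trans (expR_ge1Dx _).
    have : 0 <= t - a by rewrite subr_ge0.
    by nra.
  have := @contraction_step W L M a (M / 2 ^+ m) _ _ _ _ rW (uv m.+1) (uv m) t.
  move=> /(_ _ t)/wrap[r /andP[ar rt]|]; first exact: IH.
  rewrite at_ lexx !ua subrr enorm0 add0r => /(_ isT).
  by rewrite exprSr invfM mulrA.
have lim t : exists l, a <= t -> forall m, enorm (sval (u m) t - l) <=
    Num.sqrt n%:R * (2 * (M * ex t)) / 2 ^+ m.
  have [at_|_] := boolP (a <= t); last by exists 0.
  have /choice[l lP] : forall i, exists li, forall m,
      `|sval (u m) t ord0 i - li| <= 2 * (M * ex t) / 2 ^+ m.
    move=> i; apply: geometric_limit => m.
    have := coord_le_enorm (sval (u m.+1) t - sval (u m) t) i.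
    by rewrite !mxE => /le_trans; apply; rewrite mulrAC; exact: cauchy.
  exists (\row_i l i) => _ m; rewrite -mulrA; apply: enorm_le_coord.
    by rewrite divr_ge0 ?exprn_ge0// mulr_ge0// mulr_ge0// expR_ge0.
  by move=> i; rewrite !mxE; exact: lP.
have /choice[X XP] := lim.
have Xl : lipschitz_from a M X.
  move=> s t as_ at_; apply: (@le_div2X _ _ _
    (Num.sqrt n%:R * (2 * (M * ex s)) + Num.sqrt n%:R * (2 * (M * ex t)))) => m.
  have -> : X s - X t = - (sval (u m) s - X s) +
     ((sval (u m) s - sval (u m) t) + (sval (u m) t - X t)).
    by apply/rowP => i; rewrite !mxE; ring.
  rewrite (le_trans (ler_enormD _ _))// enormN.
  rewrite (le_trans (lerD (XP s as_ m) (ler_enormD _ _)))//.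
  have h1 := XP t at_ m; have h2 := ul m s t as_ at_.
  by rewrite mulrDl; lra.
have Xa : X a = x.
  apply/eqP; rewrite -subr_eq0; apply/eqP/enorm_eq0/eqP.
  rewrite eq_le enorm_ge0 andbT; apply: (@le_div2X _ _ _ (Num.sqrt n%:R * (2 * (M * ex a)))) => m.
  by rewrite add0r -{1}(ua m) enormC; exact: XP.
(* [X] is only a pointwise limit, with no derivative yet. Its Picard image [Y] is differentiable,
   and [Y = X] because the iterates converge to both. *)
have [Y [Ya Yl Yv]] := picard_step x rW Xl.
exists Y => // t at_; suff <- : X t = Y t by exact: Yv.
apply/eqP; rewrite -subr_eq0; apply/eqP/enorm_eq0/eqP.
rewrite eq_le enorm_ge0 andbT.
apply: (@le_div2X _ _ _ (Num.sqrt n%:R * (2 * M) * ex t)) => m.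
rewrite add0r.
have h1 := XP t at_ m.+1.
have := @contraction_step W L M a (Num.sqrt n%:R * (2 * M) / 2 ^+ m) _ _ _ _ rW (uv m) Yv t.
move=> /(_ _ t)/wrap[r /andP[ar rt]|].
  rewrite [leRHS](_ : _ = Num.sqrt n%:R * (2 * (M * ex r)) / 2 ^+ m); first exact: XP.
  by rewrite -!mulrA [_^-1 * expR _]mulrC.
rewrite at_ lexx !ua Ya subrr enorm0 add0r -/(ex t) => /(_ isT) h2.
have := ler_enorm_sub (X t) (sval (u m.+1) t) (Y t); rewrite [enorm (X t - sval _ t)]enormC.
move=> /le_trans; apply; apply: (le_trans (lerD h1 h2)).
rewrite exprS le_eqVlt; apply/orP; left; apply/eqP; field.
by rewrite expf_neq0.
Qed.

End ode.

Section flow_map.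
Context {R : realType} {n : nat}.
Variables (W : R -> 'rV[R]_n -> 'rV[R]_n) (L M : R).
Hypothesis rW : regular_field W L M.

(** The arguments are the starting time, the current time and the starting point; the equation is
    required from the starting time on. *)
Definition flow_map (Z : R -> R -> 'rV[R]_n -> 'rV[R]_n) :=
  (forall s x, Z s s x = x) /\ (forall s x, solves W s (fun t => Z s t x)).

Lemma flow_map_exists : exists Z, flow_map Z.
Proof.
have /choice[z zP] : forall sx : R * 'rV[R]_n, exists g, g sx.1 = sx.2 /\ solves W sx.1 g.
  by move=> [s x]; have [g gs gW] := picard s x rW; exists g.
by exists (fun s t x => z (s, x) t); split => [s x|s x]; have [] := zP (s, x).
Qed.

Lemma solves_unique (a : R) g1 g2 : solves W a g1 -> solves W a g2 -> g1 a = g2 a ->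
  forall t, a <= t -> g1 t = g2 t.
Proof.
move=> s1 s2 e t at_; apply/eqP; rewrite -subr_eq0; apply/eqP/enorm_eq0/eqP.
rewrite eq_le enorm_ge0 andbT (le_trans (solves_stable rW s1 s2 at_))//.
by rewrite e subrr enorm0 mulr0 mul0r.
Qed.

Variable Z : R -> R -> 'rV[R]_n -> 'rV[R]_n.
Hypothesis ZW : flow_map Z.

Lemma flow_map_comp s t r x : s <= t -> t <= r -> Z s r x = Z t r (Z s t x).
Proof.
move=> st tr; apply: (@solves_unique t (Z s ^~ x) (Z t ^~ (Z s t x))) => //.
- by move=> q tq; apply: ZW.2; exact: le_trans tq.
- exact: ZW.2.
- by rewrite ZW.1.
Qed.

Lemma flow_map_lip s t x y : s <= t ->
  enorm (Z s t x - Z s t y) <= 2 * expR ((2 * L + 1) * (t - s)) * enorm (x - y).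
Proof.
move=> st; have := solves_stable rW (ZW.2 s x) (ZW.2 s y) st.
by rewrite !ZW.1 mulrAC.
Qed.

Lemma flow_map_move s t x : s <= t -> enorm (Z s t x - x) <= M * (t - s).
Proof.
move=> st.
have := @lipschitz_from_velocity _ _ s M _ _ (ZW.2 s x) (fun t => field_bound rW _ _).
by move=> /(_ t s st (lexx s)); rewrite ZW.1 ger0_norm ?subr_ge0.
Qed.

Lemma has_velocity_affine (a c t : R) (w : 'rV[R]_n) :
  has_velocity (fun s => (s - a) *: w) t w.
Proof.
move=> i; rewrite [X in is_derive _ _ X _](_ : _ = w ord0 i *: (id - cst a)).
  by apply: is_derive_eq; rewrite subr0 /GRing.scale/= mulr1.
by apply/funext => s; rewrite mxE mulrC.
Qed.

Lemma flow_map_expand (t e : R) : 0 < e -> exists2 d : R, 0 < d & forall s r : R,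
  `|s - t| < d -> `|r - t| < d -> s <= r ->
  forall x, enorm (Z s r x - x - (r - s) *: W t x) <= e * (r - s).
Proof.
move=> e0; have e2 : 0 < e / 2 by rewrite divr_gt0.
have [d d0 dP] := field_cont rW t e2.
have L0 := field_L rW.
have M0 : 0 <= M by exact: le_trans (enorm_ge0 _) (field_bound rW t 0).
have LM0 : 0 <= L * M by rewrite mulr_ge0.
have LM : 0 < 4 * (L * M + 1) by rewrite mulr_gt0// ltr_wpDl.
exists (Num.min d (e / (4 * (L * M + 1)))); first by rewrite lt_min d0 divr_gt0.
move=> s r; rewrite !lt_min => /andP[sd se] /andP[rd re] sr x.
move: se re; rewrite !ltr_pdivlMr// => se re.
have := @enorm_le_majorant _ _ (fun q => Z s q x - (q - s) *: W t x)
  (fun q => W q (Z s q x) - W t x) (e *: id) (fun=> e) s r sr.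
rewrite !fctE/= subrr scale0r subr0 ZW.1 -mulrBr addrAC; apply.
- move=> q /andP[sq _]; apply: has_velocityB; first exact: ZW.2.
  exact: has_velocity_affine.
- by move=> q _; apply: is_derive_eq; rewrite /GRing.scale/= mulr1.
move=> q /andP[sq qr].
rewrite (splitr e) (le_trans (ler_enorm_sub _ (W t (Z s q x)) _))// lerD//.
  by apply: dP; move: sd rd; rewrite !ltr_norml; lra.
apply: (le_trans (field_lip rW _ _ _)).
apply: (@le_trans _ _ (L * (M * (q - s)))).
  by rewrite ler_wpM2l// flow_map_move.
have h3 : q - s <= `|s - t| + `|r - t|.
  have := ler_norm (r - t); have := ler_norm (t - s); rewrite (distrC t s); lra.
have : (q - s) * (L * M + 1) <= (`|s - t| + `|r - t|) * (L * M + 1).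
  by rewrite ler_wpM2r// addr_ge0.
rewrite mulrA; have : 0 <= q - s by rewrite subr_ge0.
nra.
Qed.

End flow_map.

(** * Mollification on R^n *)

Section smooth_functions.
Context {R : realType}.

Definition smooth (V W : normedModType R) (f : V -> W) := forall k, class_C k f.

Lemma smooth_continuous (V W : normedModType R) (f : V -> W) : smooth f -> continuous f.
Proof. by move=> /(_ 0%N). Qed.

(* [continuous] on a normed module: keeping the module structure visible lets
   these lemmas apply to ['rV[R]_n], whose neighbourhoods unfold otherwise *)
Definition contn (V : normedModType R) (f : V -> R) := continuous f.

Lemma smooth_contn (V : normedModType R) (f : V -> R) : smooth f -> contn f.
Proof. exact: smooth_continuous. Qed.

Lemma contn_cst (V : normedModType R) (c : R) : contn (fun _ : V => c).
Proof. by move=> x; exact: cvg_cst. Qed.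

Lemma contnM (V : normedModType R) (f g : V -> R) :
  contn f -> contn g -> contn (fun x => f x * g x).
Proof. by move=> cf cg x; apply: cvgM; [exact: cf|exact: cg]. Qed.

Lemma contnB (V : normedModType R) (f g : V -> R) :
  contn f -> contn g -> contn (fun x => f x - g x).
Proof. by move=> cf cg x; apply: cvgB; [exact: cf|exact: cg]. Qed.

Lemma contn_translate (V : normedModType R) (f : V -> R) z :
  contn f -> contn (fun x => f (x + z)).
Proof.
move=> cf x; apply: (@continuous_comp _ _ _ (fun x => x + z) f); last exact: cf.
by apply: cvgD; [exact: cvg_id|exact: cvg_cst].
Qed.

Lemma contnP (V : normedModType R) (f : V -> R) :
  (forall x e, 0 < e -> exists2 d, 0 < d & forall y, `|y - x| < d -> `|f y - f x| <= e) ->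
  contn f.
Proof.
move=> H x; apply/cvgrPdist_le => e /(H x)[d d0 dP]; near=> y.
by rewrite distrC; apply: dP; rewrite distrC; near: y; exact: cvgr_dist_lt.
Unshelve. all: by end_near. Qed.

Lemma lipschitz_contn (V : normedModType R) (f : V -> R) (C : R) :
  (forall x z, `|f (z + x) - f x| <= C * `|z|) -> contn f.
Proof.
move=> fC; apply: contnP => x e e0.
have C1 : 0 < `|C| + 1 by rewrite ltr_wpDl.
exists (e / (`|C| + 1)); first by rewrite divr_gt0.
move=> y; rewrite ltr_pdivlMr// => /ltW H.
rewrite -{1}(subrK x y) (le_trans (fC _ _))//; apply: le_trans H; rewrite mulrC ler_wpM2l//.
by rewrite (le_trans (ler_norm C))// lerDl.
Qed.

Lemma smooth_derivable (V W : normedModType R) (f : V -> W) x u :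
  smooth f -> derivable f x u.
Proof. by move=> /(_ 1%N)[]. Qed.

Lemma smooth_derive (V W : normedModType R) (f : V -> W) u :
  smooth f -> smooth (fun x => 'D_u f x).
Proof. by move=> sf k; have /= [_ H] := sf k.+1; exact: H. Qed.

(** Smoothness is a greatest fixed point: a class of continuous, derivable functions stable under
    directional derivation suffices, without formulas for iterated derivatives. *)
Lemma smooth_coind (V W : normedModType R) (F : set (V -> W)) :
  (forall f, F f -> continuous f) ->
  (forall f x u, F f -> derivable f x u) ->
  (forall f u, F f -> F (fun x => 'D_u f x)) -> forall f, F f -> smooth f.
Proof.
move=> Fc Fd FD f Ff k; elim: k f Ff => [|k IH] f Ff; first exact: Fc.
by split=> [x u|u]; [exact: Fd|exact/IH/FD].
Qed.

Lemma class_CD (V W : normedModType R) k (f g : V -> W) :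
  class_C k f -> class_C k g -> class_C k (f + g).
Proof.
elim: k f g => [|k IH] f g /=.
  by move=> cf cg x; apply: cvgD; [exact: cf|exact: cg].
move=> [df Df] [dg Dg]; split=> [x u|u]; first exact: derivableD.
rewrite [X in class_C k X](_ : _ = (fun x => 'D_u f x) + (fun x => 'D_u g x)).
  exact: IH.
by apply/funext => x; rewrite deriveD.
Qed.

Lemma smooth_cst (V W : normedModType R) (c : W) : smooth (fun _ : V => c).
Proof.
apply: (@smooth_coind _ _ [set f | exists c, f = fun=> c]); last by exists c.
- by move=> _ [a ->] x; exact: cvg_cst.
- by move=> _ x u [a ->]; exact: derivable_cst.
- move=> _ u [a ->]; exists 0; apply/funext => x; exact: derive_cst.
Qed.

Lemma smoothM (V : normedModType R) (f g : V -> R) :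
  smooth f -> smooth g -> smooth (fun x => f x * g x).
Proof.
move=> sf sg k; elim: k f g sf sg => [|k IH] f g sf sg.
  by move=> x; apply: cvgM; exact: smooth_continuous.
split=> [x u|u]; first by apply: derivableM; exact: smooth_derivable.
rewrite [X in class_C k X](_ : _ = (fun x => f x * 'D_u g x) + (fun x => g x * 'D_u f x)).
  by apply: class_CD; apply: IH => //; exact: smooth_derive.
by apply/funext => x; rewrite deriveM; try exact: smooth_derivable.
Qed.

Lemma smoothZ (V : normedModType R) (c : R) (f : V -> R) :
  smooth f -> smooth (fun x => c * f x).
Proof. by move=> sf; apply: smoothM => //; exact: smooth_cst. Qed.

Lemma smooth_prod (V : normedModType R) I (s : seq I) (f : I -> V -> R) :
  (forall i, smooth (f i)) -> smooth (fun x => \prod_(i <- s) f i x).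
Proof.
move=> sf; elim: s => [|i s IH].
  by under [X in smooth X]eq_fun do rewrite big_nil; exact: smooth_cst.
by under [X in smooth X]eq_fun do rewrite big_cons; exact: smoothM.
Qed.

(** The difference quotients already coincide before the limit, so directional derivatives pass
    through an affine map with no chain rule and no differentiability. [l'] is the linear part of
    [l]. *)
Lemma growth_affine (V V' W : normedModType R) (b : V' -> W) (l : V -> V') (l' : V -> V') x u :
  (forall h : R, l (h *: u + x) = h *: l' u + l x) ->
  (fun h : R => h^-1 *: (((b \o l) \o shift x) (h *: u) - (b \o l) x)) =
  (fun h : R => h^-1 *: ((b \o shift (l x)) (h *: l' u) - b (l x))).
Proof. by move=> H; apply/funext => h; rewrite /= H. Qed.

Lemma derivable_affine (V V' W : normedModType R) (b : V' -> W) (l : V -> V') (l' : V -> V') x u :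
  (forall h : R, l (h *: u + x) = h *: l' u + l x) ->
  derivable b (l x) (l' u) -> derivable (b \o l) x u.
Proof. by move=> H; rewrite /derivable (growth_affine b H). Qed.

Lemma derive_affine (V V' W : normedModType R) (b : V' -> W) (l : V -> V') (l' : V -> V') x u :
  (forall h : R, l (h *: u + x) = h *: l' u + l x) ->
  'D_u (b \o l) x = 'D_(l' u) b (l x).
Proof. by move=> H; rewrite /derive (growth_affine b H). Qed.

Lemma smooth_affine (V V' W : normedModType R) (b : V' -> W) (l : V -> V') (l' : V -> V') :
  continuous l -> (forall (h : R) u x, l (h *: u + x) = h *: l' u + l x) ->
  smooth b -> smooth (b \o l).
Proof.
move=> cl H sb.
apply: (@smooth_coind _ _ [set f | exists2 c, smooth c & f = c \o l]); last by exists b.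
- move=> _ [c sc ->] x; apply: continuous_comp; first exact: cl.
  exact: smooth_continuous.
- move=> _ x u [c sc ->]; apply: (derivable_affine (l' := l')) => //.
  exact: smooth_derivable.
- move=> _ u [c sc ->]; exists (fun x => 'D_(l' u) c x); first exact: smooth_derive.
  by apply/funext => x; exact: derive_affine.
Qed.

Lemma derive_scalar (f : R -> R) x u : derivable f x 1 ->
  derivable f x u /\ 'D_u f x = u * 'D_1 f x.
Proof.
move=> df; have dif : differentiable f x by exact/derivable1_diffP.
split; first exact: diff_derivable.
by rewrite deriveE// deriv1E// derive1E.
Qed.

(** On the line the derivative in direction [u] is [u] times the one in direction 1, hence the
    scalar [c]. *)
Lemma smooth1_coind (F : set (R -> R)) (D : (R -> R) -> R -> R) :
  (forall f x, F f -> is_derive x (1 : R) f (D f x)) ->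
  (forall f c, F f -> F (fun x => c * D f x)) -> forall f, F f -> smooth f.
Proof.
move=> Fd FD; apply: smooth_coind.
- by move=> f Ff x; exact: is_derive_continuous (Fd f x Ff).
- by move=> f x u Ff; have [df _] := Fd f x Ff; have [] := derive_scalar u df.
move=> f u Ff; rewrite [X in F X](_ : _ = fun x => u * D f x); first exact: FD.
apply/funext => x; have [df <-] := Fd f x Ff.
by have [_ ->] := derive_scalar u df.
Qed.

Lemma derive_line (V W : normedModType R) (f : V -> W) x u (s : R) :
  derivable f (s *: u + x) u ->
  is_derive s (1 : R) (fun s => f (s *: u + x)) ('D_u f (s *: u + x)).
Proof.
have E : (fun h : R => h^-1 *: ((f \o shift (s *: u + x)) (h *: u) - f (s *: u + x))) =
  (fun h : R => h^-1 *: (((fun s => f (s *: u + x)) \o shift s) (h *: 1) - f (s *: u + x))).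
  by apply/funext => h; rewrite /= [h *: 1]mulr1 scalerDl addrA.
by move=> df; apply: DeriveDef; rewrite /derivable /derive -E.
Qed.

Lemma MVT_line (V : normedModType R) (f : V -> R) x u (h : R) :
  (forall x, derivable f x u) ->
  exists2 th : R, `|th| <= `|h| & f (h *: u + x) - f x = h * 'D_u f (th *: u + x).
Proof.
move=> df; have dl s := @derive_line _ _ f x u s (df _).
have cl A : {within A, continuous (fun s => f (s *: u + x))}.
  by apply: continuous_subspaceT => s; exact: is_derive_continuous (dl s).
have f0 : f (0 *: u + x) = f x by rewrite scale0r add0r.
have [h0|/ltW h0] := leP 0 h.
  have [c] := MVT_segment h0 (fun s _ => dl s) (cl _).
  rewrite in_itv/= f0 subr0 => /andP[c0 ch] ->; exists c; last by rewrite mulrC.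
  by rewrite !ger0_norm.
have [c] := MVT_segment h0 (fun s _ => dl s) (cl _).
rewrite in_itv/= f0 sub0r => /andP[hc c0] E; exists c.
  by rewrite !ler0_norm// lerN2.
by rewrite -opprB E mulrN opprK mulrC.
Qed.

(** Compact support on R^n, given by an explicit radius because radii simply add under convolution
    and under the motion of a flow. *)
Definition vanishes_beyond (V : normedModType R) (r : R) (f : V -> R) :=
  forall x, r < `|x| -> f x = 0.

Lemma vanishes_beyond_derive (V : normedModType R) (r : R) (f : V -> R) u :
  vanishes_beyond r f -> vanishes_beyond r (fun x => 'D_u f x).
Proof.
move=> fr x rx; rewrite -[RHS](derive_cst (0 : R) x u); apply: near_eq_derive.
near=> y; rewrite /= fr//; near: y.
have : open [set y : V | r < `|y|].
  rewrite (_ : [set y : V | r < `|y|] = Num.norm @^-1` [set z : R | r < z])//.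
  by apply: open_comp; [move=> y _; exact: norm_continuous|exact: open_gt].
by rewrite openE => /(_ x rx).
Unshelve. all: by end_near. Qed.

End smooth_functions.

(** * A smooth bump on the line *)

Section bump.
Context {R : realType}.

(** The polynomial factor closes the family under derivation: p(1/x) exp(-1/x) has a derivative of
    the same form, with X^2 (p - p') in place of p. *)
Definition flat (p : {poly R}) (x : R) : R :=
  if 0 < x then p.[x^-1] * expR (- x^-1) else 0.

(* [exp y >= (y / m) ^ m] absorbs any polynomial growth at [y = 1 / x] *)
Lemma flat_le (p : {poly R}) : exists C, forall x, `|x| <= 1 -> `|flat p x| <= C * x ^+ 2.
Proof.
pose m := (size p).+2; pose S := \sum_(i < size p) `|p`_i|.
have S0 : 0 <= S by apply: sumr_ge0.
exists (S * m%:R ^+ m) => x x1; rewrite /flat; case: ifPn => [x0|_]; last first.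
  by rewrite normr0 mulr_ge0 ?sqr_ge0// mulr_ge0// exprn_ge0.
set y := x^-1; have y1 : 1 <= y by rewrite /y invf_ge1//; move: x1; rewrite gtr0_norm.
have yp : 0 < y by exact: lt_le_trans y1.
have -> : x ^+ 2 = y ^- 2 by rewrite /y exprVn invrK.
rewrite normrM [`|expR _|]ger0_norm ?expR_ge0// expRN.
have pS : `|p.[y]| <= S * y ^+ size p.
  rewrite horner_coef (le_trans (ler_norm_sum _ _ _))// mulr_suml ler_sum// => i _.
  rewrite normrM ler_wpM2l// normrX gtr0_norm// ler_weXn2l//.
  exact: ltnW.
have eS : y ^+ m <= m%:R ^+ m * expR y.
  have : (y / m%:R) ^+ m <= expR y.
    have -> : expR y = expR (y / m%:R) ^+ m.
      by rewrite -expRM_natl mulrC divfK// pnatr_eq0.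
    apply: lerXn2r; rewrite ?nnegrE ?divr_ge0 ?expR_ge0// ?(ltW yp)//.
    by apply: le_trans (expR_ge1Dx _); rewrite lerDr.
  by rewrite expr_div_n ler_pdivrMr ?exprn_gt0// mulrC.
rewrite ler_pdivrMr ?expR_gt0//; apply: (le_trans pS).
have k : y ^+ size p <= m%:R ^+ m * expR y / y ^+ 2.
  by rewrite ler_pdivlMr ?exprn_gt0// -exprD addn2.
rewrite (_ : S * _ / _ * _ = S * (m%:R ^+ m * expR y / y ^+ 2)) ?ler_wpM2l//.
by rewrite -!mulrA [expR y * _]mulrC.
Qed.

Lemma is_derive_flat (p : {poly R}) (x : R) :
  is_derive x (1 : R) (flat p) (flat ('X^2 * (p - p^`())) x).
Proof.
have [x0|x0|->] := ltgtP x 0.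
- rewrite {2}/flat ltNge (ltW x0)/=.
  have := @is_derive_cst _ _ _ (0 : R) x (1 : R); apply: near_eq_is_derive.
  by near=> y; rewrite /flat/= ltNge ltW//; near: y; exact: lt_nbhsl.
- rewrite {2}/flat x0.
  have xN0 : x != 0 by rewrite gt_eqF.
  have dV : is_derive x (1 : R) (fun y : R => y^-1) (- x ^- 2).
    apply: is_derive_eq; first exact: (@is_deriveV _ id x 1 1).
    by rewrite /GRing.scale/= mulr1.
  have dp := @is_derive1_comp _ (horner p) (fun y => y^-1) x _ _ (is_derive_poly p x^-1) dV.
  have dN := @is_deriveN _ _ _ (fun y : R => y^-1) x 1 _ dV.
  have de := @is_derive1_comp _ expR (- (fun y : R => y^-1)) x _ _ (is_derive_expR _) dN.
  have := @is_deriveM _ _ _ _ x 1 _ _ dp de.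
  rewrite (_ : _ * _ = fun y => p.[y^-1] * expR (- y^-1)); last first.
    by apply/funext => y; rewrite fctE.
  move=> H.
  suff: is_derive x (1 : R) (fun y => p.[y^-1] * expR (- y^-1))
      (('X^2 * (p - p^`())).[x^-1] * expR (- x^-1)).
    by apply: near_eq_is_derive; near=> y; rewrite /flat ifT//; near: y; exact: lt_nbhsr.
  apply: is_derive_eq.
  rewrite /GRing.scale/= !fctE hornerM hornerXn hornerD hornerN opprK.
  by rewrite exprVn; ring.
(* At 0 the quadratic bound of [flat_le] makes the difference quotient O(h). *)
- rewrite {2}/flat ltxx; have [C HC] := flat_le p.
  have C0 : 0 <= C by have := HC 1; rewrite normr1 expr1n mulr1 => /(_ (lexx _)); exact: le_trans.
  have f0 : flat p 0 = 0 by rewrite /flat ltxx.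
  have cv : (fun h => h^-1 *: ((flat p \o shift 0) (h *: 1) - flat p 0)) @ 0^' --> (0 : R).
    apply/cvgrPdist_le => e e0; near=> h.
    rewrite sub0r normrN /= f0 subr0 addr0 [h *: 1]mulr1 normrM normfV.
    have hN0 : h != 0 by near: h; exact: nbhs_dnbhs_neq.
    rewrite ler_pdivrMl ?normr_gt0//.
    have h1 : `|h| <= 1 by near: h; apply: dnbhs0_le.
    have he : `|h| <= e / (C + 1) by near: h; apply: dnbhs0_le; rewrite divr_gt0// ltr_wpDl.
    apply: (le_trans (HC _ h1)).
    rewrite -(@real_normK _ h) ?num_real// expr2 mulrCA ler_wpM2l//.
    by move: he; rewrite ler_pdivlMr ?ltr_wpDl//; nra.
  by apply: DeriveDef; [apply/cvg_ex; exists 0|exact: cvg_lim cv].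
Unshelve. all: by end_near. Qed.

Lemma smooth_flat (p : {poly R}) : smooth (flat p).
Proof.
apply: (@smooth1_coind _ [set f | exists q, f = flat q]
  (fun f x => 'D_1 f x)); last by exists p.
  move=> _ x [q ->]; exact/derivableP/(ex_derive (is_derive := is_derive_flat q x)).
move=> _ c [q ->]; exists (c *: ('X^2 * (q - q^`()))); apply/funext => x.
rewrite (@derive_val _ _ _ _ _ _ _ (is_derive_flat q x)) /flat.
by case: ifP; rewrite ?mulr0// hornerZ mulrA.
Qed.

Definition bump (x : R) : R := flat 1 x * flat 1 (1 - x).

Lemma flat1_ge0 x : 0 <= flat 1 x.
Proof. by rewrite /flat; case: ifP => // _; rewrite hornerC mul1r expR_ge0. Qed.

Lemma flat1_gt0 x : (0 < flat 1 x) = (0 < x).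
Proof. by rewrite /flat; case: ifP; rewrite ?ltxx// hornerC mul1r expR_gt0. Qed.

Lemma smooth_bump : smooth bump.
Proof.
apply: smoothM; first exact: smooth_flat.
apply: (@smooth_affine _ _ _ _ (flat 1) (fun x : R => 1 - x) (fun u : R => - u)).
- by move=> x; apply: cvgB; [exact: cvg_cst|exact: cvg_id].
- by move=> h u x; rewrite scalerN opprD; ring.
- exact: smooth_flat.
Qed.

Lemma bump_ge0 x : 0 <= bump x.
Proof. by rewrite mulr_ge0// flat1_ge0. Qed.

Lemma bump_gt0 x : (0 < bump x) = (0 < x < 1).
Proof.
rewrite /bump; have [x0|x0] := ltP 0 x.
  by rewrite pmulr_rgt0 ?flat1_gt0// subr_gt0.
have -> : flat 1 x = 0 by rewrite /flat le_gtF.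
by rewrite mul0r ltxx.
Qed.

Lemma bump_eq0 x : x <= 0 \/ 1 <= x -> bump x = 0.
Proof.
move=> H; apply/eqP; rewrite eq_le bump_ge0 andbT leNgt bump_gt0.
by apply/negP => /andP[]; case: H; lra.
Qed.

End bump.

(** * Lipschitz and second-order bounds under compact support *)

Section compactly_supported.
Context {R : realType} {n : nat}.
Implicit Types (f : 'rV[R]_n -> R) (x z : 'rV[R]_n).

Lemma compact_normball (r : R) : compact [set x : 'rV[R]_n | `|x| <= r].
Proof.
apply: bounded_closed_compact.
  exists r; split; first exact: num_real.
  by move=> M rM x /=; move=> /le_trans; apply; exact: ltW.
rewrite (_ : [set x : 'rV[R]_n | `|x| <= r] = Num.norm @^-1` [set z : R | z <= r])//.
by apply: closed_comp; [move=> x _; exact: norm_continuous|exact: closed_le].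
Qed.

Lemma vanishing_bounded f (r : R) : contn f -> vanishes_beyond r f ->
  exists2 C, 0 <= C & forall x, `|f x| <= C.
Proof.
move=> cf fr; pose K := [set x : 'rV[R]_n | `|x| <= Num.max 0 r].
have [c _ cP] : exists2 c, c \in K & forall x, x \in K -> `|f x| <= `|f c|.
  apply: compact_EVT_max; first by exists 0; rewrite /K/= normr0 le_max lexx.
    exact: compact_normball.
  apply: continuous_subspaceT => x.
  by apply: continuous_comp; [exact: cf|exact: norm_continuous].
exists `|f c| => // x; have [rx|xr] := ltP r `|x|; first by rewrite fr// normr0.
by apply: cP; rewrite inE /K/= le_max xr orbT.
Qed.

Definition partial f (i : 'I_n) x : R := 'D_(delta_mx ord0 i : 'rV[R]_n) f x.

(** A walk from [x] towards [z + x] along the coordinate axes listed in [s], so that one-dimensional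
    mean value theorems and partial derivatives suffice. *)
Definition shifted (s : seq 'I_n) z x : 'rV[R]_n :=
  \sum_(i <- s) z ord0 i *: delta_mx ord0 i + x.

Lemma shifted_cons i s z x :
  shifted (i :: s) z x = shifted s z (z ord0 i *: delta_mx ord0 i + x).
Proof. by rewrite /shifted big_cons addrCA addrA. Qed.

Lemma shifted_enum z x : shifted (index_enum 'I_n) z x = z + x.
Proof. by rewrite /shifted -row_sum_delta. Qed.

Lemma norm_scale_delta (a : R) (i : 'I_n) : `|a *: delta_mx ord0 i : 'rV[R]_n| <= `|a|.
Proof. by rewrite (le_trans (normr_le_enorm _))// enormZ enorm_delta mulr1. Qed.

Lemma lipschitz_partial f (C : R) : 0 <= C -> (forall x i, derivable f x (delta_mx ord0 i)) ->
  (forall x i, `|partial f i x| <= C) ->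
  forall x z, `|f (z + x) - f x| <= n%:R * C * `|z|.
Proof.
move=> C0 df fC x z.
have H s y : `|f (shifted s z y) - f y| <= (size s)%:R * (C * `|z|).
  elim: s y => [|i s IH] y.
    by rewrite /shifted big_nil add0r subrr normr0 mul0r.
  rewrite shifted_cons /=; set y' := _ + y.
  have -> : f (shifted s z y') - f y = (f (shifted s z y') - f y') + (f y' - f y).
    by rewrite subrKA.
  rewrite (le_trans (ler_normD _ _))// -natr1 mulrDl mul1r lerD//.
  have [th _ ->] := @MVT_line _ _ f y (delta_mx ord0 i) (z ord0 i) (fun x => df x i).
  rewrite normrM mulrC; apply: ler_pM => //; first exact: fC.
  exact: coord_le_norm.
have := H (index_enum 'I_n) x.
by rewrite shifted_enum -mulrA (_ : size _ = n)// /index_enum -enumT size_enum_ord.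
Qed.

Lemma smooth_lipschitz f (r : R) : smooth f -> vanishes_beyond r f ->
  exists2 C, 0 <= C & forall x z, `|f (z + x) - f x| <= C * `|z|.
Proof.
move=> sf fr.
have /choice[C CP] : forall i : 'I_n, exists C, 0 <= C /\ forall x, `|partial f i x| <= C.
  move=> i; have [C C0 CP] := vanishing_bounded
    (smooth_contn (smooth_derive (delta_mx ord0 i) sf))
    (vanishes_beyond_derive (delta_mx ord0 i) fr).
  by exists C.
have S0 : 0 <= \sum_i C i by apply: sumr_ge0 => i _; case: (CP i).
exists (n%:R * \sum_i C i); first by rewrite mulr_ge0.
apply: lipschitz_partial => // [x i|x i]; first exact: smooth_derivable.
apply: (le_trans ((CP i).2 x)); rewrite (bigD1 i)//= lerDl.
by apply: sumr_ge0 => j _; case: (CP j).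
Qed.

(** Each leg of the walk costs the variation of a partial derivative, which is Lipschitz because its
    own derivatives are bounded. In the induction [T1] is the rest of the walk from the new base
    point, [T2] the change of base point in the partials, [T3] the leg itself. *)
Lemma smooth_taylor2 f (r : R) : smooth f -> vanishes_beyond r f ->
  exists2 C, 0 <= C & forall x z,
    `|f (z + x) - f x - \sum_i z ord0 i * partial f i x| <= C * `|z| ^+ 2.
Proof.
move=> sf fr.
have /choice[A AP] : forall i : 'I_n, exists C, 0 <= C /\ forall x z,
    `|partial f i (z + x) - partial f i x| <= C * `|z|.
  move=> i; have [C C0 CP] := smooth_lipschitz (smooth_derive (delta_mx ord0 i) sf)
    (vanishes_beyond_derive (delta_mx ord0 i) fr).
  by exists C.
pose A' := \sum_i A i.
have AA' i : A i <= A'.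
  by rewrite /A' (bigD1 i)//= lerDl; apply: sumr_ge0 => j _; case: (AP j).
have A0 : 0 <= A' by apply: sumr_ge0 => i _; case: (AP i).
have AL i x z : `|partial f i (z + x) - partial f i x| <= A' * `|z|.
  by apply: (le_trans ((AP i).2 x z)); rewrite ler_wpM2r.
suff H s : exists2 C, 0 <= C & forall x z,
    `|f (shifted s z x) - f x - \sum_(i <- s) z ord0 i * partial f i x| <= C * `|z| ^+ 2.
  have [C C0 CP] := H (index_enum 'I_n); exists C => // x z.
  by have := CP x z; rewrite shifted_enum.
elim: s => [|i s [C C0 CP]].
  exists 0 => // x z; rewrite /shifted !big_nil add0r subrr subr0 normr0 mul0r//.
exists (C + (size s)%:R * A' + A').
  by rewrite !addr_ge0// mulr_ge0.
move=> x z; rewrite shifted_cons big_cons; set y := _ + x.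
have T1 := CP y z.
have T2 : `|\sum_(j <- s) z ord0 j * (partial f j y - partial f j x)| <=
    (size s)%:R * A' * `|z| ^+ 2.
  rewrite (le_trans (ler_norm_sum _ _ _))// -mulrA mulr_natl.
  rewrite (le_trans (ler_sum _ (G := fun=> A' * `|z| ^+ 2) _))//; last first.
    by rewrite big_const_seq count_predT iter_addr addr0.
  move=> j _; rewrite normrM expr2 mulrCA; apply: ler_pM => //; first exact: coord_le_norm.
  apply: (le_trans (AL j _ _)); rewrite ler_wpM2l//.
  by rewrite (le_trans (norm_scale_delta _ _))// coord_le_norm.
have T3 : `|f y - f x - z ord0 i * partial f i x| <= A' * `|z| ^+ 2.
  have [th thz ->] := @MVT_line _ _ f x (delta_mx ord0 i) (z ord0 i)
    (fun x => @smooth_derivable _ _ _ f x (delta_mx ord0 i) sf).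
  rewrite -mulrBr normrM expr2 mulrCA; apply: ler_pM => //; first exact: coord_le_norm.
  apply: (le_trans (AL i _ _)); rewrite ler_wpM2l//.
  by rewrite (le_trans (norm_scale_delta _ _))// (le_trans thz)// coord_le_norm.
rewrite (_ : _ - _ - _ = (f (shifted s z y) - f y - \sum_(j <- s) z ord0 j * partial f j y) +
  \sum_(j <- s) z ord0 j * (partial f j y - partial f j x) +
  (f y - f x - z ord0 i * partial f i x)); last first.
  have -> : \sum_(j <- s) z ord0 j * (partial f j y - partial f j x) =
      \sum_(j <- s) z ord0 j * partial f j y - \sum_(j <- s) z ord0 j * partial f j x.
    by rewrite -sumrB; apply: eq_bigr => j _; rewrite mulrBr.
  by ring.
rewrite !mulrDl (le_trans (ler_normD _ _))// lerD// (le_trans (ler_normD _ _))// lerD//.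
Qed.

End compactly_supported.

(** * Borel sets of R^n; translations and boxes for Lebesgue measure *)

Section borel_rV.
Context {R : realType}.

Lemma measurable_open_rV m n (A : set 'M[R]_(m, n)) : open A -> measurable A.
Proof. exact: sub_sigma_algebra. Qed.

Lemma continuous_measurable_rV n (f : 'rV[R]_n -> R) :
  continuous f -> measurable_fun setT f.
Proof.
move=> cf; apply: (@measurability _ _ _ _ _ _ (@RGenOInfty.G R)).
  exact: RGenOInfty.measurableE.
move=> _ [_ [a ->] <-]; rewrite setTI; apply: measurable_open_rV.
by apply: open_comp; [move=> x _; exact: cf|exact: interval_open].
Qed.

Lemma measurable_addl_rV n (z : 'rV[R]_n) : measurable_fun setT (fun x : 'rV[R]_n => z + x).
Proof.
apply: measurable_rowP => i.
rewrite (_ : (fun _ => _) = (fun x : 'rV[R]_n => z ord0 i + x ord0 i)).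
  by apply: measurable_funD; [exact: measurable_cst|exact: measurable_coord].
by apply/funext => x; rewrite mxE.
Qed.

Lemma lebesgue_measure_translate (c : R) (A : set (measurableTypeR R)) : measurable A ->
  lebesgue_measure ((fun x => c + x) @^-1` A) = lebesgue_measure A.
Proof.
move=> mA; have mc : measurable_fun [set: measurableTypeR R]
    (fun x => c + x : measurableTypeR R) by exact: measurable_funD.
rewrite -[LHS]/(pushforward lebesgue_measure (fun x : measurableTypeR R => c + x : measurableTypeR R) A).
apply/esym/lebesgue_measure_unique => //= _ [[a b]] _ <-.
rewrite /pushforward (_ : _ @^-1` _ = [set` `](a - c), (b - c)]]); last first.
  by apply/seteqP; split=> x /=; rewrite !in_itv/= => /andP[? ?]; apply/andP; split; lra.
rewrite !lebesgue_measure_itv/= !lte_fin ltrD2r; case: ifPn => // _.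
by rewrite -!EFinB; congr (_%:E); lra.
Qed.

Lemma lebesgue_stepE n (A : set 'rV[R]_n.+1) :
  lebesgue_rV R n.+1 A = (@lebesgue_measure R \x lebesgue_rV R n)%E (@rV_cons R n @^-1` A).
Proof. by []. Qed.

Lemma rV_consD n (a b : R) (x y : 'rV[R]_n) :
  rV_cons (a, x) + rV_cons (b, y) = rV_cons (a + b, x + y).
Proof.
apply/rowP => i; rewrite /rV_cons mxE; case: (@splitP 1 n i) => j ij.
  have -> : i = lshift n j :> 'I_(1 + n) by apply/val_inj; rewrite /= ij.
  rewrite (row_mxEl (const_mx a : 'rV_1) x) (row_mxEl (const_mx b : 'rV_1) y).
  by rewrite [RHS](row_mxEl (const_mx (a + b) : 'rV_1) (x + y)) !mxE.
have -> : i = rshift 1 j :> 'I_(1 + n) by apply/val_inj; rewrite /= ij.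
rewrite (row_mxEr (const_mx a : 'rV_1) x) (row_mxEr (const_mx b : 'rV_1) y).
by rewrite [RHS](row_mxEr (const_mx (a + b) : 'rV_1) (x + y)) !mxE.
Qed.

Lemma rV_cons_surj n (z : 'rV[R]_n.+1) : exists a x, z = rV_cons (a, x).
Proof.
exists (z ord0 ord0), (rsubmx (z : 'rV_(1 + n))).
rewrite /rV_cons; apply: (etrans (esym (hsubmxK (z : 'rV_(1 + n))))); congr row_mx.
by apply/rowP => i; rewrite !mxE; congr (z _ _); apply/val_inj; rewrite (ord1 i).
Qed.

(** By induction on the dimension: a translated rectangle is a product of translated sides, and a
    product measure is determined by its values on rectangles. *)
Lemma lebesgue_rV_translate n (z : 'rV[R]_n) A : measurable A ->
  lebesgue_rV R n ((fun x => z + x) @^-1` A) = lebesgue_rV R n A.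
Proof.
elim: n z A => [|n IH] z A mA.
  congr (lebesgue_rV R 0 _); apply/funext => x /=; congr A.
  by apply/rowP => -[].
rewrite !lebesgue_stepE; have [a [y ->]] := rV_cons_surj z.
have mB : measurable (@rV_cons R n @^-1` A).
  by rewrite -[X in measurable X]setTI; exact: measurable_rV_cons.
pose S (u : measurableTypeR R * 'rV[R]_n) : measurableTypeR R * 'rV[R]_n := (a + u.1, y + u.2).
have mS : measurable_fun setT S.
  apply/measurable_fun_pairP; split.
    by apply: measurable_funD => //; exact: measurable_fst.
  apply: (@measurableT_comp _ _ _ _ _ _ (fun x : 'rV[R]_n => y + x) _ snd) => //.
  exact: measurable_addl_rV.
rewrite (_ : _ @^-1` (_ @^-1` A) = S @^-1` (@rV_cons R n @^-1` A)); last first.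
  by apply/funext => -[b x]; rewrite /preimage/= rV_consD.
rewrite -[LHS]/(pushforward (@lebesgue_measure R \x lebesgue_rV R n)%E S _).
apply/esym/product_measure_unique => //= B C mB' mC.
rewrite /pushforward (_ : S @^-1` _ = ((fun x => a + x) @^-1` B) `*` ((fun x => y + x) @^-1` C)) //.
rewrite -[LHS]/((@lebesgue_measure R \x lebesgue_rV R n)%E _) product_measure1E//.
- by congr (_ * _)%E; [exact: lebesgue_measure_translate|exact: IH].
- by rewrite -[X in measurable X]setTI; exact: measurable_funD.
- rewrite -[X in measurable X]setTI.
  exact: measurable_addl_rV.
Qed.

Lemma rV_cons0 n (a : R) (x : 'rV[R]_n) : rV_cons (a, x) ord0 ord0 = a.
Proof.
rewrite (_ : (ord0 : 'I_n.+1) = lshift n (ord0 : 'I_1) :> 'I_(1 + n)); last exact/val_inj.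
by rewrite [LHS](row_mxEl (const_mx a : 'rV_1)) mxE.
Qed.

Lemma rV_consS n (a : R) (x : 'rV[R]_n) i : rV_cons (a, x) ord0 (lift ord0 i) = x ord0 i.
Proof.
rewrite (_ : lift ord0 i = rshift 1 i :> 'I_(1 + n)); last exact/val_inj.
by rewrite [LHS](row_mxEr (const_mx a : 'rV_1)).
Qed.

Lemma lebesgue_rV_box n (B : 'I_n -> set (measurableTypeR R)) :
  (forall i, measurable (B i)) ->
  measurable [set x : 'rV[R]_n | forall i, B i (x ord0 i)] /\
  lebesgue_rV R n [set x : 'rV[R]_n | forall i, B i (x ord0 i)] =
  (\prod_(i < n) lebesgue_measure (B i))%E.
Proof.
move=> mB; have mbox m (C : 'I_m -> set (measurableTypeR R)) : (forall i, measurable (C i)) ->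
    measurable [set x : 'rV[R]_m | forall i, C i (x ord0 i)].
  move=> mC; rewrite (_ : [set _ | _] = \bigcap_(i in [set: 'I_m]) ((fun x : 'rV[R]_m => x ord0 i) @^-1` C i)).
    apply: fin_bigcap_measurable => // i _.
    by rewrite -[X in measurable X]setTI; apply: measurable_coord => //; exact: mC.
  by apply/seteqP; split=> x /= H i => [_|]; apply: H.
split; first exact: mbox.
elim: n B mB => [|n IH] B mB.
  by rewrite big_ord0 /= diracE mem_set// => -[].
rewrite big_ord_recl lebesgue_stepE; pose C (i : 'I_n) := B (lift ord0 i).
rewrite (_ : _ @^-1` _ = B ord0 `*` [set x : 'rV[R]_n | forall i, C i (x ord0 i)]).
  have mC i : measurable (C i) by exact: mB.
  rewrite product_measure1E; [|exact: mB|exact: mbox].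
  by congr (_ * _)%E; exact: (IH C mC).
apply/seteqP; split=> -[a x]/=.
  move=> H; split=> [|i]; first by have := H ord0; rewrite rV_cons0.
  by have := H (lift ord0 i); rewrite rV_consS.
move=> [Ha Hx] i; case: (unliftP ord0 i) => [j ->|->]; last by rewrite rV_cons0.
by rewrite rV_consS; exact: Hx.
Qed.

End borel_rV.

(** * Smoothing by a compactly supported kernel *)

Section mollifier.
Context {R : realType} {n : nat}.
Implicit Types (f g k a b : 'rV[R]_n -> R) (x y z u : 'rV[R]_n).

Local Notation leb := (lebesgue_rV R n).

Lemma norm_le_coord x (r : R) : 0 <= r -> (forall i, `|x ord0 i| <= r) -> `|x| <= r.
Proof.
move=> r0 xr; rewrite /Num.norm/= mx_normrE; apply: bigmax_le => // -[i j] _ /=.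
by rewrite (ord1 i).
Qed.

Definition cube (r : R) : set 'rV[R]_n := [set x | forall i, `[- r, r]%classic (x ord0 i)].

Lemma measurable_cube r : measurable (cube r).
Proof.
by apply: (@lebesgue_rV_box _ _ (fun=> `[- r, r]%classic) _).1 => i; exact: measurable_itv.
Qed.

Lemma lebesgue_cube_lty r : (leb (cube r) < +oo)%E.
Proof.
have [|_ ->] := @lebesgue_rV_box R n (fun=> `[- r, r]%classic).
  by move=> i; exact: measurable_itv.
rewrite (eq_bigr (fun=> (fine (lebesgue_measure (`[- r, r]%classic : set R)))%:E)).
  by rewrite prodEFin ltry.
move=> i _; rewrite fineK// lebesgue_measure_itv/=; case: ifP => // _.
Qed.

Lemma vanishes_cube f (r : R) x : vanishes_beyond r f -> ~ cube r x -> f x = 0.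
Proof.
move=> fr; rewrite /cube/= => H; apply: fr; rewrite ltNge; apply/negP => xr; apply: H => i.
by rewrite in_itv/= -ler_norml (le_trans (coord_le_norm _ _)).
Qed.

Definition cube_volume (r : R) : R := fine (leb (cube r)).

Lemma cube_volume_ge0 r : 0 <= cube_volume r.
Proof. exact: fine_ge0. Qed.

Lemma integrable_vanishing f (r C : R) : measurable_fun setT f ->
  vanishes_beyond r f -> (forall x, `|f x| <= C) ->
  leb.-integrable setT (EFin \o f) /\ `|\int[leb]_x f x| <= C * cube_volume r.
Proof.
move=> mf fr fC.
have fcube : f = f \_ (cube r).
  apply/funext => x; rewrite patchE; case: ifPn => // /negP H.
  by apply: vanishes_cube fr _ => Hx; apply: H; rewrite inE.
have intc : leb.-integrable (cube r) (EFin \o f).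
  apply: measurable_bounded_integrable.
  - exact: measurable_cube.
  - exact: lebesgue_cube_lty.
  - exact: measurable_funTS.
  - exists C; split; first exact: num_real.
    by move=> y Cy x _; exact: le_trans (fC x) (ltW Cy).
split.
  have := (integrable_mkcond (EFin \o f) (measurable_cube r)).1 intc.
  by rewrite restrict_EFin -fcube.
rewrite fcube -Rintegral_mkcond.
apply: (le_trans (le_normr_Rintegral (measurable_cube r) intc)).
rewrite -(Rintegral_cst _ (measurable_cube r)).
apply: le_Rintegral; first exact: measurable_cube.
- exact: integrable_norm.
- apply: measurable_bounded_integrable; [exact: measurable_cube|exact: lebesgue_cube_lty| |].
    exact: measurable_cst.
  exists `|C|; split; first exact: num_real.
  by move=> y Cy x _; exact: ltW.
- by move=> x _; exact: fC.
Qed.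

Lemma integrable_continuous_vanishing f (r : R) : contn f -> vanishes_beyond r f ->
  leb.-integrable setT (EFin \o f).
Proof.
move=> cf fr; have [C _ fC] := vanishing_bounded cf fr.
by have [] := integrable_vanishing (continuous_measurable_rV cf) fr fC.
Qed.

Lemma vanishes_beyondMr r k g : vanishes_beyond r g -> vanishes_beyond r (fun x => k x * g x).
Proof. by move=> gr x /gr ->; rewrite mulr0. Qed.

Lemma vanishes_beyondMl r k g : vanishes_beyond r g -> vanishes_beyond r (fun x => g x * k x).
Proof. by move=> gr x /gr ->; rewrite mul0r. Qed.

Section convolution.
Variables (g : 'rV[R]_n -> R) (rg : R).
Hypotheses (cg : contn g) (gr : vanishes_beyond rg g).

(** With the kernel at [y - x], [conv g rho x] averages g(u + x) against rho(u) without reflecting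
    [rho]; the price is a sign in the derivatives. As [x] enters through the kernel alone, [g] need
    only be continuous. *)
Definition conv k x : R := \int[leb]_y (k (y - x) * g y).

Lemma conv_integrable k : contn k -> leb.-integrable setT (EFin \o (fun y => k y * g y)).
Proof.
move=> ck; apply: (@integrable_continuous_vanishing _ rg).
  exact: contnM.
exact: vanishes_beyondMr.
Qed.

Lemma conv_bound : exists2 A, 0 <= A & forall k (D : R), contn k ->
  (forall x, `|k x| <= D) -> `|\int[leb]_y (k y * g y)| <= D * A.
Proof.
have [C C0 gC] := vanishing_bounded cg gr.
exists (C * cube_volume rg); first by rewrite mulr_ge0// cube_volume_ge0.
move=> k D ck kD; rewrite mulrA.
apply: (@integrable_vanishing (fun y => k y * g y) rg (D * C) _ _ _).2.
- by apply: continuous_measurable_rV; exact: (contnM ck cg).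
- exact: vanishes_beyondMr.
- by move=> x; rewrite normrM ler_pM.
Qed.

Lemma conv_smooth k r : smooth k -> vanishes_beyond r k -> smooth (conv k).
Proof.
move=> sk kr; have [A A0 AP] := conv_bound.
(* Differentiation under the integral without dominated convergence: the difference quotient of the
   kernel is within C |u| |h| of its limit, uniformly in [y]. *)
have key l s x u : smooth l -> vanishes_beyond s l ->
  is_derive x u (conv l) (conv (fun y => -1 * 'D_u l y) x).
  move=> sl ls; have sD := smooth_derive u sl.
  have [C C0 CP] := smooth_lipschitz sD (vanishes_beyond_derive u ls).
  have cv : (fun h : R => h^-1 *: ((conv l \o shift x) (h *: u) - conv l x)) @ 0^' -->
      (conv (fun y => -1 * 'D_u l y) x).
    have B0 : 0 < C * `|u| * A + 1 by rewrite ltr_wpDl// !mulr_ge0.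
    apply/cvgrPdist_le => e e0; near=> h.
    have hN0 : h != 0 by near: h; exact: nbhs_dnbhs_neq.
    pose q y := -1 * 'D_u l (y - x) - h^-1 * (l (y - (h *: u + x)) - l (y - x)).
    have cl z : contn (fun y => l (y - z)).
      exact/contn_translate/smooth_contn.
    have cD : contn (fun y => -1 * 'D_u l (y - x)).
      apply: (@contn_translate _ _ (fun y => -1 * 'D_u l y) (- x)).
      by apply: contnM; [exact: contn_cst|exact: smooth_contn].
    have cdl : contn (fun y => l (y - (h *: u + x)) - l (y - x)).
      by apply: contnB; exact: cl.
    have cq2 : contn (fun y => h^-1 * (l (y - (h *: u + x)) - l (y - x))).
      by apply: contnM => //; exact: contn_cst.
    have cq : contn q by apply: contnB; [exact: cD|exact: cq2].
    have -> : conv (fun y => -1 * 'D_u l y) x -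
        h^-1 *: ((conv l \o shift x) (h *: u) - conv l x) = \int[leb]_y (q y * g y).
      rewrite /conv /= -RintegralB//; try exact: conv_integrable.
      rewrite -[h^-1 *: _]/(h^-1 * _) -RintegralZl//; last first.
        have := conv_integrable cdl.
        by apply: eq_integrable => // y _ /=; rewrite mulrBl.
      rewrite -RintegralB//; first last.
      - have := conv_integrable cq2.
        by apply: eq_integrable => // y _ /=; rewrite -mulrBl mulrA.
      - exact: (conv_integrable cD).
      - by apply: eq_Rintegral => y _; rewrite /q; ring.
    apply: (le_trans (AP q (C * `|u| * `|h|) cq _)).
      move=> y; rewrite /q opprD addrA -(addrAC y (- x)) [y - x - _]addrC -[- (h *: u)]scaleNr.
      have [th thh ->] := @MVT_line _ _ l (y - x) u (- h)
        (fun x => @smooth_derivable _ _ _ l x u sl).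
      rewrite mulrA mulrN mulVf// -mulrBr normrM normrN1 mul1r distrC.
      apply: (le_trans (CP _ _)); rewrite -mulrA ler_wpM2l// normrZ mulrC ler_wpM2l//.
      by rewrite normrN in thh.
    have he : `|h| <= e / (C * `|u| * A + 1) by near: h; apply: dnbhs0_le; rewrite divr_gt0.
    rewrite mulrAC; move: he; rewrite ler_pdivlMr// mulrC; apply: le_trans.
    by rewrite ler_wpM2r// lerDl.
  by apply: DeriveDef; [apply/cvg_ex; eexists; exact: cv|exact: cvg_lim cv].
apply: (@smooth_coind _ _ _ [set f | exists l, smooth l /\ (exists s, vanishes_beyond s l) /\ f = conv l]).
- move=> _ [l [sl [[s ls] ->]]].
  have [C C0 CP] := smooth_lipschitz sl ls.
  apply: (@lipschitz_contn _ _ _ (C * A)) => x z; rewrite /conv.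
  have cl w : contn (fun y => l (y - w)).
    exact/contn_translate/smooth_contn.
  rewrite -RintegralB//; try exact: (conv_integrable (cl _)).
  rewrite (@eq_Rintegral _ _ _ leb setT (fun y => (l (y - (z + x)) - l (y - x)) * g y)); last first.
    by move=> y _; rewrite mulrBl.
  rewrite mulrAC; apply: AP.
    by apply: contnB; exact: cl.
  move=> y; rewrite opprD addrA -(addrAC y (- x)) [y - x - _]addrC.
  by rewrite (le_trans (CP _ _))// normrN.
- by move=> _ x u [l [sl [[s ls] ->]]]; have [] := key l s x u sl ls.
- move=> _ u [l [sl [[s ls] ->]]]; exists (fun y => -1 * 'D_u l y); split.
    exact/smoothZ/smooth_derive.
  split; last first.
    by apply/funext => x; rewrite (@derive_val _ _ _ _ _ _ _ (key l s x u sl ls)).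
  by exists s; apply/vanishes_beyondMr/vanishes_beyond_derive.
- by exists k; split => //; split => //; exists r.
Unshelve. all: by end_near. Qed.

Lemma conv_vanishes k r : vanishes_beyond r k -> vanishes_beyond (r + rg) (conv k).
Proof.
move=> kr x xr; rewrite /conv (@eq_Rintegral _ _ _ leb setT (fun=> 0)); last first.
  move=> y _; have [ry|yr] := ltP rg `|y|; first by rewrite gr// mulr0.
  rewrite kr ?mul0r//; have := ler_normB y (y - x).
  by rewrite opprB addrCA subrr addr0; lra.
by rewrite Rintegral_cst// mul0r.
Qed.

End convolution.
End mollifier.

(** * Averages against a mollifier *)

Section mollification.
Context {R : realType} {n : nat}.
Implicit Types (f g a b : 'rV[R]_n -> R) (x y z u : 'rV[R]_n).

Local Notation leb := (lebesgue_rV R n).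

Record mollifier (kappa : R) (rho : 'rV[R]_n -> R) : Prop := Mollifier {
  mollifier_smooth : smooth rho ;
  mollifier_vanishes : vanishes_beyond kappa rho ;
  mollifier_ge0 : forall x, 0 <= rho x ;
  mollifier_mass : \int[leb]_x rho x = 1 }.

Lemma mollifier_exists (kappa : R) : 0 < kappa -> exists rho, mollifier kappa rho.
Proof.
move=> k0; pose rho0 (x : 'rV[R]_n) := \prod_(i < n) bump (x ord0 i / kappa).
have s0 : smooth rho0.
  apply: (@smooth_prod _ _ _ (index_enum 'I_n) (fun i x => bump (x ord0 i / kappa))) => i.
  apply: (@smooth_affine _ _ _ _ (@bump R) (fun x : 'rV[R]_n => x ord0 i / kappa)
    (fun u : 'rV[R]_n => u ord0 i / kappa)).
  - apply: contnM; last exact: contn_cst.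
    by apply: (@lipschitz_contn _ _ _ 1) => x z; rewrite mxE addrK mul1r coord_le_norm.
  - by move=> h u x; rewrite !mxE mulrDl -[h *: _]/(h * _) mulrA.
  - exact: smooth_bump.
have v0 : vanishes_beyond kappa rho0.
  move=> x kx; have [i ki] : exists i, kappa < `|x ord0 i|.
    apply/not_existsP => H; move: kx; apply/negP; rewrite -leNgt.
    by apply: norm_le_coord => [|i]; [exact: ltW|rewrite leNgt; apply/negP; exact: H].
  rewrite /rho0 (bigD1 i)//= bump_eq0 ?mul0r//.
  move: ki; rewrite ltr_normr => /orP[h|h]; [right|left].
    by rewrite ler_pdivlMr// mul1r ltW.
  by rewrite ler_pdivrMr// mul0r; lra.
have p0 x : 0 <= rho0 x by apply: prodr_ge0 => i _; exact: bump_ge0.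
have i0 : leb.-integrable setT (EFin \o rho0).
  exact: integrable_continuous_vanishing (smooth_contn s0) v0.
pose m := \int[leb]_x rho0 x.
have m0 : 0 < m.
  (* If the mass were 0, [rho0] would vanish almost everywhere; but it is positive on the open box
     of side [kappa], whose volume is positive. *)
  rewrite lt_neqAle eq_sym Rintegral_ge0// andbT; apply/eqP => m0.
  have I0 : (\int[leb]_x (EFin \o rho0) x = 0)%E.
    rewrite -[LHS]fineK; first by rewrite -[fine _]/m m0.
    exact: (integrable_fin_num measurableT i0).
  have I1 : (\int[leb]_x `|(EFin \o rho0) x| = 0)%E.
    by rewrite -I0; apply: eq_integral => x _; rewrite gee0_abs// lee_fin.
  have := (ae_eq_integral_abs leb measurableT (measurable_int _ i0)).1 I1.
  move=> [N [mN N0 sub]].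
  have [mB BE] := @lebesgue_rV_box R n (fun=> `]0, kappa[%classic) (fun=> measurable_itv _).
  have BN : [set x : 'rV[R]_n | forall i, `]0, kappa[%classic (x ord0 i)] `<=` N.
    move=> x Bx; apply: sub => /= /(_ I); rewrite /cst => -[r0].
    suff : 0 < rho0 x by rewrite r0 ltxx.
    apply: prodr_gt0 => i _; rewrite bump_gt0; have := Bx i; rewrite /= in_itv/= => /andP[h1 h2].
    by rewrite divr_gt0// ltr_pdivrMr// mul1r.
  pose B := [set x : 'rV[R]_n | forall i, `]0, kappa[%classic (x ord0 i)].
  have : (leb B <= leb N)%E by exact: (le_measure leb (mem_set mB) (mem_set mN) BN).
  rewrite N0 BE (eq_bigr (fun=> kappa%:E)); last first.
    by move=> i _; rewrite lebesgue_measure_itv/= lte_fin k0 sube0.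
  rewrite prodEFin lee_fin leNgt => /negP; apply.
  by rewrite prodr_gt0.
exists (fun x => m^-1 * rho0 x); split.
- exact: smoothZ.
- exact: vanishes_beyondMr.
- by move=> x; rewrite mulr_ge0// invr_ge0 ltW.
- by rewrite RintegralZl//= mulVf// gt_eqF.
Qed.

Variables (kappa : R) (rho : 'rV[R]_n -> R).
Hypothesis mrho : mollifier kappa rho.

Let crho : contn rho := smooth_contn (mollifier_smooth mrho).

Lemma mollifier_integrable a : contn a -> leb.-integrable setT (EFin \o (fun x => rho x * a x)).
Proof.
move=> ca; apply: (@integrable_continuous_vanishing _ _ _ kappa); first exact: contnM.
exact: vanishes_beyondMl (mollifier_vanishes mrho).
Qed.

Lemma mollifier_average_close a b (D : R) : contn a -> contn b ->
  (forall u, `|u| <= kappa -> `|a u - b u| <= D) ->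
  `|\int[leb]_u (rho u * a u) - \int[leb]_u (rho u * b u)| <= D.
Proof.
move=> ca cb ab.
rewrite -RintegralB//; [|exact: mollifier_integrable|exact: mollifier_integrable].
have ci : leb.-integrable setT (EFin \o (fun x => rho x * a x - rho x * b x)).
  have := mollifier_integrable (contnB ca cb).
  by apply: eq_integrable => // y _ /=; rewrite mulrBr.
have rD : leb.-integrable setT (EFin \o (fun x => rho x * D)).
  exact: (mollifier_integrable (@contn_cst _ _ D)).
apply: (le_trans (le_normr_Rintegral measurableT ci)).
apply: (@le_trans _ _ (\int[leb]_x (rho x * D))).
  apply: le_Rintegral => //; first exact: integrable_norm.
  move=> x _ /=; rewrite -mulrBr normrM (ger0_norm (mollifier_ge0 mrho x)).
  have [kx|xk] := ltP kappa `|x|.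
    by rewrite (mollifier_vanishes mrho kx) !mul0r.
  by rewrite ler_wpM2l ?(mollifier_ge0 mrho)// ab.
rewrite RintegralZr// ?(mollifier_mass mrho) ?mul1r//.
exact: integrable_continuous_vanishing crho (mollifier_vanishes mrho).
Qed.

Lemma mollifier_average_cst (c : R) : \int[leb]_u (rho u * c) = c.
Proof.
rewrite RintegralZr// ?(mollifier_mass mrho) ?mul1r//.
exact: integrable_continuous_vanishing crho (mollifier_vanishes mrho).
Qed.

(** Translation invariance, through the change of variables for nonnegative integrands; this is
    where the sign condition on the functions [phi] below originates. *)
Lemma conv_translate g x : contn g -> (forall y, 0 <= g y) ->
  conv g rho x = \int[leb]_u (rho u * g (u + x)).
Proof.
move=> cg g0; pose f y := rho (y - x) * g y.
have f0 y : 0 <= f y by rewrite mulr_ge0// (mollifier_ge0 mrho).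
have mf : measurable_fun setT f.
  apply: continuous_measurable_rV; apply: contnM => //.
  exact: contn_translate.
rewrite /conv; congr fine.
have mx := measurable_addl_rV x; pose T u : 'rV[R]_n := x + u.
transitivity (\int[pushforward leb T]_y (f y)%:E)%E.
  by apply: eq_measure_integral => A mA _; exact/esym/lebesgue_rV_translate.
rewrite ge0_integral_pushforward//.
- by rewrite preimage_setT; apply: eq_integral => u _ /=; rewrite /f /T [x + u]addrC addrK.
- exact/measurable_EFinP.
- by move=> y _; rewrite lee_fin.
Qed.

Lemma conv_close g1 g2 x1 x2 (D : R) : contn g1 -> contn g2 ->
  (forall y, 0 <= g1 y) -> (forall y, 0 <= g2 y) ->
  (forall u, `|u| <= kappa -> `|g1 (u + x1) - g2 (u + x2)| <= D) ->
  `|conv g1 rho x1 - conv g2 rho x2| <= D.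
Proof.
move=> c1 c2 p1 p2 H; rewrite !conv_translate//.
by apply: mollifier_average_close => //; exact: contn_translate.
Qed.

Lemma conv_approx g x (D : R) : contn g -> (forall y, 0 <= g y) ->
  (forall u, `|u| <= kappa -> `|g (u + x) - g x| <= D) ->
  `|conv g rho x - g x| <= D.
Proof.
move=> cg p H; rewrite conv_translate// -[X in _ - X]mollifier_average_cst.
by apply: mollifier_average_close => //; [exact: contn_translate|exact: contn_cst].
Qed.

End mollification.

(** * Measure solutions and characteristics *)

Section weak_derivative.
Context {R : realType}.
Implicit Types (f F G : R -> R).

Lemma is_derive0_cst f (a b : R) : a <= b ->
  (forall t, a <= t <= b -> is_derive t (1 : R) f 0) -> f b = f a.
Proof.
move=> ab f0; apply/eqP; rewrite eq_le; apply/andP; split.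
  by apply: (@le_is_derive _ f (fun=> 0)).
rewrite -lerN2; apply: (@le_is_derive _ (- f) (fun=> 0)) => // t tab.
by rewrite -oppr0; have := f0 t tab => ?; exact: is_deriveN.
Qed.

Lemma is_derive_compN f (t d : R) : is_derive (- t) (1 : R) f d ->
  is_derive t (1 : R) (fun s => - f (- s)) d.
Proof.
move=> df; have := @is_derive1_comp _ f (fun s => - s) t _ _ df (is_deriveNid t 1).
move=> H; have := @is_deriveN _ _ _ _ t 1 _ H.
by rewrite mulrN1 opprK; apply.
Qed.

(** An antiderivative valid to the right of -1 and a reflected one valid to the left of 1 differ by
    a constant on [-1, 1]; they are glued at 0, inside the overlap. *)
Lemma antiderivativeT f (a : R) : continuous f ->
  exists2 F, F a = 0 & forall t, is_derive t (1 : R) F (f t).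
Proof.
move=> cf; suff [F dF] : exists F, forall t, is_derive t (1 : R) F (f t).
  exists (fun t => F t - F a); first by rewrite subrr.
  by move=> t; rewrite -[f t]subr0; apply: is_deriveB.
have [F1 _ d1] := antiderivative (- 1) cf.
have cfN : continuous (fun t => f (- t)).
  by move=> t; apply: (@continuous_comp _ _ _ -%R f); [exact: opp_continuous|exact: cf].
have [F2 _ d2] := antiderivative (- 1) cfN.
have d2N (t : R) : t <= 1 -> is_derive t (1 : R) (fun s => - F2 (- s)) (f t).
  by move=> t1; apply: is_derive_compN; rewrite -{2}[t]opprK; apply: d2; rewrite lerN2.
have E t : -1 <= t <= 1 -> F1 t = - F2 (- t) + (F1 (- 1) + F2 1).
  move=> /andP[t0 t1]; have := @is_derive0_cst (fun s => F1 s - - F2 (- s)) (- 1) t t0.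
  rewrite opprK opprK => H; have {H} : F1 t + F2 (- t) = F1 (-1) + F2 1.
    have := H; rewrite opprK; apply => s /andP[s0 st].
    have ? := d1 s s0; have ? := d2N s (le_trans st t1).
    by apply: is_derive_eq; rewrite subrr.
  by move=> H2; rewrite -H2; ring.
exists (fun t => if t < 0 then - F2 (- t) + (F1 (- 1) + F2 1) else F1 t) => t.
have [t0|t0] := ltP t 0.
  suff : is_derive t (1 : R) (fun t => - F2 (- t) + (F1 (- 1) + F2 1)) (f t).
    by apply: near_eq_is_derive; near=> s; rewrite ifT//; near: s; exact: lt_nbhsl.
  have ? := d2N t (le_trans (ltW t0) ler01).
  rewrite -[f t]addr0; exact: is_deriveD.
have t1 : - 1 < t by rewrite (lt_le_trans _ t0)// ltrN10.
have := d1 t (ltW t1); apply: near_eq_is_derive; near=> s.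
case: ifPn => // s0; apply: E; apply/andP; split.
  by apply: ltW; near: s; exact: lt_nbhsr.
by rewrite (le_trans (ltW s0)).
Unshelve. all: by end_near. Qed.

Lemma smooth_antiderivative f F : smooth f ->
  (forall t, is_derive t (1 : R) F (f t)) -> smooth F.
Proof.
move=> sf dF [|k]; first by move=> t; exact: is_derive_continuous (dF t).
have H t u : derivable F t u /\ 'D_u F t = u * f t.
  by have [dt <-] := dF t; exact: derive_scalar.
split=> [t u|u]; first by case: (H t u).
rewrite [X in class_C k X](_ : _ = fun t => u * f t); first exact: (smoothZ u sf).
by apply/funext => t; case: (H t u).
Qed.

(* the smooth step [B] climbs from 0 to m on [0, kappa] *)
Lemma smooth_step (kappa : R) : 0 < kappa -> exists (m : R) (B b : R -> R),
  [/\ 0 < m, smooth B, forall t, is_derive t (1 : R) B (b t) &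
   [/\ continuous b, forall t, 0 <= b t, forall t, t <= 0 \/ kappa <= t -> b t = 0,
    forall t, t <= 0 -> B t = 0 & forall t, kappa <= t -> B t = m]].
Proof.
move=> k0; pose b := @bump R \o (fun t : R => t / kappa).
have sb : smooth b.
  apply: (@smooth_affine _ R R R (@bump R) (fun t : R => t / kappa) (fun t : R => t / kappa)).
  - by move=> t; apply: cvgM; [exact: cvg_id|exact: cvg_cst].
  - by move=> h u x; rewrite mulrDl -[h *: u]/(h * u) -[h *: _]/(h * _) mulrA.
  - exact: smooth_bump.
have b0 t : t <= 0 \/ kappa <= t -> b t = 0.
  move=> H; apply: bump_eq0; case: H => h; [left|right].
    by rewrite ler_pdivrMr// mul0r.
  by rewrite ler_pdivlMr// mul1r.
have [B B0 dB] := antiderivativeT 0 (smooth_continuous sb).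
have Bl t : t <= 0 -> B t = 0.
  move=> t0; rewrite -B0; apply/esym/is_derive0_cst => // s /andP[_ s0].
  by rewrite -(b0 s); [exact: dB|left].
have Br t : kappa <= t -> B t = B kappa.
  move=> tk; apply: is_derive0_cst => // s /andP[ks _].
  by rewrite -(b0 s); [exact: dB|right].
exists (B kappa), B, b; split => //.
- rewrite -[X in X < _]B0; apply: (@gtr0_derive1_incr _ B 0 kappa) => //.
  + move=> t; rewrite in_itv/= => /andP[t0 tk].
    rewrite derive1E (@derive_val _ _ _ _ _ _ _ (dB t)) /b/= bump_gt0.
    by rewrite divr_gt0// ltr_pdivrMr// mul1r.
  + by apply: continuous_subspaceT => t; exact: is_derive_continuous (dB t).
- exact: smooth_antiderivative dB.
- by split => //; [exact: smooth_continuous|move=> t; exact: bump_ge0].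
Qed.

Lemma integrable_segment f (a b : R) : continuous f ->
  lebesgue_measure.-integrable `[a, b] (EFin \o f).
Proof.
move=> cf; apply: continuous_compact_integrable; first exact: segment_compact.
exact: continuous_subspaceT.
Qed.

Lemma Rintegral_is_derive f F (a b : R) : a < b -> continuous f ->
  (forall t, is_derive t (1 : R) F (f t)) ->
  \int[lebesgue_measure]_(t in `[a, b]) f t = F b - F a.
Proof.
move=> ab cf dF; have cF : continuous F by move=> t; exact: is_derive_continuous (dF t).
rewrite /Rintegral (@continuous_FTC2 _ f F)//.
- exact: continuous_subspaceT.
- split.
  + by move=> t _; case: (dF t).
  + exact: cvg_at_right_filter (cF a).
  + exact: cvg_at_left_filter (cF b).
- by move=> t _; rewrite derive1E (@derive_val _ _ _ _ _ _ _ (dF t)).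
Qed.

Definition time_test (T : R) (eta : R -> R) := smooth eta /\
  exists a b, [/\ 0 < a, b < T & forall t, t < a \/ b < t -> eta t = 0].

Lemma weighted_average_close (x y z e : R) (w H : R -> R) : continuous w -> continuous H ->
  (forall r, 0 <= w r) -> (forall r, w r != 0 -> `|H r - z| <= e) ->
  `|\int[lebesgue_measure]_(r in `[x, y]) (w r * H r) -
    (\int[lebesgue_measure]_(r in `[x, y]) w r) * z| <=
  (\int[lebesgue_measure]_(r in `[x, y]) w r) * e.
Proof.
move=> cw cH w0 wH.
have cM (f g : R -> R) : continuous f -> continuous g -> continuous (fun r => f r * g r).
  by move=> cf cg r; apply: cvgM; [exact: cf|exact: cg].
have cK k : continuous (fun r => w r * k) by apply: cM => // r; exact: cvg_cst.
rewrite -!RintegralZr//; [|exact: integrable_segment..].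
rewrite -RintegralB//; [|by apply: integrable_segment; exact: cM|exact: integrable_segment].
have ci : continuous (fun r => w r * H r - w r * z).
  by move=> r; apply: cvgB; [exact: cM|exact: cK].
have h := @le_normr_Rintegral _ _ _ lebesgue_measure _ _ (measurable_itv _) (integrable_segment x y ci).
apply: (le_trans h).
apply: le_Rintegral => //.
- by apply: integrable_norm; exact: integrable_segment.
- exact: integrable_segment.
move=> r _; rewrite -mulrBr normrM (ger0_norm (w0 _)).
have [->|h2] := eqVneq (w r) 0; first by rewrite !mul0r.
by rewrite ler_wpM2l//; exact: wH.
Qed.

(** The du Bois-Reymond lemma. The test function is the difference of two smooth steps; its
    derivative consists of two bumps of equal mass just to the right of [s] and [t], so that local
    averages of [H] there agree. [kappa] keeps the bumps inside the continuity scales of [H] and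
    before [T]. *)
Lemma constant_of_weak_derivative0 (T : R) (H : R -> R) : continuous H ->
  (forall eta, time_test T eta ->
    \int[lebesgue_measure]_(t in `[0, T]) ('D_1 eta t * H t) = 0) ->
  forall s t, 0 < s < T -> 0 < t < T -> H s = H t.
Proof.
move=> cH H0.
suff key s t e : 0 < s -> s <= t -> t < T -> 0 < e -> `|H s - H t| <= 2 * e.
  have key2 s t : 0 < s -> s <= t -> t < T -> H s = H t.
    move=> s0 st tT; apply/eqP; rewrite -subr_eq0 -normr_le0.
    apply/ler_addgt0Pr => e e0; rewrite add0r.
    by have := @key s t (e / 2) s0 st tT; rewrite mulrCA mulfV// mulr1; apply; rewrite divr_gt0.
  move=> s t /andP[s0 sT] /andP[t0 tT]; have [st|/ltW ts] := leP s t; first exact: key2.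
  by apply/esym; exact: key2.
move=> s0 st tT e0.
have near_ r : exists2 d, 0 < d & forall q, `|q - r| < d -> `|H q - H r| <= e.
  have /cvgrPdist_le/(_ _ e0)/nbhs_ballP[d /= d0 dP] := cH r.
  by exists d => // q qr; rewrite distrC; apply: dP; rewrite /ball/= distrC.
have [ds ds0 dsP] := near_ s; have [dt dt0 dtP] := near_ t.
pose kappa := Num.min (ds / 2) (Num.min (dt / 2) ((T - t) / 2)).
have k0 : 0 < kappa by rewrite !lt_min !divr_gt0// subr_gt0.
have [ks kt kT] : [/\ kappa < ds, kappa < dt & t + kappa < T].
  have h1 : kappa <= ds / 2 by rewrite ge_min lexx.
  have h2 : kappa <= dt / 2 by rewrite !ge_min lexx orbT.
  have h3 : kappa <= (T - t) / 2 by rewrite !ge_min lexx !orbT.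
  by split; lra.
have [m [B [b [m0 sB dB [cb b0 bout Bl Br]]]]] := smooth_step k0.
have shift_cont (c : R) : continuous (fun r : R => r - c).
  by move=> r; apply: cvgB; [exact: cvg_id|exact: cvg_cst].
have cbs c : continuous (fun r => b (r - c)).
  by move=> r; apply: (@continuous_comp _ _ _ (fun r => r - c) b); [exact: shift_cont|exact: cb].
have dBs c r : is_derive r (1 : R) (fun r => B (r - c)) (b (r - c)).
  have d1 : is_derive r (1 : R) (fun r => r - c) 1.
    by rewrite -[X in is_derive _ _ _ X]subr0; exact: is_deriveB.
  by have := @is_derive1_comp _ B (fun r => r - c) r _ _ (dB _) d1; rewrite mulr1.
have sBs c : smooth (fun r => B (r - c)).
  apply: (@smooth_affine _ _ _ _ B (fun r => r - c) id) => //.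
  by move=> h u x; rewrite addrA.
pose eta r := B (r - s) - B (r - t).
have T0 : 0 < T by rewrite (lt_le_trans s0)// (le_trans st)// ltW.
have seta : smooth eta.
  rewrite (_ : eta = (fun r => B (r - s)) + (fun r => -1 * B (r - t))).
    by move=> k; apply: class_CD; [exact: sBs|exact: (smoothZ (-1) (sBs t))].
  by apply/funext => r; rewrite /eta !fctE mulN1r.
have teta : time_test T eta.
  split=> //; exists s, (t + kappa); split => // r [rs|rt]; rewrite /eta.
    by rewrite !Bl ?subrr//; lra.
  by rewrite !Br ?subrr//; lra.
have deta r : 'D_1 eta r = b (r - s) - b (r - t).
  have := @is_deriveB _ _ _ _ _ r 1 _ _ (dBs s r) (dBs t r).
  by move=> H1; rewrite (@derive_val _ _ _ _ _ _ _ H1).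
have I0 := H0 _ teta.
have mass c : 0 < c -> c + kappa < T -> \int[lebesgue_measure]_(r in `[0, T]) b (r - c) = m.
  move=> c0 cT; rewrite (Rintegral_is_derive T0 (cbs c) (dBs c)).
  by rewrite Br ?Bl ?subr0//; lra.
have cbH c : continuous (fun r => b (r - c) * H r).
  by move=> r; apply: cvgM; [exact: cbs|exact: cH].
have close c d : 0 < c -> c + kappa < T -> kappa < d ->
    (forall q, `|q - c| < d -> `|H q - H c| <= e) ->
    `|\int[lebesgue_measure]_(r in `[0, T]) (b (r - c) * H r) - m * H c| <= m * e.
  move=> c0 cT kd HP; rewrite -(mass c c0 cT).
  apply: weighted_average_close => // r.
  have [h|h] := boolP ((r - c <= 0) || (kappa <= r - c)).
    by rewrite bout ?eqxx//; exact/orP.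
  move=> _; apply: HP; move: h; rewrite negb_or -!ltNge => /andP[h1 h2].
  by rewrite gtr0_norm// (lt_trans h2).
have C1 := close s ds s0 _ ks dsP; have C2 := close t dt (lt_le_trans s0 st) kT kt dtP.
have {}C1 : `|\int[lebesgue_measure]_(r in `[0, T]) (b (r - s) * H r) - m * H s| <= m * e.
  by apply: C1; rewrite (le_lt_trans _ kT)// lerD2r.
move: I0; rewrite (@eq_Rintegral _ _ _ lebesgue_measure _
  (fun r => b (r - s) * H r - b (r - t) * H r)); last first.
  by move=> r _; rewrite deta mulrBl.
rewrite RintegralB//; [|exact: integrable_segment..] => I0.
rewrite -(ler_pM2l m0) -{1}(gtr0_norm m0) -normrM.
by move: C1 C2; rewrite !ler_norml; lra.
Qed.

(** [F] minus an antiderivative of [G] has zero weak derivative. Test functions see only the open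
    interval, so continuity carries the constancy to 0 and [T]; the endpoint 0 is where the initial
    datum sits. *)
Lemma weak_derivative (T : R) F G : 0 < T -> continuous F -> continuous G ->
  (forall eta, time_test T eta ->
    \int[lebesgue_measure]_(t in `[0, T]) ('D_1 eta t * F t + eta t * G t) = 0) ->
  forall (s t c e : R), 0 <= s <= T -> 0 <= t <= T -> s <= t ->
    (forall r, s <= r <= t -> `|G r - c| <= e) ->
    `|F t - F s - (t - s) * c| <= (t - s) * e.
Proof.
move=> T0 cF cG H0.
have [Gam _ dGam] := antiderivativeT 0 cG.
have cGam : continuous Gam by move=> t; exact: is_derive_continuous (dGam t).
pose H t := F t - Gam t.
have cH : continuous H by move=> t; apply: cvgB; [exact: cF|exact: cGam].
have Hcst : forall s t, 0 < s < T -> 0 < t < T -> H s = H t.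
  apply: (constant_of_weak_derivative0 cH) => eta teta.
  have [seta [a [b [a0 bT eta0]]]] := teta.
  have deta r : is_derive r (1 : R) eta ('D_1 eta r).
    exact/derivableP/smooth_derivable.
  have ceta := smooth_continuous seta.
  have cdeta : continuous ('D_1 eta) by exact/smooth_continuous/smooth_derive.
  have c1 : continuous (fun r => 'D_1 eta r * F r + eta r * G r).
    move=> r; apply: cvgD; apply: cvgM;
    [exact: cdeta|exact: cF|exact: ceta|exact: cG].
  have c2 : continuous (fun r => 'D_1 eta r * Gam r + eta r * G r).
    move=> r; apply: cvgD; apply: cvgM;
    [exact: cdeta|exact: cGam|exact: ceta|exact: cG].
  have parts : \int[lebesgue_measure]_(r in `[0, T]) ('D_1 eta r * Gam r + eta r * G r) = 0.
    have dp r : is_derive r (1 : R) (fun r => eta r * Gam r) ('D_1 eta r * Gam r + eta r * G r).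
      have := @is_deriveM _ _ _ _ r 1 _ _ (deta r) (dGam r).
      rewrite (_ : _ + _ = 'D_1 eta r * Gam r + eta r * G r)//.
      by rewrite addrC; congr (_ + _); exact: mulrC.
    rewrite (Rintegral_is_derive T0 c2 dp).
    by rewrite (eta0 T) ?(eta0 0) ?mul0r ?subrr//; [left|right].
  rewrite (@eq_Rintegral _ _ _ lebesgue_measure _
    (fun r => ('D_1 eta r * F r + eta r * G r) - ('D_1 eta r * Gam r + eta r * G r))).
    rewrite RintegralB//; [|exact: integrable_segment..].
    by rewrite (H0 _ teta) parts subrr.
  by move=> r _; rewrite /H; ring.
have Hend s : 0 <= s <= T -> H s = H (T / 2).
  move=> sT; apply/eqP; rewrite -subr_eq0 -normr_le0; apply/ler_addgt0Pr => e e0; rewrite add0r.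
  have /cvgrPdist_le/(_ _ e0)/nbhs_ballP[d /= d0 dP] := cH s.
  pose d' := Num.min (d / 2) (T / 2).
  have d'0 : 0 < d' by rewrite lt_min !divr_gt0.
  have [d'd d'T] : d' <= d / 2 /\ d' <= T / 2 by rewrite !ge_min !lexx orbT.
  have [q qs q0] : exists2 q, `|s - q| < d & 0 < q < T.
    have [h|h] := leP s (T / 2).
      by exists (s + d' / 2); [rewrite ltr_norml; lra|lra].
    by exists (s - d' / 2); [rewrite ltr_norml; lra|lra].
  by rewrite -(Hcst q (T / 2))//; [exact: dP|lra].
move=> s t c e sT tT st Ge.
have E : F t - F s = Gam t - Gam s.
  by have := Hend s sT; rewrite -(Hend t tT) /H; lra.
have lin k r : is_derive r (1 : R) (fun r => Gam r - k * r) (G r - k).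
  have ? : is_derive r (1 : R) (fun r => k * r) k.
    by rewrite -[X in is_derive _ _ _ X]mulr1; exact: (@is_deriveZ _ _ _ id k r 1 1).
  exact: is_deriveB.
have linN k r : is_derive r (1 : R) (fun r => - (Gam r - k * r)) (- (G r - k)).
  by have ? := lin k r; exact: is_deriveN.
have U := @le_is_derive _ _ _ s t st (fun r _ => lin (c + e) r).
have D := @le_is_derive _ _ _ s t st (fun r _ => linN (c - e) r).
have {}U : Gam t - (c + e) * t <= Gam s - (c + e) * s.
  by apply: U => r /Ge; rewrite ler_norml => /andP[_]; lra.
have {}D : - (Gam t - (c - e) * t) <= - (Gam s - (c - e) * s).
  by apply: D => r /Ge; rewrite ler_norml => /andP[+ _]; lra.
by rewrite E ler_norml; lra.
Qed.

End weak_derivative.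

Section bounded_integrals.
Context d (X : measurableType d) (R : realType) (P : probability X R).
Implicit Types f g : X -> R.

Lemma bounded_integrable f (C : R) : measurable_fun setT f -> (forall x, `|f x| <= C) ->
  P.-integrable setT (EFin \o f).
Proof.
move=> mf fC; apply: measurable_bounded_integrable => //.
  exact: (le_lt_trans (probability_le1 P measurableT) (ltry 1)).
exists C; split; first exact: num_real.
by move=> y Cy x _; exact: le_trans (fC x) (ltW Cy).
Qed.

Lemma integral_prob_cst (c : \bar R) : (\int[P]_x c = c)%E.
Proof.
rewrite integral_cst//.
by apply: (etrans (congr1 (mule c) (probability_setT P))); rewrite mule1.
Qed.

Lemma Rintegral_prob_cst (c : R) : \int[P]_x c = c.
Proof.
rewrite Rintegral_cst//.
by apply: (etrans (congr1 ( *%R c) (congr1 fine (probability_setT P)))); rewrite mulr1.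
Qed.

Lemma Rintegral_close f g (C D : R) : measurable_fun setT f -> measurable_fun setT g ->
  (forall x, `|f x| <= C) -> (forall x, `|g x| <= C) -> (forall x, `|f x - g x| <= D) ->
  `|\int[P]_x f x - \int[P]_x g x| <= D.
Proof.
move=> mf mg fC gC fg.
have If := bounded_integrable mf fC; have Ig := bounded_integrable mg gC.
rewrite -RintegralB//.
have mfg : measurable_fun setT (fun x => f x - g x) by exact: measurable_funB.
have Ifg := bounded_integrable mfg fg.
apply: (le_trans (le_normr_Rintegral measurableT Ifg)).
rewrite -[leRHS]Rintegral_prob_cst; apply: le_Rintegral => //.
- exact: integrable_norm.
- by apply: (@bounded_integrable _ `|D|) => //; exact: measurable_cst.
Qed.

End bounded_integrals.

Section measurable_enorm.
Context {R : realType} {n : nat}.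

Lemma ler_enorm_dist (x y : 'rV[R]_n) : `|enorm x - enorm y| <= enorm (x - y).
Proof.
rewrite ler_norml; apply/andP; split.
  by have := ler_enormD (y - x) x; rewrite subrK enormC; lra.
by have := ler_enormD (x - y) y; rewrite subrK; lra.
Qed.

Lemma contn_enorm : contn (@enorm R n).
Proof.
apply: (@lipschitz_contn _ _ _ (Num.sqrt n%:R)) => x z.
by rewrite (le_trans (ler_enorm_dist _ _))// addrK enorm_le_norm.
Qed.

Lemma lipschitz_enorm_contn (f : 'rV[R]_n -> R) (l : R) : 0 <= l ->
  (forall x y, `|f x - f y| <= l * enorm (x - y)) -> contn f.
Proof.
move=> l0 fl; apply: (@lipschitz_contn _ _ _ (l * Num.sqrt n%:R)) => x z.
by rewrite (le_trans (fl _ _))// addrK -mulrA ler_wpM2l// enorm_le_norm.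
Qed.

Lemma measurable_enorm_sub :
  measurable_fun setT (fun z : 'rV[R]_n * 'rV[R]_n => enorm (z.1 - z.2)).
Proof.
apply: (@measurableT_comp _ _ _ _ _ _ (@enorm R n) _ (fun z : 'rV[R]_n * 'rV[R]_n => z.1 - z.2)).
  exact: continuous_measurable_rV contn_enorm.
apply: measurable_rowP => i.
rewrite (_ : (fun _ => _) = fun z : 'rV[R]_n * 'rV[R]_n => z.1 ord0 i - z.2 ord0 i).
  apply: measurable_funB.
    exact: measurableT_comp (measurable_coord i) measurable_fst.
  exact: measurableT_comp (measurable_coord i) measurable_snd.
by apply/funext => z; rewrite !mxE.
Qed.

End measurable_enorm.

(** * Couplings, and Wasserstein control of Lipschitz means *)

Section couplings.
Context {R : realType} {n : nat}.
Implicit Types (mu nu : probability 'rV[R]_n R) (pi : probability ('rV[R]_n * 'rV[R]_n)%type R).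

Lemma coupling_Rintegral mu nu pi (f g : 'rV[R]_n -> R) (C : R) : coupling mu nu pi ->
  measurable_fun setT f -> measurable_fun setT g ->
  (forall x, `|f x| <= C) -> (forall x, `|g x| <= C) ->
  \int[mu]_x f x - \int[nu]_x g x = \int[pi]_z (f z.1 - g z.2).
Proof.
move=> [c1 c2] mf mg fC gC.
have m1 : measurable_fun setT (fun z : 'rV[R]_n * 'rV[R]_n => f z.1).
  exact: measurableT_comp mf measurable_fst.
have m2 : measurable_fun setT (fun z : 'rV[R]_n * 'rV[R]_n => g z.2).
  exact: measurableT_comp mg measurable_snd.
have I1 := bounded_integrable pi m1 (fun z => fC z.1).
have I2 := bounded_integrable pi m2 (fun z => gC z.2).
rewrite RintegralB//; congr (fine _ - fine _).
  transitivity (\int[pushforward pi fst]_x (f x)%:E)%E.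
    apply: eq_measure_integral => A mA _; rewrite /= -c1//; congr (pi _).
    by apply/seteqP; split=> z /=; [case|].
  rewrite (@integral_pushforward _ _ _ _ _ fst)//.
  exact/measurable_EFinP.
transitivity (\int[pushforward pi snd]_x (g x)%:E)%E.
  apply: eq_measure_integral => A mA _; rewrite /= -c2//; congr (pi _).
  by apply/seteqP; split=> z /=; [case|].
rewrite (@integral_pushforward _ _ _ _ _ snd)//.
exact/measurable_EFinP.
Qed.

(** A substitute for Hölder's inequality: beyond [delta] the ratio a / delta exceeds 1 and is
    dominated by its p-th power. *)
Lemma le_add_powR (p a delta : R) : 1 <= p -> 0 < delta -> 0 <= a ->
  a <= delta + delta / delta `^ p * a `^ p.
Proof.
move=> p1 d0 a0; have [ad|da] := leP a delta.
  by rewrite (le_trans ad)// lerDl mulr_ge0 ?powR_ge0// divr_ge0 ?powR_ge0// ltW.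
have H : a / delta <= (a / delta) `^ p.
  by apply: le1r_powR => //; rewrite ler_pdivlMr// mul1r ltW.
rewrite (@le_trans _ _ (delta * (a / delta) `^ p))//.
  by rewrite -ler_pdivrMl// mulrC.
rewrite powRM// ?invr_ge0 ?(ltW d0)// (_ : delta^-1 `^ p = (delta `^ p)^-1); last first.
  by rewrite -powR_inv1 ?(ltW d0)// -powRrM mulN1r powRN.
by rewrite mulrA mulrAC lerDr ltW.
Qed.

(** The strict inequality yields a coupling of cost below [delta] without any optimal plan.
    Integrating [le_add_powR] along it gives delta + delta^(1-p) delta^p = 2 delta. *)
Lemma Wp_lipschitz (p delta l C : R) mu nu (f : 'rV[R]_n -> R) : 1 <= p -> 0 < delta ->
  (Wp p mu nu < delta%:E)%E -> 0 <= l -> (forall x, `|f x| <= C) ->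
  (forall x y, `|f x - f y| <= l * enorm (x - y)) ->
  `|\int[mu]_x f x - \int[nu]_x f x| <= l * (2 * delta).
Proof.
move=> p1 d0 /ereal_inf_lt[_ [pi cpi <-]] costd l0 fC fl.
have p0 : 0 < p by exact: lt_le_trans p1.
have mf := continuous_measurable_rV (lipschitz_enorm_contn l0 fl).
rewrite (coupling_Rintegral cpi mf mf fC fC).
have m12 : measurable_fun setT (fun z : 'rV[R]_n * 'rV[R]_n => f z.1 - f z.2).
  apply: measurable_funB.
    exact: measurableT_comp mf measurable_fst.
  exact: measurableT_comp mf measurable_snd.
have b12 z : `|f z.1 - f z.2| <= C + C.
  by rewrite (le_trans (ler_normB _ _))// lerD.
have I12 := bounded_integrable pi m12 b12.
pose I := (\int[pi]_z (enorm (z.1 - z.2) `^ p)%:E)%E.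
have Id : (I <= (delta `^ p)%:E)%E.
  have I0 : (0 <= I)%E by apply: integral_ge0 => z _; rewrite lee_fin powR_ge0.
  have -> : I = ((I `^ p^-1) `^ p)%E by rewrite -poweRrM mulVf ?gt_eqF// poweRe1.
  rewrite -poweR_EFin; apply: gt0_ler_poweR; last exact: ltW.
  - exact: ltW.
  - by rewrite in_itv/= poweR_ge0 leey.
  - by rewrite in_itv/= lee_fin (ltW d0) leey.
have mz : measurable_fun setT (fun z : 'rV[R]_n * 'rV[R]_n => (enorm (z.1 - z.2) `^ p)%:E).
  apply/measurable_EFinP.
  exact: (measurableT_comp (measurable_powR p) measurable_enorm_sub).
have c0 : 0 <= delta / delta `^ p by rewrite divr_ge0 ?powR_ge0// ltW.
rewrite -lee_fin EFin_normr_Rintegral//.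
apply: (le_trans (le_abse_integral pi measurableT (measurable_int _ I12))).
apply: (@le_trans _ _ (\int[pi]_z (l%:E * (delta%:E + (delta / delta `^ p)%:E *
    (enorm (z.1 - z.2) `^ p)%:E)))%E).
  apply: ge0_le_integral => //.
  - by apply: measurableT_comp => //; exact: measurable_int I12.
  - apply: measurable_funeM; apply: emeasurable_funD; first exact: measurable_cst.
    exact: measurable_funeM.
  - move=> z _; rewrite -[leRHS]/((l * (delta + delta / delta `^ p * enorm (z.1 - z.2) `^ p))%:E).
    rewrite /= lee_fin (le_trans (fl _ _))//.
    by rewrite ler_wpM2l// le_add_powR// enorm_ge0.
have p1E (z : 'rV[R]_n * 'rV[R]_n) :
    (0 <= (delta / delta `^ p)%:E * (enorm (z.1 - z.2) `^ p)%:E)%E.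
  by rewrite -EFinM lee_fin mulr_ge0// powR_ge0.
rewrite ge0_integralZl//; last 2 first.
- apply: emeasurable_funD; first exact: measurable_cst.
  exact: measurable_funeM.
- by move=> z _; rewrite adde_ge0// lee_fin ltW.
rewrite ge0_integralD//; last 2 first.
- by move=> z _; rewrite lee_fin ltW.
- exact: measurable_funeM.
rewrite ge0_integralZl//; last by move=> z _; rewrite lee_fin powR_ge0.
rewrite -/I integral_prob_cst.
apply: (@le_trans _ _ (l%:E * (delta%:E + (delta / delta `^ p)%:E * (delta `^ p)%:E))%E).
  apply: lee_wpmul2l; first by rewrite lee_fin.
  by apply: leeD2l; apply: lee_wpmul2l; rewrite ?lee_fin.
rewrite -[leLHS]/((l * (delta + delta / delta `^ p * delta `^ p))%:E) lee_fin.
by rewrite mulfVK ?gt_eqF ?powR_gt0//; nra.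
Qed.

End couplings.

Lemma continuous_dist (R : realType) (f : R -> R) t (e : R) : continuous f -> 0 < e ->
  exists2 d, 0 < d & forall s, `|s - t| < d -> `|f s - f t| <= e.
Proof.
move=> cf e0; have /cvgrPdist_le/(_ _ e0)/nbhs_ballP[d /= d0 dP] := cf t.
by exists d => // s st; rewrite distrC; apply: dP; rewrite /ball/= distrC.
Qed.

(** * Test functions in product form *)

Section tensor_tests.
Context {R : realType} {n : nat}.

Definition tensor (eta : R -> R) (f : 'rV[R]_n -> R) (z : R * 'rV[R]_n) : R :=
  eta z.1 * f z.2.

Lemma derive_tensor (eta : R -> R) (f : 'rV[R]_n -> R) (h : R) (u : 'rV[R]_n) z :
  smooth eta -> smooth f ->
  'D_(h, u) (tensor eta f) z = eta z.1 * 'D_u f z.2 + f z.2 * 'D_h eta z.1.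
Proof.
move=> se sf; rewrite (_ : tensor eta f = (eta \o fst) * (f \o snd))//.
have a1 (k : R) : (k *: (h, u) + z).1 = k *: h + z.1 by [].
have a2 (k : R) : (k *: (h, u) + z).2 = k *: u + z.2 by [].
have E1 := @derive_affine _ _ _ _ eta fst fst z (h, u) a1.
have E2 := @derive_affine _ _ _ _ f snd snd z (h, u) a2.
have D1 := @derivable_affine _ _ _ _ eta fst fst z (h, u) a1 (smooth_derivable se).
have D2 := @derivable_affine _ _ _ _ f snd snd z (h, u) a2 (smooth_derivable sf).
by rewrite (deriveM D1 D2) E1 E2.
Qed.

Lemma tensor_test (T r : R) (eta : R -> R) (f : 'rV[R]_n -> R) : time_test T eta ->
  smooth f -> vanishes_beyond r f -> test_function T (tensor eta f).
Proof.
move=> [se [a [b [a0 bT eta0]]]] sf fr; split.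
  apply: (@smoothM _ _ (eta \o fst) (f \o snd)).
    apply: (@smooth_affine _ _ _ _ eta fst fst) => //.
    by move=> z; exact: cvg_fst.
  apply: (@smooth_affine _ _ _ _ f snd snd) => //.
  by move=> z; exact: cvg_snd.
exists (`[a, b]%classic `*` [set x : 'rV[R]_n | `|x| <= r]); split.
- by apply: compact_setX; [exact: segment_compact|exact: compact_normball].
- move=> [t x] /= [+ _]; rewrite !in_itv/= => /andP[at_ tb]; split => //.
  by rewrite (lt_le_trans a0)//= (le_lt_trans tb).
move=> [t x] /= H; rewrite /tensor/=.
have [xr|rx] := leP `|x| r; last by rewrite (fr x)// mulr0.
rewrite eta0 ?mul0r//; have [ta|at_] := ltP t a; first by left.
right; rewrite ltNge; apply/negP => tb; apply: H; split => //.
by rewrite in_itv/= at_.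
Qed.

Lemma dt_tensor (eta : R -> R) (f : 'rV[R]_n -> R) t x : smooth eta -> smooth f ->
  dt_test (tensor eta f) (t, x) = 'D_1 eta t * f x.
Proof. by move=> se sf; rewrite /dt_test derive_tensor// derive0 mulr0 add0r mulrC. Qed.

Lemma grad_tensor (eta : R -> R) (f : 'rV[R]_n -> R) t x i : smooth eta -> smooth f ->
  grad_test (tensor eta f) (t, x) ord0 i = eta t * partial f i x.
Proof. by move=> se sf; rewrite mxE derive_tensor// derive0 mulr0 addr0. Qed.

End tensor_tests.

(** * Evolution of the mean of a fixed test function *)

Section continuity_equation.
Context {R : realType} {n : nat}.
Variables (p T L M : R) (W : R -> 'rV[R]_n -> 'rV[R]_n) (mt : R -> probability 'rV[R]_n R).
Hypotheses (p1 : 1 <= p) (T0 : 0 < T) (rW : regular_field W L M).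
Hypothesis mt_cont : forall t e, 0 < e -> exists2 d, 0 < d &
  forall s, `|s - t| < d -> (Wp p (mt s) (mt t) < e%:E)%E.
Hypothesis mt_eq : forall f, test_function T f ->
  \int[lebesgue_measure]_(t in `[0, T]) (\int[mt t]_x
    (dt_test f (t, x) + \sum_(i < n) grad_test f (t, x) ord0 i * W t x ord0 i)) = 0.

Lemma Rintegral_lipschitz_cont (f : 'rV[R]_n -> R) (l C : R) t (e : R) : 0 <= l -> 0 < e ->
  (forall x, `|f x| <= C) -> (forall x y, `|f x - f y| <= l * enorm (x - y)) ->
  exists2 d, 0 < d & forall s, `|s - t| < d ->
    `|\int[mt s]_x f x - \int[mt t]_x f x| <= e.
Proof.
move=> l0 e0 fC fl.
have e1 : 0 < e / (2 * (l + 1)) by rewrite divr_gt0// mulr_gt0// ltr_wpDl.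
have [d d0 dP] := mt_cont t e1; exists d => // s /dP H.
apply: (le_trans (Wp_lipschitz p1 e1 H l0 fC fl)).
have l1 : 0 < l + 1 by rewrite ltr_wpDl.
rewrite (_ : l * _ = e * (l / (l + 1))); last by field; rewrite gt_eqF.
by rewrite ler_piMr ?(ltW e0)// ler_pdivrMr// mul1r lerDl.
Qed.

Definition advection (f : 'rV[R]_n -> R) t x : R :=
  \sum_(i < n) partial f i x * W t x ord0 i.

Variables (f : 'rV[R]_n -> R) (rf : R).
Hypotheses (sf : smooth f) (fr : vanishes_beyond rf f).

Lemma smooth_enorm_lipschitz (h : 'rV[R]_n -> R) r : smooth h -> vanishes_beyond r h ->
  exists2 C, 0 <= C & (forall x, `|h x| <= C) /\
    forall x y, `|h x - h y| <= C * enorm (x - y).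
Proof.
move=> sh hr; have [A A0 AP] := vanishing_bounded (smooth_contn sh) hr.
have [B B0 BP] := smooth_lipschitz sh hr.
exists (A + B); first exact: addr_ge0.
split=> [x|x y]; first by rewrite (le_trans (AP x))// lerDl.
rewrite -{1}(subrK y x) (le_trans (BP _ _))// ler_pM// ?lerDr//.
exact: normr_le_enorm.
Qed.

Lemma advection_lipschitz : exists2 C, 0 <= C &
  [/\ forall t x, `|advection f t x| <= C,
      forall t x y, `|advection f t x - advection f t y| <= C * enorm (x - y) &
      forall s t x, `|advection f s x - advection f t x| <= C * enorm (W s x - W t x)].
Proof.
have M0 : 0 <= M := le_trans (enorm_ge0 _) (field_bound rW 0 0).
have L0 := field_L rW.
have /choice[A AP] : forall i : 'I_n, exists A, 0 <= A /\
    (forall x, `|partial f i x| <= A) /\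
    forall x y, `|partial f i x - partial f i y| <= A * enorm (x - y).
  move=> i; have [A A0 AP] := smooth_enorm_lipschitz (smooth_derive (delta_mx ord0 i) sf)
    (vanishes_beyond_derive (delta_mx ord0 i) fr).
  by exists A.
have A0 i : 0 <= A i by case: (AP i).
have S0 : 0 <= \sum_i A i by apply: sumr_ge0.
(* One constant for three bounds: [M] serves the size, [M + L] the variation in [x], and 1 the
   variation in time. *)
exists ((\sum_i A i) * (M + L + 1)); first by rewrite mulr_ge0// !addr_ge0.
split.
- move=> t x; rewrite mulr_suml (le_trans (ler_norm_sum _ _ _))// ler_sum// => i _.
  rewrite normrM ler_pM//; first exact: (AP i).2.1.
  by rewrite (le_trans (coord_le_enorm _ _))// (le_trans (field_bound rW _ _))//; lra.
- move=> t x y; rewrite /advection -sumrB !mulr_suml (le_trans (ler_norm_sum _ _ _))//.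
  apply: ler_sum => i _.
  have -> : partial f i x * W t x ord0 i - partial f i y * W t y ord0 i =
    (partial f i x - partial f i y) * W t x ord0 i +
    partial f i y * (W t x ord0 i - W t y ord0 i) by ring.
  have h1 : `|(partial f i x - partial f i y) * W t x ord0 i| <= A i * enorm (x - y) * M.
    rewrite normrM ler_pM//; first exact: (AP i).2.2.
    by rewrite (le_trans (coord_le_enorm _ _))// (field_bound rW).
  have h2 : `|partial f i y * (W t x ord0 i - W t y ord0 i)| <= A i * (L * enorm (x - y)).
    rewrite normrM ler_pM//; first exact: (AP i).2.1.
    have := coord_le_enorm (W t x - W t y) i; rewrite !mxE => /le_trans; apply.
    exact: (field_lip rW).
  rewrite (le_trans (ler_normD _ _))// (le_trans (lerD h1 h2))//.
  by have := mulr_ge0 (A0 i) (enorm_ge0 (x - y)); lra.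
- move=> s t x; rewrite /advection -sumrB !mulr_suml (le_trans (ler_norm_sum _ _ _))//.
  apply: ler_sum => i _; rewrite -mulrBr normrM -mulrA ler_pM//; first exact: (AP i).2.1.
  have := coord_le_enorm (W s x - W t x) i; rewrite !mxE => /le_trans; apply.
  by rewrite ler_peMl ?enorm_ge0//; lra.
Qed.

Lemma measurable_advection t : measurable_fun setT (advection f t).
Proof.
have [C C0 [_ Cl _]] := advection_lipschitz.
exact: continuous_measurable_rV (lipschitz_enorm_contn C0 (Cl t)).
Qed.

Lemma mean_advection_cont : continuous (fun t => \int[mt t]_x advection f t x).
Proof.
have [C C0 [Cb Cl Ct]] := advection_lipschitz.
move=> t; apply: continuous_pointP => e e0.
have e2 : 0 < e / 2 by rewrite divr_gt0.
have [d1 d10 d1P] := Rintegral_lipschitz_cont t C0 e2 (Cb t) (Cl t).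
have e3 : 0 < e / 2 / (C + 1) by rewrite divr_gt0// ltr_wpDl.
have [d2 d20 d2P] := field_cont rW t e3.
exists (Num.min d1 d2); first by rewrite lt_min d10.
move=> s; rewrite lt_min => /andP[/d1P h1 /d2P h2].
rewrite (splitr e) -(subrKA (\int[mt s]_x advection f t x)) (le_trans (ler_normD _ _))// lerD//.
apply: (@Rintegral_close _ _ _ _ _ _ C) => //; try exact: measurable_advection.
move=> x; rewrite (le_trans (Ct _ _ _))//.
rewrite (@le_trans _ _ ((C + 1) * (e / 2 / (C + 1))))//.
  by rewrite ler_pM ?enorm_ge0// lerDl.
by rewrite mulrC divfK// gt_eqF// ltr_wpDl.
Qed.

Lemma mean_cont : continuous (fun t => \int[mt t]_x f x).
Proof.
have [C C0 [Cb Cl]] := smooth_enorm_lipschitz sf fr.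
move=> t; apply: continuous_pointP => e e0.
have [d d0 dP] := Rintegral_lipschitz_cont t C0 e0 Cb Cl.
by exists d.
Qed.

(** Testing with eta(t) f(x) identifies the mean of the advection term as the weak derivative of the
    mean of [f]. Both are continuous in time, so the expansion holds at every time, one-sided at 0
    and [T]. *)
Lemma mean_expansion t e : 0 <= t <= T -> 0 < e -> exists2 d, 0 < d & forall s,
  0 <= s <= T -> `|s - t| < d ->
  `|\int[mt s]_x f x - \int[mt t]_x f x - (s - t) * \int[mt t]_x advection f t x| <= e * `|s - t|.
Proof.
move=> tT e0.
have [Cf Cf0 [Cfb _]] := smooth_enorm_lipschitz sf fr.
have [C C0 [Cb _ _]] := advection_lipschitz.
have mf : measurable_fun setT f := continuous_measurable_rV (smooth_contn sf).
have weak : forall eta, time_test T eta ->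
    \int[lebesgue_measure]_(t in `[0, T]) ('D_1 eta t * (\int[mt t]_x f x) +
      eta t * \int[mt t]_x advection f t x) = 0.
  move=> eta teta; rewrite -[RHS](mt_eq (tensor_test teta sf fr)).
  apply: eq_Rintegral => r _; have se := teta.1.
  have If := bounded_integrable (mt r) mf Cfb.
  have Ia := bounded_integrable (mt r) (measurable_advection r) (Cb r).
  have E1 : 'D_1 eta r * (\int[mt r]_x f x) = \int[mt r]_x ('D_1 eta r * f x).
    by rewrite RintegralZl.
  have E2 : eta r * (\int[mt r]_x advection f r x) = \int[mt r]_x (eta r * advection f r x).
    by rewrite RintegralZl.
  rewrite E1 E2.
  have I1 : (mt r).-integrable setT (EFin \o (fun x => 'D_1 eta r * f x)).
    apply: (@bounded_integrable _ _ _ _ _ (`|'D_1 eta r| * Cf)).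
      by apply: measurable_funM => //; exact: measurable_cst.
    by move=> x; rewrite normrM ler_wpM2l.
  have I2 : (mt r).-integrable setT (EFin \o (fun x => eta r * advection f r x)).
    apply: (@bounded_integrable _ _ _ _ _ (`|eta r| * C)).
      by apply: measurable_funM; [exact: measurable_cst|exact: measurable_advection].
    by move=> x; rewrite normrM ler_wpM2l.
  rewrite -RintegralD//; apply: eq_Rintegral => x _.
  rewrite dt_tensor// /advection mulr_sumr; congr (_ + _).
  by apply: eq_bigr => i _; rewrite grad_tensor// mulrA.
have WD := weak_derivative T0 mean_cont mean_advection_cont weak.
have [d d0 dP] := continuous_dist t mean_advection_cont e0.
exists d => // s sT sd.
have [st|/ltW ts] := leP s t.
  have := @WD s t (\int[mt t]_x advection f t x) e sT tT st _.
  move=> /(_ _)/wrap[r /andP[sr rt]|].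
    apply: dP; rewrite ler0_norm ?subr_le0//.
    by move: sd; rewrite ler0_norm ?subr_le0//; lra.
  rewrite [leRHS]mulrC [`|s - t|]distrC [`|t - s|]ger0_norm ?subr_ge0//.
  rewrite -[leLHS]normrN; congr (`|_| <= _); ring.
have := @WD t s (\int[mt t]_x advection f t x) e tT sT ts _.
move=> /(_ _)/wrap[r /andP[tr rs]|].
  apply: dP; rewrite ger0_norm ?subr_ge0//.
  by move: sd; rewrite ger0_norm ?subr_ge0//; lra.
by rewrite [leRHS]mulrC [`|s - t|]ger0_norm ?subr_ge0.
Qed.

End continuity_equation.

(** Continuous induction with slope c + e: the last time up to which the bound is attained satisfies
    it by a leftward increment, and a rightward increment would push it further. [F] needs no
    derivative. *)
Lemma local_increments_le (R : realType) (F : R -> R) (tau c : R) : 0 <= tau -> 0 <= c ->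
  (forall t e : R, 0 <= t <= tau -> 0 < e -> exists2 d : R, 0 < d & forall s : R,
    0 <= s <= tau -> `|s - t| < d -> `|F s - F t| <= (c + e) * `|s - t|) ->
  `|F tau - F 0| <= c * tau.
Proof.
move=> tau0 c0 H; apply/ler_addgt0Pr => e' e'0.
pose e := e' / (tau + 1).
have e0 : 0 < e by rewrite divr_gt0// ltr_wpDl.
apply: (@le_trans _ _ ((c + e) * tau)); last first.
  rewrite mulrDl lerD2l /e mulrAC ler_pdivrMr ?ltr_wpDl//.
  by rewrite ler_wpM2l ?(ltW e'0)// lerDl.
pose S := [set t | 0 <= t <= tau /\ `|F t - F 0| <= (c + e) * t].
have S0 : S 0 by split; rewrite ?lexx//= subrr normr0 mulr0.
have hS : has_sup S by split; [exists 0|exists tau => t [/andP[]]].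
pose ts := sup S.
have tsl : 0 <= ts by exact: sup_upper_bound.
have tsr : ts <= tau by apply: ge_sup; [exists 0|move=> t [/andP[]]].
have tst : 0 <= ts <= tau by rewrite tsl.
have [d d0 dP] := H ts e tst e0.
have Sts : S ts.
  split => //; have [t St htt] := sup_adherent d0 hS.
  have tts : t <= ts by exact: sup_upper_bound.
  have [t0 Ft] := St.
  have dt : `|t - ts| = ts - t by rewrite distrC ger0_norm// subr_ge0.
  have := dP t t0; rewrite dt => /(_ _)/wrap[|h]; first by rewrite -/ts in htt; lra.
  have := ler_normD (F ts - F t) (F t - F 0); rewrite addrA subrK => h2.
  by rewrite distrC in h; nra.
suff <- : ts = tau by case: Sts.
apply/eqP; rewrite eq_le tsr leNgt; apply/negP => tlt.
pose s := Num.min tau (ts + d / 2).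
have sts : ts < s by rewrite lt_min tlt ltrDl divr_gt0.
have std : s - ts < d.
  by have h : s <= ts + d / 2; [rewrite ge_min lexx orbT|lra].
have stau : s <= tau by rewrite ge_min lexx.
have s0 : 0 <= s <= tau by rewrite stau (le_trans tsl)// ltW.
have ds : `|s - ts| = s - ts by rewrite ger0_norm// subr_ge0 ltW.
have : S s.
  split => //; have := dP s s0; rewrite ds => /(_ std) h.
  have := ler_normD (F s - F ts) (F ts - F 0); rewrite addrA subrK => h2.
  by have := Sts.2; nra.
by move=> /(sup_upper_bound hS); rewrite -/ts leNgt sts.
Qed.

(** * Near conservation of the mollified mean *)

Section representation.
Context {R : realType} {n : nat}.
Variables (p T L M : R) (W : R -> 'rV[R]_n -> 'rV[R]_n) (mt : R -> probability 'rV[R]_n R).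
Hypotheses (p1 : 1 <= p) (T0 : 0 < T) (rW : regular_field W L M).
Hypothesis mt_cont : forall t e, 0 < e -> exists2 d, 0 < d &
  forall s, `|s - t| < d -> (Wp p (mt s) (mt t) < e%:E)%E.
Hypothesis mt_eq : forall f, test_function T f ->
  \int[lebesgue_measure]_(t in `[0, T]) (\int[mt t]_x
    (dt_test f (t, x) + \sum_(i < n) grad_test f (t, x) ord0 i * W t x ord0 i)) = 0.
Variable Z : R -> R -> 'rV[R]_n -> 'rV[R]_n.
Hypothesis ZW : flow_map W Z.

Let L0 : 0 <= L := field_L rW.
Let M0 : 0 <= M := le_trans (enorm_ge0 _) (field_bound rW 0 0).

Variables (phi : 'rV[R]_n -> R) (l r tau : R).
Hypotheses (l0 : 0 <= l) (phi0 : forall x, 0 <= phi x)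
  (phil : forall x y, `|phi x - phi y| <= l * enorm (x - y))
  (phir : vanishes_beyond r phi) (tau0 : 0 <= tau) (tauT : tau <= T).

Let g t x := phi (Z t tau x).
Let l' := l * (2 * expR ((2 * L + 1) * T)).

Let l'0 : 0 <= l'. Proof. by rewrite !mulr_ge0// expR_ge0. Qed.

Let g_lip (t : R) x y : 0 <= t <= tau -> `|g t x - g t y| <= l' * enorm (x - y).
Proof.
move=> /andP[t0 htt]; apply: (le_trans (phil _ _)); rewrite -mulrA ler_wpM2l//.
apply: (le_trans (flow_map_lip rW ZW _ _ htt)).
rewrite ler_wpM2r ?enorm_ge0// ler_wpM2l// ler_expR ler_wpM2l//; first by rewrite addr_ge0// mulr_ge0.
by rewrite (le_trans _ tauT)// gerBl.
Qed.

Let g_contn (t : R) : 0 <= t <= tau -> contn (g t).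
Proof. by move=> htt; apply: (lipschitz_enorm_contn l'0) => x y; exact: g_lip. Qed.

Let g_vanishes (t : R) : 0 <= t <= tau -> vanishes_beyond (r + M * T) (g t).
Proof.
move=> /andP[t0 htt] x rx; apply: phir.
have h1 : `|Z t tau x - x| <= M * T.
  apply: (le_trans (normr_le_enorm _)); apply: (le_trans (flow_map_move rW ZW _ htt)).
  by rewrite ler_wpM2l// (le_trans _ tauT)// gerBl.
have := ler_normB (Z t tau x) (Z t tau x - x); rewrite subKr; lra.
Qed.

Variables (kappa : R) (rho : 'rV[R]_n -> R).
Hypotheses (k0 : 0 < kappa) (mrho : mollifier kappa rho).

(** Rate of the commutator error: |u| <= kappa in the sup norm means at most sqrt n kappa in the
    Euclidean norm, [L] turns this into a velocity error and [l'] into an error on [g]. *)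
Let c := l' * (L * (Num.sqrt n%:R * kappa)).

Let gs (t : R) : 0 <= t <= tau -> smooth (conv (g t) rho).
Proof.
move=> htt; apply: (conv_smooth (g_contn htt) (g_vanishes htt)).
  exact: mollifier_smooth mrho.
exact: mollifier_vanishes mrho.
Qed.

Let gv (t : R) : 0 <= t <= tau -> vanishes_beyond (kappa + (r + M * T)) (conv (g t) rho).
Proof.
move=> htt; apply: (conv_vanishes (g_vanishes htt)); exact: mollifier_vanishes mrho.
Qed.

Let g_transport (t e : R) : 0 <= t <= tau -> 0 < e -> exists2 d : R, 0 < d & forall s : R,
  0 <= s <= tau -> `|s - t| < d -> forall y,
  `|g s y - g t (y - (s - t) *: W t y)| <= e * `|s - t|.
Proof.
move=> htt e0.
have e1 : 0 < e / 2 / (l' + 1) by rewrite !divr_gt0// ltr_wpDl.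
have [d d0 dP] := flow_map_expand rW ZW t e1.
have A0 : 0 < l' * L * M + 1 by rewrite ltr_wpDl// !mulr_ge0.
exists (Num.min d (e / 2 / (l' * L * M + 1))); first by rewrite lt_min d0 !divr_gt0.
move=> s ss; rewrite lt_min => /andP[sd1]; rewrite ltr_pdivlMr// => sd2 y.
have tt0 : `|t - t| < d by rewrite subrr normr0.
have le1 : l' * (e / 2 / (l' + 1)) <= e / 2.
  rewrite (_ : l' * _ = e / 2 * (l' / (l' + 1))); last by field; rewrite gt_eqF// ltr_wpDl.
  by rewrite ler_piMr ?divr_ge0 ?(ltW e0)// ler_pdivrMr ?ltr_wpDl// mul1r lerDl.
have [st|/ltW ts] := leP s t.
  have E : g s y = g t (Z s t y) by rewrite /g (flow_map_comp rW ZW _ st)//; case/andP: htt.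
  rewrite E; apply: (le_trans (g_lip _ _ htt)).
  have := dP s t sd1 tt0 st y.
  have -> : Z s t y - y - (t - s) *: W t y = Z s t y - (y - (s - t) *: W t y).
    by apply/rowP => i; rewrite !mxE; ring.
  rewrite [`|s - t|]distrC (ger0_norm (_ : 0 <= t - s)) ?subr_ge0// => h.
  apply: (le_trans (ler_wpM2l l'0 h)); rewrite mulrA ler_wpM2r ?subr_ge0//.
  by rewrite (le_trans le1)//; lra.
(* For [s > t] the flow would have to be run backwards from [y]. Instead it starts at the displaced
   point [y'] at time [t] and is shown to return to [y] up to o(s - t). *)
set y' := y - _.
have E : g t y' = g s (Z t s y') by rewrite /g (flow_map_comp rW ZW _ ts)//; case/andP: ss.
rewrite E; apply: (le_trans (g_lip _ _ ss)).
have st0 : `|s - t| = s - t by rewrite ger0_norm// subr_ge0.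
have h1 := dP t s tt0 sd1 ts y'.
have h2 : enorm ((s - t) *: (W t y' - W t y)) <= (s - t) * (L * ((s - t) * M)).
  rewrite enormZ st0 ler_wpM2l ?subr_ge0// (le_trans (field_lip rW _ _ _))// ler_wpM2l//.
  rewrite /y' addrC addKr enormN enormZ st0 ler_wpM2l ?subr_ge0//.
  exact: field_bound rW _ _.
have h3 : enorm (y - Z t s y') <= e / 2 / (l' + 1) * (s - t) + (s - t) * (L * ((s - t) * M)).
  rewrite enormC; apply: le_trans (lerD h1 h2).
  have -> : Z t s y' - y = (Z t s y' - y' - (s - t) *: W t y') + (s - t) *: (W t y' - W t y).
    by apply/rowP => i; rewrite /y' !mxE; ring.
  exact: ler_enormD.
apply: (le_trans (ler_wpM2l l'0 h3)); rewrite st0 mulrDr mulrA.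
have st1 : 0 <= s - t by rewrite subr_ge0.
have h4 : l' * (e / 2 / (l' + 1)) * (s - t) <= e / 2 * (s - t) by rewrite ler_wpM2r.
have h5 : (s - t) * (l' * L * M) <= e / 2.
  by rewrite st0 in sd2; rewrite (le_trans _ (ltW sd2))// ler_wpM2l// lerDl.
have h6 : (s - t) * ((s - t) * (l' * L * M)) <= (s - t) * (e / 2) by rewrite ler_wpM2l.
by lra.
Qed.

Let F t := \int[mt t]_x conv (g t) rho x.

(** Passing from [g t] to [g s] contributes -(s - t) times the advection of [f], passing from [mt t]
    to [mt s] contributes the opposite; [h] isolates the first effect. Four errors of size e / 4
    remain, and the commutator [c]: transport and Taylor remainder in [point], then [S2] and
    [S4]. *)
Let F_increment (t e : R) : 0 <= t <= tau -> 0 < e -> exists2 d : R, 0 < d & forall s : R,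
  0 <= s <= tau -> `|s - t| < d -> `|F s - F t| <= (c + e) * `|s - t|.
Proof.
move=> htt e0; pose f := conv (g t) rho.
have sf : smooth f := gs htt; have vf := gv htt; rewrite -/f in vf.
have e4 : 0 < e / 4 by rewrite divr_gt0.
have tT : 0 <= t <= T by case/andP: htt => t0 htt'; rewrite t0 (le_trans htt').
have [d1 d10 d1P] := mean_expansion p1 T0 rW mt_cont mt_eq sf vf tT e4.
have [d2 d20 d2P] := g_transport htt e4.
have [C2 C20 C2P] := smooth_taylor2 sf vf.
have [Ca Ca0 [Cab Cal _]] := advection_lipschitz rW sf vf.
have [d3 d30 d3P] := Rintegral_lipschitz_cont p1 mt_cont t Ca0 e4 (Cab t) (Cal t).
have B0 : 0 < C2 * M ^+ 2 + 1 by rewrite ltr_wpDl// mulr_ge0// sqr_ge0.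
exists (Num.min (Num.min d1 d2) (Num.min d3 (e / 4 / (C2 * M ^+ 2 + 1)))).
  by rewrite !lt_min d10 d20 d30 divr_gt0.
move=> s ss; rewrite !lt_min ltr_pdivlMr// => /andP[/andP[sd1 sd2] /andP[sd3 sd4]].
have sT : 0 <= s <= T by case/andP: ss => s0 st'; rewrite s0 (le_trans st').
set q := `|s - t|; have q0 : 0 <= q by exact: normr_ge0.
pose h x := f x - (s - t) * advection W f t x.
have mf : measurable_fun setT f := continuous_measurable_rV (smooth_contn sf).
have ma : measurable_fun setT (advection W f t) := measurable_advection rW sf vf t.
have msa : measurable_fun setT (fun x => (s - t) * advection W f t x).
  by apply: measurable_funM => //; exact: measurable_cst.
have mh : measurable_fun setT h by exact: measurable_funB.
have mgs : measurable_fun setT (conv (g s) rho).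
  exact: continuous_measurable_rV (smooth_contn (gs ss)).
have [Cf Cf0 [Cfb _]] := smooth_enorm_lipschitz sf vf.
have [Cs Cs0 [Csb _]] := smooth_enorm_lipschitz (gs ss) (gv ss).
have bsa x : `|(s - t) * advection W f t x| <= q * Ca by rewrite normrM ler_wpM2l.
have point x : `|conv (g s) rho x - h x| <= (c + e / 2) * q.
  have T1 : `|conv (g s) rho x - f (x - (s - t) *: W t x)| <= (e / 4 + c) * q.
    apply: (conv_close mrho (g_contn ss) (g_contn htt)) => [y|y|u uk]; try exact: phi0.
    have h1 := d2P s ss sd2 (u + x).
    have h2 : `|g t (u + x - (s - t) *: W t (u + x)) - g t (u + (x - (s - t) *: W t x))| <= c * q.
      apply: (le_trans (g_lip _ _ htt)); rewrite /c -mulrA ler_wpM2l//.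
      have -> : u + x - (s - t) *: W t (u + x) - (u + (x - (s - t) *: W t x)) =
          (s - t) *: (W t x - W t (u + x)).
        by apply/rowP => i; rewrite !mxE; ring.
      rewrite enormZ -/q mulrC ler_wpM2r//.
      rewrite (le_trans (field_lip rW _ _ _))// ler_wpM2l//.
      rewrite opprD addrCA subrr addr0 enormN (le_trans (enorm_le_norm _))//.
      by rewrite ler_wpM2l.
    rewrite mulrDl; apply: le_trans (lerD h1 h2).
    exact: ler_distD.
  have T2 : `|f (x - (s - t) *: W t x) - h x| <= e / 4 * q.
    have := C2P x (- ((s - t) *: W t x)).
    have -> : \sum_i (- ((s - t) *: W t x)) ord0 i * partial f i x =
        - ((s - t) * advection W f t x).
      rewrite /advection mulr_sumr -sumrN; apply: eq_bigr => i _; rewrite !mxE; ring.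
    rewrite opprK addrC [- _ + x]addrC => H.
    have -> : f (x - (s - t) *: W t x) - h x =
       (s - t) * advection W f t x + (f (x - (s - t) *: W t x) - f x) by rewrite /h; ring.
    apply: (le_trans H); rewrite normrN normrZ -/q exprMn.
    have WM : `|W t x| ^+ 2 <= M ^+ 2.
      rewrite ler_pXn2r ?nnegrE//; apply: (le_trans (normr_le_enorm _)); exact: field_bound rW _ _.
    have h3 : C2 * (q ^+ 2 * `|W t x| ^+ 2) <= C2 * (q ^+ 2 * M ^+ 2).
      by rewrite ler_wpM2l// ler_wpM2l// sqr_ge0.
    have h4 : q * (C2 * M ^+ 2) <= e / 4.
      by rewrite (le_trans _ (ltW sd4))// ler_wpM2l// lerDl.
    have h5 : q * (q * (C2 * M ^+ 2)) <= q * (e / 4) by rewrite ler_wpM2l.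
    by lra.
  have -> : conv (g s) rho x - h x = (conv (g s) rho x - f (x - (s - t) *: W t x)) +
     (f (x - (s - t) *: W t x) - h x) by rewrite addrA subrK.
  rewrite (le_trans (ler_normD _ _))// (le_trans (lerD T1 T2))//.
  by rewrite -mulrDl ler_wpM2r//; lra.
have bh x : `|h x| <= Cf + q * Ca.
  by rewrite (le_trans (ler_normB _ _))// lerD.
have S1 : `|F s - \int[mt s]_x h x| <= (c + e / 2) * q.
  apply: (@Rintegral_close _ _ _ _ _ _ (Cs + (Cf + q * Ca))) => // x.
    by rewrite (le_trans (Csb x))// lerDl addr_ge0// mulr_ge0.
  by rewrite (le_trans (bh x))// lerDr.
have Eh : \int[mt s]_x h x = \int[mt s]_x f x - (s - t) * \int[mt s]_x advection W f t x.
  rewrite /h RintegralB//; last 2 first.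
  - exact: (bounded_integrable _ mf Cfb).
  - exact: (bounded_integrable _ msa bsa).
  by rewrite RintegralZl//; exact: (bounded_integrable _ ma (Cab t)).
have S2 := d1P s sT sd1; have S3 := d3P s sd3.
have S4 : `|(s - t) * (\int[mt s]_x advection W f t x - \int[mt t]_x advection W f t x)| <= q * (e / 4).
  by rewrite normrM ler_wpM2l.
have -> : F s - F t = (F s - \int[mt s]_x h x) +
    ((\int[mt s]_x f x - \int[mt t]_x f x - (s - t) * \int[mt t]_x advection W f t x) -
     (s - t) * (\int[mt s]_x advection W f t x - \int[mt t]_x advection W f t x)).
  by rewrite Eh -/(F t); ring.
rewrite (le_trans (ler_normD _ _))// (le_trans (lerD S1 (le_trans (ler_normB _ _) (lerD S2 S4))))//.
by rewrite -/q; lra.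
Qed.

Let lk := l' * (Num.sqrt n%:R * kappa).

Let F_close (t : R) : 0 <= t <= tau -> `|F t - \int[mt t]_x g t x| <= lk.
Proof.
move=> htt; have [Cs Cs0 [Csb _]] := smooth_enorm_lipschitz (gs htt) (gv htt).
have [Cg Cg0 Cgb] := vanishing_bounded (g_contn htt) (g_vanishes htt).
apply: (@Rintegral_close _ _ _ _ _ _ (Cs + Cg)).
- exact: continuous_measurable_rV (smooth_contn (gs htt)).
- exact: continuous_measurable_rV (g_contn htt).
- by move=> x; rewrite (le_trans (Csb x))// lerDl.
- by move=> x; rewrite (le_trans (Cgb x))// lerDr.
move=> x; apply: (conv_approx mrho (g_contn htt)) => [y|u uk]; first exact: phi0.
rewrite (le_trans (g_lip _ _ htt))// addrK ler_wpM2l// (le_trans (enorm_le_norm _))//.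
by rewrite ler_wpM2l.
Qed.

Lemma representation_close : `|\int[mt tau]_x phi x - \int[mt 0]_x phi (Z 0 tau x)| <=
  kappa * (l' * (L * Num.sqrt n%:R) * tau + 2 * (l' * Num.sqrt n%:R)).
Proof.
have ttau : 0 <= tau <= tau by rewrite tau0 lexx.
have t0 : (0 : R) <= 0 <= tau by rewrite lexx.
have c0 : 0 <= c by rewrite /c !mulr_ge0// ltW.
have H := local_increments_le tau0 c0 F_increment.
have H1 := F_close ttau; have H2 := F_close t0.
have gtau : g tau = phi by apply/funext => x; rewrite /g ZW.1.
rewrite gtau in H1.
have -> : \int[mt tau]_x phi x - \int[mt 0]_x phi (Z 0 tau x) =
  - (F tau - \int[mt tau]_x phi x) + ((F tau - F 0) + (F 0 - \int[mt 0]_x g 0 x)).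
  by rewrite /g; ring.
rewrite (le_trans (ler_normD _ _))// normrN.
rewrite (le_trans (lerD H1 (le_trans (ler_normD _ _) (lerD H H2))))//.
by rewrite /c /lk; lra.
Qed.

End representation.

(** * Lipschitz functions determine a probability measure *)

Section truncated_distance.
Context {R : realType} {n : nat}.
Implicit Types (A B : set 'rV[R]_n) (x y : 'rV[R]_n).

(** Adjoining 1 keeps the infimum meaningful for empty [A] and makes the function bounded. *)
Definition trdist A x : R := inf ([set enorm (x - y) | y in A] `|` [set 1]).

Lemma trdist_lbound A x : has_lbound ([set enorm (x - y) | y in A] `|` [set 1]).
Proof.
by exists 0 => _ [[y _ <-]|->]; [exact: enorm_ge0|exact: ler01].
Qed.

Lemma trdist_ge A x (c : R) : c <= 1 -> (forall y, A y -> c <= enorm (x - y)) -> c <= trdist A x.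
Proof.
move=> c1 cA; apply: lb_le_inf; first by exists 1; right.
by move=> _ [[y Ay <-]|->] //; exact: cA.
Qed.

Lemma trdist_ge0 A x : 0 <= trdist A x.
Proof. by apply: trdist_ge => // y _; exact: enorm_ge0. Qed.

Lemma trdist_le A x y : A y -> trdist A x <= enorm (x - y).
Proof. by move=> Ay; apply: (ge_inf (trdist_lbound A x)); left; exists y. Qed.

Lemma trdist_le1 A x : trdist A x <= 1.
Proof. by apply: (ge_inf (trdist_lbound A x)); right. Qed.

Lemma trdist0 A x : A x -> trdist A x = 0.
Proof.
by move=> Ax; apply/le_anti; rewrite trdist_ge0 -(@enorm0 R n) -(subrr x) trdist_le.
Qed.

Lemma trdist_anti A B x : A `<=` B -> trdist B x <= trdist A x.
Proof.
move=> AB; apply: trdist_ge; first exact: trdist_le1.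
by move=> y /AB; exact: trdist_le.
Qed.

Lemma trdist_lip A x y : `|trdist A x - trdist A y| <= enorm (x - y).
Proof.
have H u w : trdist A u - enorm (u - w) <= trdist A w.
  apply: trdist_ge => [|z Az].
    by rewrite (le_trans _ (trdist_le1 A u))// gerBl enorm_ge0.
  by have := trdist_le u Az; have := ler_enorm_sub u w z; lra.
have := H x y; have := H y x; rewrite (enormC y x).
by rewrite ler_norml => h1 h2; apply/andP; split; lra.
Qed.

End truncated_distance.

Section lipschitz_test.
Context {R : realType} {n : nat}.

(** The far points are cut away along with the complement of [O], so that [bump_fun], which
    increases to the indicator of an open [O], is compactly supported as well as Lipschitz. *)
Let cut (O : set 'rV[R]_n) (k : nat) := ~` O `|` [set x | k%:R <= `|x|].

Let bump_fun O k x : R := Num.min 1 (k%:R * trdist (cut O k) x).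

Let bump_ge0 O k x : 0 <= bump_fun O k x.
Proof. by rewrite le_min ler01 mulr_ge0// trdist_ge0. Qed.

Let bump_le1 O k x : bump_fun O k x <= 1.
Proof. by rewrite ge_min lexx. Qed.

Let bump_lip O k x y : `|bump_fun O k x - bump_fun O k y| <= k%:R * enorm (x - y).
Proof.
have H u w : bump_fun O k u <= bump_fun O k w + k%:R * enorm (u - w).
  rewrite /bump_fun addr_minl le_min !ge_min.
  rewrite lerDl mulr_ge0 ?enorm_ge0//= -mulrDr; apply/orP; right.
  rewrite ler_wpM2l// -lerBlDl (le_trans (ler_norm _))//.
  exact: trdist_lip.
have := H x y; have := H y x; rewrite (enormC y x).
by rewrite ler_norml => h1 h2; apply/andP; split; lra.
Qed.

Let bump_vanishes O k : vanishes_beyond k%:R (bump_fun O k).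
Proof.
move=> x kx; rewrite /bump_fun trdist0; last by right; exact: ltW.
by rewrite mulr0 (min_idPr ler01).
Qed.

Let bump_nd O x : {homo (fun k => bump_fun O k x) : k m / (k <= m)%N >-> k <= m}.
Proof.
move=> k m km; rewrite /bump_fun le_min !ge_min lexx/=; apply/orP; right.
apply: ler_pM => //; first exact: trdist_ge0.
  by rewrite ler_nat.
apply: trdist_anti => y [Oy|/= my]; [by left|right => /=].
by rewrite (le_trans _ my)// ler_nat.
Qed.

Let bump_lim O x : open O -> limn (fun k => (bump_fun O k x)%:E) = (\1_O x)%:E.
Proof.
move=> oO; apply/cvg_lim => //; rewrite indicE; case: (boolP (x \in O)) => xO; last first.
  rewrite (_ : (fun _ => _) = cst 0%E); first exact: cvg_cst.
  apply/funext => k; rewrite /bump_fun trdist0; last by left => xO'; rewrite mem_set in xO.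
  by rewrite mulr0 (min_idPr ler01).
have [e /= e0 eO] : exists2 e : R, 0 < e & forall y, enorm (x - y) < e -> O y.
  have /nbhs_ballP[e /= e0 eO] := open_nbhs_nbhs (conj oO (set_mem xO)).
  exists e => // y xy; apply: eO; rewrite -ball_normE /=.
  exact: le_lt_trans (normr_le_enorm _) xy.
pose c := Num.min 1 e.
have c0 : 0 < c by rewrite lt_min ltr01.
apply: cvg_near_cst; near=> k; congr (_%:E); apply/min_idPl.
have kc : c^-1 <= k%:R by near: k; exact: nbhs_infty_ger.
rewrite -[leLHS](mulVf (lt0r_neq0 c0)).
apply: ler_pM => //; [by rewrite invr_ge0 ltW|exact: ltW|].
apply: trdist_ge => [|y [Oy|/= ky]]; first by rewrite ge_min lexx.
  by rewrite (@le_trans _ _ e) ?ge_min ?lexx ?orbT// leNgt; apply/negP => /eO.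
rewrite (@le_trans _ _ 1) ?ge_min ?lexx// (le_trans _ (normr_le_enorm _))//.
have kx : `|x| + 1 <= k%:R by near: k; exact: nbhs_infty_ger.
by have := ler_normB y x; have := ler_normB x (x - y); rewrite subKr; lra.
Unshelve. all: end_near.
Qed.

(** Open sets are stable under intersection and generate the Borel sets; on each of them monotone
    convergence along [bump_fun] applies to both measures. *)
Lemma probability_eq_lipschitz (P Q : probability 'rV[R]_n R) :
  (forall phi (l r : R), 0 <= l -> (forall x, 0 <= phi x) ->
     (forall x y, `|phi x - phi y| <= l * enorm (x - y)) -> vanishes_beyond r phi ->
     \int[P]_x phi x = \int[Q]_x phi x) ->
  forall A, measurable A -> P A = Q A.
Proof.
move=> PQ; apply: (@measure_unique _ _ _ (@open 'rV[R]_n) (fun=> setT)) => //.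
- by move=> A B oA oB; exact: openI.
- by move=> _; exact: openT.
- by rewrite bigcup_const.
- move=> O oO.
  have mO : measurable O by exact: sub_sigma_algebra.
  have mb k : measurable_fun setT (bump_fun O k).
    apply: continuous_measurable_rV; apply: (@lipschitz_enorm_contn _ _ _ k%:R) => //.
  have bb k x : `|bump_fun O k x| <= 1 by rewrite ger0_norm.
  have H (m : probability 'rV[R]_n R) :
      ((\int[m]_x bump_fun O k x)%:E @[k --> \oo] --> m O)%E.
    have E k : (\int[m]_x bump_fun O k x)%:E = (\int[m]_x (bump_fun O k x)%:E)%E.
      rewrite /Rintegral fineK//; apply: integrable_fin_num => //.
      exact: (bounded_integrable m (mb k) (bb k)).
    rewrite (eq_cvg _ _ E).
    have -> : m O = (\int[m]_x limn (fun k => (bump_fun O k x)%:E))%E.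
      under eq_integral do rewrite bump_lim//.
      by rewrite integral_indic// setIT.
    apply: cvg_monotone_convergence => //.
    - by move=> k; exact/measurable_EFinP.
    - by move=> k x _; rewrite lee_fin.
    - by move=> x _ k m' km; rewrite lee_fin; exact: bump_nd.
  apply: (cvg_unique _ (H P)) => //.
  rewrite (_ : (fun k => _) = (fun k => (\int[Q]_x bump_fun O k x)%:E)); first exact: H.
  by apply/funext => k; congr (_%:E); apply: (PQ _ k%:R k%:R).
- by move=> k; rewrite (le_lt_trans (probability_le1 P measurableT))// ltry.
Qed.

End lipschitz_test.

Section image_probability.
Context {R : realType}.

Section definition.
Context d1 d2 (X : measurableType d1) (Y : measurableType d2) (P : probability X R)
  (f : X -> Y) (mf : measurable_fun setT f).

Definition image_prob : probability Y R :=
  let F : {mfun X >-> Y} := HB.pack f (isMeasurableFun.Build _ _ _ _ f mf) in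
  distribution P F.

Lemma image_probE A : image_prob A = P (f @^-1` A).
Proof. by []. Qed.

Lemma Rintegral_image_prob (g : Y -> R) (C : R) : measurable_fun setT g -> (forall y, `|g y| <= C) ->
  \int[image_prob]_y g y = \int[P]_x g (f x).
Proof.
move=> mg gC; congr fine; rewrite /image_prob integral_distribution//.
  exact/measurable_EFinP.
apply: (@bounded_integrable _ _ _ P (g \o f) C) => [|x]; last exact: gC.
exact: measurableT_comp.
Qed.

End definition.

Lemma lipschitz_measurable {n m : nat} (f : 'rV[R]_n -> 'rV[R]_m) (l : R) : 0 <= l ->
  (forall x y, enorm (f x - f y) <= l * enorm (x - y)) -> measurable_fun setT f.
Proof.
move=> l0 fl; apply: measurable_rowP => i; apply: continuous_measurable_rV.
apply: (lipschitz_enorm_contn l0) => x y; apply: le_trans (fl x y).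
by have := coord_le_enorm (f x - f y) i; rewrite !mxE.
Qed.

End image_probability.

Section representation_eq.
Context {R : realType} {n : nat}.
Variables (p T L M : R) (W : R -> 'rV[R]_n -> 'rV[R]_n) (mt : R -> probability 'rV[R]_n R).
Hypotheses (p1 : 1 <= p) (T0 : 0 < T) (rW : regular_field W L M).
Hypothesis mt_cont : forall t e : R, 0 < e -> exists2 d : R, 0 < d &
  forall s, `|s - t| < d -> (Wp p (mt s) (mt t) < e%:E)%E.
Hypothesis mt_eq : forall f, test_function T f ->
  \int[lebesgue_measure]_(t in `[0, T]) (\int[mt t]_x
    (dt_test f (t, x) + \sum_(i < n) grad_test f (t, x) ord0 i * W t x ord0 i)) = 0.
Variable Z : R -> R -> 'rV[R]_n -> 'rV[R]_n.
Hypothesis ZW : flow_map W Z.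

Lemma flow_map_measurable (s t : R) : s <= t -> measurable_fun setT (Z s t).
Proof.
move=> st; apply: lipschitz_measurable (fun x y => flow_map_lip rW ZW x y st).
by rewrite mulr_ge0// expR_ge0.
Qed.

Lemma representation (tau : R) : 0 <= tau <= T ->
  forall A, measurable A -> mt tau A = pushforward (mt 0) (Z 0 tau) A.
Proof.
move=> tauT; have tau0 : 0 <= tau by case/andP: tauT.
have mZ := flow_map_measurable tau0.
pose Q := image_prob (mt 0) mZ.
apply: (@probability_eq_lipschitz _ _ _ Q) => phi l r l0 phi0 philip phiv.
have mphi := continuous_measurable_rV (lipschitz_enorm_contn l0 philip).
have [C C0 Cphi] := vanishing_bounded (lipschitz_enorm_contn l0 philip) phiv.
rewrite (Rintegral_image_prob _ mZ mphi Cphi).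
apply/eqP; rewrite -subr_eq0 -normr_le0.
set D := _ - _.
have M0 : 0 <= M := le_trans (enorm_ge0 _) (field_bound rW 0 0).
set l' := l * (2 * expR ((2 * L + 1) * T)).
pose B := l' * (L * Num.sqrt n%:R) * tau + 2 * (l' * Num.sqrt n%:R).
have L0 := field_L rW.
have l'0 : 0 <= l' by rewrite /l' !mulr_ge0// expR_ge0.
have B0 : 0 <= B by rewrite /B addr_ge0// !mulr_ge0// sqrtr_ge0.
apply/ler_addgt0Pr => e e0; rewrite add0r.
have k0 : 0 < e / (B + 1) by rewrite divr_gt0// ltr_wpDl.
have [rho mrho] := @mollifier_exists R n _ k0.
have := representation_close p1 T0 rW mt_cont mt_eq ZW l0 phi0 philip phiv tau0 (proj2 (andP tauT)) k0 mrho.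
move=> /le_trans; apply; rewrite -/l' -/B mulrAC ler_pdivrMr ?ltr_wpDl//.
by rewrite ler_wpM2l ?(ltW e0)// lerDl.
Qed.

End representation_eq.

(** * The grid coupling *)

Section grid_plan.
Context {R : realType} {n : nat}.
Variables (o : 'rV[R]_n) (dx : R) (mu : probability 'rV[R]_n R).
Hypothesis dx0 : 0 < dx.
Local Notation leb := (lebesgue_rV R n).

Definition cell_index (x : 'rV[R]_n) : 'rV[int]_n :=
  \row_i Num.floor ((x ord0 i - o ord0 i) / dx).

Lemma cell_indexP k x : cell o dx k x <-> cell_index x = k.
Proof.
have E i : (o ord0 i + (k ord0 i)%:~R * dx <= x ord0 i < o ord0 i + (k ord0 i + 1)%:~R * dx) =
    (cell_index x ord0 i == k ord0 i).
  by rewrite mxE floor_eq ler_pdivlMr// ltr_pdivrMr// lerBrDl ltrBlDl.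
split=> [H|ck i]; last by rewrite E -ck.
by apply/rowP => i; apply/eqP; rewrite -E.
Qed.

Let side (k : 'rV[int]_n) i : set (measurableTypeR R) :=
  [set` `[o ord0 i + (k ord0 i)%:~R * dx, o ord0 i + (k ord0 i + 1)%:~R * dx[].

Let measurable_side k i : measurable (side k i).
Proof. exact: measurable_itv. Qed.

Let cellE k : cell o dx k = [set x | forall i, side k i (x ord0 i)].
Proof. by apply/seteqP; split=> x H i; have := H i; rewrite /side/= in_itv. Qed.

Lemma measurable_cell k : measurable (cell o dx k).
Proof.
by rewrite cellE; exact: (lebesgue_rV_box (measurable_side k)).1.
Qed.

Lemma cell_volume k : leb (cell o dx k) = (dx ^+ n)%:E.
Proof.
rewrite cellE (lebesgue_rV_box (measurable_side k)).2.
rewrite (eq_bigr (fun=> dx%:E)) => [|i _].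
  by rewrite prodEFin prodr_const card_ord.
rewrite lebesgue_measure_itv/= lte_fin ltrD2l ltr_pM2r// ltr_int ltrDl ltr01.
by rewrite -EFinB intrD; congr (_%:E); ring.
Qed.

Definition same_cell : set ('rV[R]_n * 'rV[R]_n) := [set z | cell_index z.1 = cell_index z.2].

Lemma measurable_same_cell : measurable same_cell.
Proof.
rewrite (_ : same_cell = \bigcup_(k : 'rV[int]_n) (cell o dx k `*` cell o dx k)).
  apply: countable_bigcupT_measurable; first exact: countableP.
  by move=> k; apply: measurableX; exact: measurable_cell.
apply/seteqP; split=> [z /= zz|z [k _ [/= /cell_indexP h1 /cell_indexP h2]]].
  by exists (cell_index z.1) => //; split=> /=; apply/cell_indexP.
by rewrite /same_cell/= h1 h2.
Qed.

Lemma same_cell_close z : same_cell z -> enorm (z.1 - z.2) <= Num.sqrt n%:R * dx.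
Proof.
move=> zz; apply: enorm_le_coord; first exact: ltW.
move=> i; rewrite !mxE.
have /cell_indexP/(_ i) := esym zz; have /cell_indexP/(_ i) := erefl (cell_index z.1).
rewrite intrD; move: (_%:~R) => a; rewrite ler_norml => /andP[h1 h2] /andP[h3 h4].
by apply/andP; split; lra.
Qed.

Let dxn0 : 0 <= (dx ^+ n)^-1.
Proof. by rewrite invr_ge0 exprn_ge0// ltW. Qed.

(** Given the first point, the second is uniform in the same cell: dividing by the volume of a cell
    normalizes this conditional law. *)
Definition grid_plan :=
  mscale (NngNum dxn0) (mrestr (mu \x leb)%E measurable_same_cell).

HB.instance Definition _ := Measure.on grid_plan.

Let dxnV : (((dx ^+ n)^-1)%:E * (dx ^+ n)%:E = 1 :> \bar R)%E.
Proof. by rewrite -EFinM mulVf// expf_neq0 ?gt_eqF. Qed.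

Lemma grid_plan_fst A : measurable A -> grid_plan (A `*` setT) = mu A.
Proof.
move=> mA; rewrite /grid_plan /mscale/= /mrestr /product_measure1.
rewrite (eq_integral (fun x => (dx ^+ n)%:E * (\1_A x)%:E)%E) => [|x _].
  rewrite ge0_integralZl//= ?integral_indic ?setIT ?muleA ?dxnV ?mul1e//.
  - by apply/measurable_EFinP; exact: measurable_indic.
  - by rewrite lee_fin exprn_ge0// ltW.
rewrite /= indicE; case: (boolP (x \in A)) => xA.
  rewrite mule1 -(cell_volume (cell_index x)); congr (leb _).
  rewrite inE in xA; apply/seteqP; split=> y; rewrite /xsection/= inE.
    by move=> [_ /= /esym/cell_indexP].
  by move=> /cell_indexP/esym.
rewrite mule0 (_ : xsection _ _ = set0) ?measure0//.
by apply/seteqP; split=> y //; rewrite /xsection/= inE => -[[/= xA' _] _]; rewrite mem_set in xA.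
Qed.

Lemma grid_sum y : (\esum_(k in [set: 'rV[int]_n])
    (mu (cell o dx k) * ((dx ^+ n)^-1)%:E * (\1_(cell o dx k) y)%:E) =
  ((dx ^+ n)^-1)%:E * mu (cell o dx (cell_index y)))%E.
Proof.
have p0 k : (0 <= mu (cell o dx k) * ((dx ^+ n)^-1)%:E)%E by rewrite mule_ge0.
transitivity (\esum_(k in [set cell_index y]) (mu (cell o dx k) * ((dx ^+ n)^-1)%:E))%E; last first.
  by rewrite esum_set1// muleC.
rewrite [RHS]esum_mkcond; apply: eq_esum => k _; rewrite indicE.
have -> : (k \in [set cell_index y]) = (cell_index y == k).
  by apply/idP/eqP => [/set_mem ->//|->]; exact/mem_set.
have -> : (y \in cell o dx k) = (cell_index y == k).
  by apply/idP/eqP => [/set_mem/cell_indexP|/cell_indexP/mem_set].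
by case: eqP => _; rewrite ?mule1 ?mule0.
Qed.

Lemma grid_plan_snd A : measurable A -> grid_plan (setT `*` A) = grid o dx mu A.
Proof.
move=> mA; rewrite /grid_plan /mscale/= /mrestr.
have mS : measurable (setT `*` A `&` same_cell).
  by apply: measurableI; [exact: measurableX|exact: measurable_same_cell].
(* The second marginal is read off sections at fixed [y], so the order of integration is exchanged
   first. *)
have -> : (mu \x leb)%E (setT `*` A `&` same_cell) = (mu \x^ leb)%E (setT `*` A `&` same_cell).
  apply: (@product_measure_unique _ _ _ _ _ mu leb (mu \x^ leb)%E) => // B C mB mC.
  exact: product_measure2E.
rewrite /product_measure2 -ge0_integralZl//; last exact: measurable_fun_ysection.
rewrite /grid (integral_mkcond A); apply: eq_integral => y _.
rewrite patchE grid_sum /=; case: ifPn => yA.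
  congr (_ * mu _)%E; rewrite inE in yA; apply/seteqP; split=> x; rewrite /ysection/= inE.
    by move=> [_ /= /cell_indexP].
  by move=> /cell_indexP.
rewrite (_ : ysection _ _ = set0) ?measure0 ?mule0//.
by apply/seteqP; split=> x //; rewrite /ysection/= inE => -[[/= _ yA'] _]; rewrite mem_set in yA.
Qed.

Let grid_plan_setT : grid_plan setT = 1%E.
Proof. by rewrite -setXTT grid_plan_fst//; exact: probability_setT. Qed.

HB.instance Definition _ := Measure_isProbability.Build _ _ _ grid_plan grid_plan_setT.

Lemma grid_coupling (nu : probability 'rV[R]_n R) :
  (forall A, measurable A -> nu A = grid o dx mu A) ->
  exists2 pi : probability ('rV[R]_n * 'rV[R]_n)%type R, coupling mu nu pi &
    {ae pi, forall z, enorm (z.1 - z.2) <= Num.sqrt n%:R * dx}.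
Proof.
move=> nuE; exists grid_plan.
  split=> A mA; first exact: grid_plan_fst.
  by rewrite nuE// -grid_plan_snd.
exists (~` same_cell); split; first exact: measurableC measurable_same_cell.
  rewrite -[LHS]/(((dx ^+ n)^-1)%:E * (mu \x leb) (~` same_cell `&` same_cell))%E.
  by rewrite setICl measure0 mule0.
by apply: subsetC => z; exact: same_cell_close.
Qed.

End grid_plan.

(** * Bounds through images of a coupling *)

Section transport_bound.
Context {R : realType} {n : nat}.
Implicit Types (mu nu : probability 'rV[R]_n R) (pi : probability ('rV[R]_n * 'rV[R]_n)%type R).

Lemma Wp_le (p r : R) mu nu pi : 1 <= p -> 0 <= r -> coupling mu nu pi ->
  {ae pi, forall z, enorm (z.1 - z.2) <= r} -> (Wp p mu nu <= r%:E)%E.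
Proof.
move=> p1 r0 cpi pir; have p0 : 0 < p by exact: lt_le_trans p1.
apply: (@le_trans _ _ ((\int[pi]_z (enorm (z.1 - z.2) `^ p)%:E) `^ p^-1)%E).
  by apply: ereal_inf_lbound; exists pi.
have mz : measurable_fun setT (fun z : 'rV[R]_n * 'rV[R]_n => (enorm (z.1 - z.2) `^ p)%:E).
  apply/measurable_EFinP.
  exact: (measurableT_comp (measurable_powR p) measurable_enorm_sub).
have -> : r%:E = ((r `^ p)%:E `^ p^-1)%E.
  by rewrite poweR_EFin -powRrM mulfV ?gt_eqF// powRr1.
apply: gt0_ler_poweR; first by rewrite invr_ge0 ltW.
- by rewrite in_itv/= leey integral_ge0// => z _; rewrite lee_fin powR_ge0.
- by rewrite in_itv/= leey lee_fin powR_ge0.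
rewrite -(integral_prob_cst pi (r `^ p)%:E); apply: ae_ge0_le_integral => //.
- by move=> z _; rewrite lee_fin powR_ge0.
- by move=> z _; rewrite lee_fin powR_ge0.
apply: filterS pir => z zr _; rewrite lee_fin ge0_ler_powR ?nnegrE ?enorm_ge0//.
exact: ltW.
Qed.

(** The image of [pi] under [f] and [g] couples the two images, and its displacement is almost
    surely at most [r]; hence a bound that does not depend on [p]. *)
Lemma Wp_image_le (p D r : R) mu nu mu' nu' pi (f g : 'rV[R]_n -> 'rV[R]_n) :
  1 <= p -> 0 <= r -> coupling mu nu pi ->
  {ae pi, forall z, enorm (z.1 - z.2) <= D} ->
  measurable_fun setT f -> measurable_fun setT g ->
  (forall A, measurable A -> mu' A = pushforward mu f A) ->
  (forall A, measurable A -> nu' A = pushforward nu g A) ->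
  (forall x y, enorm (x - y) <= D -> enorm (f x - g y) <= r) ->
  (Wp p mu' nu' <= r%:E)%E.
Proof.
move=> p1 r0 [c1 c2] piD mf mg muE nuE fgr.
pose h z := (f z.1, g z.2).
have mh : measurable_fun setT h.
  apply/measurable_fun_pairP; split.
    exact: measurableT_comp mf measurable_fst.
  exact: measurableT_comp mg measurable_snd.
have mfA A : measurable A -> measurable (f @^-1` A).
  by move=> mA; rewrite -[X in measurable X]setTI; exact: mf.
have mgA A : measurable A -> measurable (g @^-1` A).
  by move=> mA; rewrite -[X in measurable X]setTI; exact: mg.
apply: (@Wp_le _ _ _ _ (image_prob pi mh)) => //.
  split=> A mA; rewrite image_probE.
    by rewrite muE// /pushforward -c1 ?preimage_setX//; exact: mfA.
  by rewrite nuE// /pushforward -c2 ?preimage_setX//; exact: mgA.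
have [N [mN N0 DN]] := piD.
have mc : measurable [set z : 'rV[R]_n * 'rV[R]_n | r < enorm (z.1 - z.2)].
  rewrite (_ : [set _ | _] = (fun z => enorm (z.1 - z.2)) @^-1` `]r, +oo[%classic).
    rewrite -[X in measurable X]setTI; apply: measurable_enorm_sub => //.
  by apply/seteqP; split=> z /=; rewrite in_itv/= andbT.
exists [set z | r < enorm (z.1 - z.2)]; split => //; last first.
  by move=> z /= /negP; rewrite -ltNge.
rewrite image_probE; apply/eqP; rewrite -measure_le0 -N0; apply: le_measure; rewrite ?inE//.
  by rewrite -[X in measurable X]setTI; exact: mh.
move=> z /= rz; apply: DN => /= zD.
by have := fgr _ _ zD; rewrite leNgt rz.
Qed.

(** A merely continuous [phi] is uniformly continuous only near bounded sets, so the estimate is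
    asked only for points [x] of a set [C0] carrying [mu]. *)
Lemma Rintegral_image_close (D eps C : R) mu nu mu' nu' pi (C0 : set 'rV[R]_n)
    (f g : 'rV[R]_n -> 'rV[R]_n) (phi : 'rV[R]_n -> R) :
  0 <= eps -> coupling mu nu pi ->
  {ae pi, forall z, enorm (z.1 - z.2) <= D} -> measurable C0 -> mu (~` C0) = 0%E ->
  measurable_fun setT f -> measurable_fun setT g ->
  (forall A, measurable A -> mu' A = pushforward mu f A) ->
  (forall A, measurable A -> nu' A = pushforward nu g A) ->
  measurable_fun setT phi -> (forall x, `|phi x| <= C) ->
  (forall x y, C0 x -> enorm (x - y) <= D -> `|phi (f x) - phi (g y)| <= eps) ->
  `|\int[mu']_x phi x - \int[nu']_x phi x| <= eps.
Proof.
move=> eps0 cpi piD mC0 muC0 mf mg muE nuE mphi phiC phie.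
have E (m m' : probability 'rV[R]_n R) (h : 'rV[R]_n -> 'rV[R]_n) (mh : measurable_fun setT h) :
    (forall A, measurable A -> m' A = pushforward m h A) ->
    \int[m']_x phi x = \int[m]_x phi (h x).
  move=> mE; rewrite -(Rintegral_image_prob m mh mphi phiC); congr fine.
  by apply: eq_measure_integral => A mA _; exact: mE.
rewrite (E _ _ _ mf muE) (E _ _ _ mg nuE).
have mpf : measurable_fun setT (fun x => phi (f x)) by exact: measurableT_comp mphi mf.
have mpg : measurable_fun setT (fun x => phi (g x)) by exact: measurableT_comp mphi mg.
rewrite (coupling_Rintegral cpi mpf mpg (fun x => phiC _) (fun x => phiC _)).
have md : measurable_fun setT (fun z : 'rV[R]_n * 'rV[R]_n => phi (f z.1) - phi (g z.2)).
  apply: measurable_funB.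
    exact: measurableT_comp mpf measurable_fst.
  exact: measurableT_comp mpg measurable_snd.
have bd z : `|phi (f z.1) - phi (g z.2)| <= C + C.
  by rewrite (le_trans (ler_normB _ _))// lerD.
have Id := bounded_integrable pi md bd.
have aeC : {ae pi, forall z : 'rV[R]_n * 'rV[R]_n, C0 z.1}.
  exists (~` C0 `*` setT); split; first by apply: measurableX => //; exact: measurableC.
    by rewrite cpi.1//; exact: measurableC.
  by move=> z.
rewrite -lee_fin EFin_normr_Rintegral//.
apply: (le_trans (le_abse_integral pi measurableT (measurable_int _ Id))).
have ae0 : {ae pi, forall z : 'rV[R]_n * 'rV[R]_n, `|phi (f z.1) - phi (g z.2)| <= eps}.
  by apply: filterS2 aeC piD => z; exact: phie.
rewrite -(integral_prob_cst pi eps%:E); apply: ae_ge0_le_integral => //.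
- by apply: measurableT_comp => //; exact: measurable_int Id.
- by apply: filterS ae0 => z h _.
Qed.

End transport_bound.

(** * Comparison of the scheme with the solution *)

Section vector_field_constants.
Context {R : realType} {n : nat}.

Lemma dirac_moment (p : R) (a : 'rV[R]_n) :
  (\int[(\d_a : probability 'rV[R]_n R)]_x (enorm x `^ p)%:E < +oo)%E.
Proof.
rewrite integral_dirac// ?diracT ?mul1e ?ltry//.
apply/measurable_EFinP; apply: (measurableT_comp (measurable_powR p)).
exact: continuous_measurable_rV contn_enorm.
Qed.

Variables (p L M K : R) (v : Pp p n -> 'rV[R]_n -> 'rV[R]_n).
Hypotheses (n0 : (0 < n)%N) (p1 : 1 <= p) (hv : hypothesis_H v L M K).

Let e := delta_mx ord0 (Ordinal n0) : 'rV[R]_n.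

Let dirac_Pp a : Pp p n := MkPp (dirac_moment p a).

(** The signs of the constants have to be deduced from the inequalities. Here two points at distance
    1, which exist in positive dimension, force the sign; a Dirac mass supplies the measure. *)
Lemma hypH_L_ge0 : 0 <= L.
Proof.
have := hypH_lip hv (dirac_Pp 0) e 0; rewrite subr0 enorm_delta mulr1.
exact: le_trans (enorm_ge0 _).
Qed.

Lemma hypH_M_ge0 : 0 <= M.
Proof. by have := hypH_bound hv (dirac_Pp 0) 0; apply: le_trans; exact: enorm_ge0. Qed.

(* If K < 0 the hypothesis makes every Wasserstein distance nonpositive, which
   fails for two distinct Dirac masses. *)
Lemma hypH_K_ge0 : 0 <= K.
Proof.
rewrite leNgt; apply/negP => K0.
have W0 : (Wp p (dirac_Pp 0) (dirac_Pp e) < (2^-1)%:E * (2^-1)%:E)%E.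
  rewrite ltNge; apply/negP => W1; have := hypH_dep hv (dirac_Pp 0) (dirac_Pp e).
  apply/negP; rewrite -ltNge; apply: (@lt_le_trans _ _ 0%E).
    by rewrite nmule_rlt0 ?lte_fin// (lt_le_trans _ W1)// -EFinM lte_fin mulr_gt0.
  apply: (@le_trans _ _ (enorm (v (dirac_Pp 0) 0 - v (dirac_Pp e) 0))%:E).
    by rewrite lee_fin enorm_ge0.
  by apply: ereal_sup_ubound; exists 0.
have d0 : (0 : R) < 2^-1 * 2^-1 by rewrite mulr_gt0.
have tb x : `|trdist [set 0 : 'rV[R]_n] x| <= 1 by rewrite ger0_norm ?trdist_ge0 ?trdist_le1.
have tl x y : `|trdist [set 0 : 'rV[R]_n] x - trdist [set 0] y| <= 1 * enorm (x - y).
  by rewrite mul1r trdist_lip.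
have := Wp_lipschitz p1 d0 W0 ler01 tb tl.
have mt : measurable_fun setT (trdist [set 0 : 'rV[R]_n]).
  exact: continuous_measurable_rV (lipschitz_enorm_contn ler01 tl).
have E a : \int[dirac_Pp a]_x trdist [set 0 : 'rV[R]_n] x = trdist [set 0] a.
  rewrite /Rintegral integral_dirac//; last exact/measurable_EFinP.
  by rewrite diracT mul1e.
rewrite !E trdist0// sub0r normrN ger0_norm ?trdist_ge0// mul1r.
apply/negP; rewrite -ltNge; apply: (@lt_le_trans _ _ 1); first by lra.
by apply: trdist_ge => // y ->; rewrite subr0 enorm_delta.
Qed.

End vector_field_constants.

(* The source at time t involves a supremum over all trajectories, whose time
   regularity is not known; the supremum A of (|g - h| + c) e^(-2 lambda (t - a))
   is only assumed finite, and one integration gives A <= S + c + A / 2. *)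
Section gronwall_step.
Context {R : realType} {n : nat}.
Variables (I : Type) (J : set I) (a b lambda c S B : R).
Variables g h g' h' : I -> R -> 'rV[R]_n.
Hypotheses (lambda0 : 0 <= lambda) (c0 : 0 <= c) (S0 : 0 <= S).
Hypothesis gv : forall z t, J z -> a <= t <= b -> has_velocity (g z) t (g' z t).
Hypothesis hv : forall z t, J z -> a <= t <= b -> has_velocity (h z) t (h' z t).
Hypothesis gha : forall z, J z -> enorm (g z a - h z a) <= S.
Hypothesis ghB : forall z t, J z -> a <= t <= b -> enorm (g z t - h z t) <= B.
Hypothesis gh' : forall t s, a <= t <= b -> 0 <= s ->
  (forall z, J z -> enorm (g z t - h z t) <= s) ->
  forall z, J z -> enorm (g' z t - h' z t) <= lambda * (s + c).

Let w t := expR (2 * lambda * (t - a)).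

Let w1 t : a <= t -> 1 <= w t.
Proof. by move=> at_; rewrite -expR0 ler_expR mulr_ge0 ?subr_ge0// mulr_ge0. Qed.

Let integrate (A : R) :
  (forall z t, J z -> a <= t <= b -> enorm (g z t - h z t) + c <= A * w t) ->
  forall z t, J z -> a <= t <= b -> enorm (g z t - h z t) <= S + A / 2 * (w t - 1).
Proof.
move=> HA z t Jz /andP[at_ tb].
have w0 : w a = 1 by rewrite /w subrr mulr0 expR0.
have := @enorm_le_majorant _ _ (fun r => g z r - h z r) (fun r => g' z r - h' z r)
  (fun r => A / 2 * w r) (fun r => A / 2 * (2 * lambda) * w r) a t at_.
move=> /(_ _ _ _)/wrap[r /andP[ar rt]||r /andP[ar rt]|].
- by apply: has_velocityB; [apply: gv|apply: hv] => //; rewrite ar (le_trans rt).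
- by move=> r _; exact: is_derive_expR_affine.
- have rab : a <= r <= b by rewrite ar (le_trans rt).
  have := @gh' r (A * w r - c) rab; rewrite subrK => H.
  rewrite (le_trans (H _ _ _ Jz))//.
  + by have := HA z r Jz rab; have := enorm_ge0 (g z r - h z r); lra.
  + by move=> z' Jz'; have := HA z' r Jz' rab; lra.
  + by rewrite le_eqVlt; apply/orP; left; apply/eqP; field.
rewrite w0 => h1; have := gha Jz; rewrite mulrBr => h2.
have := ler_enorm_sub (g z t - h z t) (g z a - h z a) 0; rewrite !subr0; lra.
Qed.

Lemma gronwall_step z t : J z -> a <= t <= b ->
  enorm (g z t - h z t) <= (S + c) * expR (2 * lambda * (t - a)) - c.
Proof.
pose E := [set e | exists z t, [/\ J z, a <= t <= b & e = (enorm (g z t - h z t) + c) / w t]].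
have wgt0 r : 0 < w r by exact: expR_gt0.
have EB e : E e -> e <= `|B| + c.
  move=> [z' [r [Jz rab ->]]]; rewrite ler_pdivrMr//.
  have ar : a <= r by case/andP: rab.
  have Bc : 0 <= `|B| + c by rewrite addr_ge0.
  rewrite (le_trans _ (ler_peMr Bc (w1 ar)))// lerD2r.
  exact: le_trans (ghB Jz rab) (ler_norm B).
have boot A : (forall e, E e -> e <= A) -> forall e, E e -> e <= S + c + A / 2.
  move=> EA _ [z' [r [Jz rab ->]]].
  have HA z0 t0 : J z0 -> a <= t0 <= b -> enorm (g z0 t0 - h z0 t0) + c <= A * w t0.
    by move=> Jz0 tab; rewrite -ler_pdivrMr//; apply: EA; exists z0, t0.
  have := integrate HA Jz rab; have ar : a <= r by case/andP: rab.
  have h1 := HA _ _ Jz rab; have u0 := enorm_ge0 (g z' r - h z' r).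
  have A0 : 0 <= A by rewrite -(pmulr_lge0 _ (wgt0 r)) (le_trans _ h1)// addr_ge0.
  have h2 := ler_peMr (addr_ge0 S0 c0) (w1 ar).
  by rewrite ler_pdivrMr// !mulrDl => h3; rewrite mulrDl in h2; lra.
have H := half_bootstrap EB boot; move=> Jz tab.
have := @integrate (2 * (S + c)); rewrite mulrAC divff// mul1r => H'.
have := H' _ z t Jz tab; rewrite -/(w t) => /(_ _)/wrap[z' r Jz' rab|]; last by lra.
by rewrite -ler_pdivrMr//; apply: H; exists z', r.
Qed.

End gronwall_step.

(** With m the ceiling of [X], the exponent is at most m + m / 4, and e^(1/4) <= 4/3 < 2 because 1 -
    1/4 <= e^(-1/4). So the factor 2 in the base 2 e pays for the surplus quarter. *)
Lemma expR_le_2e (R : realType) (s X : R) : 0 <= X -> 2 * s <= X + X / 4 ->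
  expR (2 * s) <= (2 * expR 1) ^ Num.ceil X.
Proof.
move=> X0 sX.
have : X <= (Num.ceil X)%:~R by exact: ceil_ge.
have : 0 <= Num.ceil X by rewrite -(ler_int R) (le_trans X0)// ceil_ge.
case: (Num.ceil X) => // m _ Xm.
rewrite -exprnP exprMn -expRM_natl mulr1.
have q2 : expR (4^-1 : R) <= 2.
  have := expR_ge1Dx (- (4^-1) : R); rewrite expRN => h.
  have e0 := expR_gt0 (4^-1 : R).
  have : 3 / 4 <= (expR (4^-1 : R))^-1 by lra.
  by rewrite -(ler_pM2r e0) mulVf ?gt_eqF//; lra.
apply: (@le_trans _ _ (expR (m%:R * 4^-1) * expR m%:R)).
  by rewrite -expRD ler_expR; move: Xm; rewrite -pmulrn; lra.
rewrite ler_wpM2r ?expR_ge0// mulrC expRM_natr.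
by apply: lerXn2r q2; rewrite nnegrE ?expR_ge0.
Qed.

Section clamp.
Context {R : realType}.
Variable T : R.
Hypothesis T0 : 0 <= T.

(* Freezes curves outside [0, T], where nothing is known about them. *)
Definition clamp (t : R) := Num.max 0 (Num.min t T).

Lemma clamp_in t : 0 <= clamp t <= T.
Proof. by rewrite /clamp le_max lexx/= ge_max ge_min lexx orbT andbT. Qed.

Lemma clamp_id t : 0 <= t <= T -> clamp t = t.
Proof. by case/andP => t0 tT; rewrite /clamp (min_idPl tT) (max_idPr t0). Qed.

Lemma clamp_contraction s t : `|clamp s - clamp t| <= `|s - t|.
Proof.
have H (a b : R) : `|Num.max 0 a - Num.max 0 b| <= `|a - b|.
  have := ler_norm (a - b); have := ler_norm (b - a); rewrite (distrC b) ler_norml => h1 h2.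
  by apply/andP; case: (leP 0 a) => ha; case: (leP 0 b) => hb; split; lra.
apply: (le_trans (H _ _)).
have := ler_norm (s - t); have := ler_norm (t - s); rewrite (distrC t) ler_norml => h1 h2.
by apply/andP; case: (leP s T) => ha; case: (leP t T) => hb; split; lra.
Qed.

End clamp.

(** * The solution as an image under its own characteristics *)

Section exact_solution.
Context {R : realType} {n : nat}.
Variables (p T L M K : R) (v : Pp p n -> 'rV[R]_n -> 'rV[R]_n).
Variables (mu0 : Pp p n) (mu : R -> Pp p n).
Hypotheses (n0 : (0 < n)%N) (p1 : 1 <= p) (T0 : 0 < T).
Hypotheses (hv : hypothesis_H v L M K) (hmu : is_solution v T mu0 mu).

Definition clamped_field (t : R) x := v (mu (clamp T t)) x.

Lemma hypH_diff (m1 m2 : Pp p n) (s : R) x : (Wp p m1 m2 <= s%:E)%E ->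
  enorm (v m1 x - v m2 x) <= K * s.
Proof.
move=> ms; rewrite -lee_fin EFinM.
apply: (@le_trans _ _ (K%:E * Wp p m1 m2)%E); last first.
  by apply: lee_wpmul2l => //; rewrite lee_fin; exact: hypH_K_ge0 hv.
by apply: le_trans (hypH_dep hv m1 m2); apply: ereal_sup_ubound; exists x.
Qed.

Lemma clamped_Wp (t e : R) : 0 < e -> exists2 d : R, 0 < d &
  forall s, `|s - t| < d -> (Wp p (mu (clamp T s)) (mu (clamp T t)) < e%:E)%E.
Proof.
move=> e0; have [_ cont _ _] := hmu.
have tT : clamp T t \in `[0, T] by rewrite in_itv/= clamp_in// ltW.
have nb : nbhs (0%E : \bar R) [set x | (x < e%:E)%E].
  by apply: open_nbhs_nbhs; split; [exact: open_ereal_lt_ereal|rewrite /= lte_fin].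
have := cont _ tT _ nb.
rewrite /within/= => /nbhs_ballP[d /= d0 dP]; exists d => // s std.
have sT : clamp T s \in `[0, T] by rewrite in_itv/= clamp_in// ltW.
apply: (dP (clamp T s) _ sT); rewrite /ball/= distrC.
exact: le_lt_trans (clamp_contraction T _ _) std.
Qed.

Lemma clamped_regular : regular_field clamped_field L M.
Proof.
have K0 := hypH_K_ge0 n0 p1 hv.
split.
- exact: hypH_L_ge0 n0 hv.
- by move=> t x y; exact: hypH_lip hv _ _ _.
- by move=> t x; exact: hypH_bound hv _ _.
- move=> t e e0; have eK : 0 < e / (K + 1) by rewrite divr_gt0// ltr_wpDl.
  have [d d0 dP] := clamped_Wp t eK; exists d => // s sd x.
  apply: (le_trans (hypH_diff x (ltW (dP s sd)))).
  by rewrite mulrCA ger_pMr// ler_pdivrMr ?ltr_wpDl// mul1r lerDl.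
Qed.

Variable Z : R -> R -> 'rV[R]_n -> 'rV[R]_n.
Hypothesis ZW : flow_map clamped_field Z.

Lemma solution_transport t : 0 <= t <= T ->
  forall A, measurable A -> mu t A = pushforward mu0 (Z 0 t) A.
Proof.
move=> tT A mA; have t0 : 0 <= t by case/andP: tT.
have [_ _ init weak] := hmu.
have mt_eq (f : R * 'rV[R]_n -> R) : test_function T f ->
    \int[lebesgue_measure]_(t in `[0, T]) (\int[mu (clamp T t)]_x
    (dt_test f (t, x) + \sum_(i < n) grad_test f (t, x) ord0 i * clamped_field t x ord0 i)) = 0.
  move=> /weak; apply: etrans; apply: (@eq_Rintegral _ _ R (@lebesgue_measure R) `[0, T]%classic) => s; rewrite inE/= in_itv/= => sT.
  by rewrite /clamped_field clamp_id.
have mZ := flow_map_measurable clamped_regular ZW t0.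
have := representation p1 T0 clamped_regular clamped_Wp mt_eq ZW tT mA.
rewrite (clamp_id tT) => ->; rewrite /pushforward clamp_id ?lexx ?ltW// init//.
by rewrite -[X in measurable X]setTI; exact: mZ.
Qed.

End exact_solution.

Section autonomous_flow.
Context {R : realType} {n : nat}.
Variables (w : 'rV[R]_n -> 'rV[R]_n) (L M : R) (Phi : R -> 'rV[R]_n -> 'rV[R]_n).
Hypotheses (L0 : 0 <= L) (wl : forall x y, enorm (w x - w y) <= L * enorm (x - y)).
Hypotheses (wM : forall x, enorm (w x) <= M) (Phiw : is_flow w Phi).

Lemma autonomous_velocity (a t : R) x :
  has_velocity (fun s => Phi (s - a) x) t (w (Phi (t - a) x)).
Proof.
move=> i; have := is_derive_has_velocity (Phiw.2 (t - a) x) i => H.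
have S : is_derive t (1 : R) (fun s => s - a) (1 : R).
  by apply: is_derive_eq; rewrite subr0.
have := @is_derive1_comp _ (fun s => Phi s x ord0 i) (fun s => s - a) t _ _ H S.
by rewrite mulr1.
Qed.

Lemma autonomous_measurable (t : R) : 0 <= t -> measurable_fun setT (Phi t).
Proof.
move=> t0; have rw : regular_field (fun=> w) L M.
  apply: RegularField => // t' e e0; exists 1 => // s _ x.
  by rewrite subrr enorm0 ltW.
apply: (@lipschitz_measurable _ _ _ _ (2 * expR ((2 * L + 1) * (t - 0)))).
  by rewrite mulr_ge0// expR_ge0.
move=> x y.
have sol z : solves (fun=> w) 0 (fun s => Phi s z).
  by move=> s _; exact: is_derive_has_velocity (Phiw.2 s z).
have := solves_stable rw (sol x) (sol y) t0.
by rewrite !Phiw.1 mulrAC.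
Qed.

Lemma autonomous_move (t : R) x : 0 <= t -> enorm (Phi t x - x) <= M * t.
Proof.
move=> t0.
have H s : 0 <= s -> has_velocity (fun s => Phi s x) s (w (Phi s x)).
  by move=> _; exact: is_derive_has_velocity (Phiw.2 s x).
have := lipschitz_from_velocity H (fun s => wM _) t0 (lexx 0).
by rewrite Phiw.1 subr0 ger0_norm.
Qed.

End autonomous_flow.

(** * Gronwall comparison of the two transport maps *)

Section scheme_comparison.
Context {R : realType} {n : nat}.
Variables (p T L M K : R) (v : Pp p n -> 'rV[R]_n -> 'rV[R]_n).
Variables (mu0 : Pp p n) (mu : R -> Pp p n).
Hypotheses (n0 : (0 < n)%N) (p1 : 1 <= p) (T0 : 0 < T) (lambda0 : 0 < L + K).
Hypotheses (hv : hypothesis_H v L M K) (hmu : is_solution v T mu0 mu).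
Variable Z : R -> R -> 'rV[R]_n -> 'rV[R]_n.
Hypothesis ZW : flow_map (clamped_field T v mu) Z.
Variables (o : 'rV[R]_n) (dx : R) (k : nat) (mu3 : R -> Pp p n).
Hypotheses (dx0 : 0 < dx) (hmu3 : scheme3 v T mu0 o dx k mu3).

Let dt := T / 2 ^+ k.
Let D := Num.sqrt n%:R * dx.
Let c := K * M * dt / (L + K).

Let L0 : 0 <= L := hypH_L_ge0 n0 hv.
Let M0 : 0 <= M := hypH_M_ge0 hv.
Let K0 : 0 <= K := hypH_K_ge0 n0 p1 hv.
Let rW := clamped_regular n0 p1 T0 hv hmu.

Let dt0 : 0 < dt.
Proof. by rewrite /dt divr_gt0// exprn_gt0. Qed.

Let D0 : 0 <= D.
Proof. by rewrite /D mulr_ge0 ?sqrtr_ge0// ltW. Qed.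

Let c0 : 0 <= c.
Proof. by rewrite /c divr_ge0 ?mulr_ge0// ltW. Qed.

(** The solution of y' = 2 (L + K) (y + c) with y(0) = D. The equation is autonomous, so restarting
    from the value reached at a grid time loses nothing and the steps of the scheme concatenate. *)
Definition scheme_gap (t : R) := (D + c) * expR (2 * (L + K) * t) - c.

Lemma scheme_gap_ge0 t : 0 <= t -> 0 <= scheme_gap t.
Proof.
move=> t0; rewrite /scheme_gap subr_ge0.
have e1 : 1 <= expR (2 * (L + K) * t).
  by rewrite -expR0 ler_expR !mulr_ge0// ltW.
by rewrite (le_trans _ (ler_peMr (addr_ge0 D0 c0) e1))// lerDr.
Qed.

(** The last bound is required of all pairs within [D], not almost all, because [gronwall_step]
    works with a supremum over a set of pairs. *)
Let transported t (Y : 'rV[R]_n -> 'rV[R]_n) :=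
  [/\ measurable_fun setT Y,
      forall A, measurable A -> mu3 t A = pushforward (mu3 0) Y A
    & forall x y, enorm (x - y) <= D -> enorm (Z 0 t x - Y y) <= scheme_gap t].

Let scheme_step (i : nat) (Y : 'rV[R]_n -> 'rV[R]_n) : (i < 2 ^ k)%N ->
  transported (i%:R * dt) Y ->
  forall t, i%:R * dt <= t <= i.+1%:R * dt -> exists Y', transported t Y'.
Proof.
move=> ik; have [Phi flPhi muPhi] := hmu3.2 i ik; rewrite -/dt in muPhi.
set a := i%:R * dt; set b := i.+1%:R * dt => -[mY muY ZY].
have a0 : 0 <= a by rewrite /a mulr_ge0// ltW.
have bE : b = a + dt by rewrite /b /a -natr1 mulrDl mul1r.
have bT : b <= T.
  rewrite /b /dt mulrCA ger_pMr// ler_pdivrMr ?exprn_gt0// mul1r -natrX ler_nat.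
  exact: ik.
have ab : a <= b by rewrite bE lerDl ltW.
pose w := v (mu3 a).
have wl x y : enorm (w x - w y) <= L * enorm (x - y) by exact: hypH_lip hv _ _ _.
have wM x : enorm (w x) <= M by exact: hypH_bound hv _ _.
have [pi cpi piD] := grid_coupling dx0 hmu3.1.
pose J := [set z : 'rV[R]_n * 'rV[R]_n | enorm (z.1 - z.2) <= D].
pose g (z : 'rV[R]_n * 'rV[R]_n) s := Z 0 s z.1.
pose h (z : 'rV[R]_n * 'rV[R]_n) s := Phi (s - a) (Y z.2).
pose g' (z : 'rV[R]_n * 'rV[R]_n) s := clamped_field T v mu s (g z s).
pose h' (z : 'rV[R]_n * 'rV[R]_n) s := w (h z s).
have S0 := scheme_gap_ge0 a0.
have hmove z s : a <= s <= b -> enorm (h z s - Y z.2) <= M * dt.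
  case/andP=> as_ sb; have sa : 0 <= s - a by rewrite subr_ge0.
  by rewrite (le_trans (autonomous_move wM flPhi _ sa))// ler_wpM2l//; lra.
have gmove z s : a <= s <= b -> enorm (g z s - g z a) <= M * dt.
  case/andP=> as_ sb; rewrite /g (flow_map_comp rW ZW _ a0 as_).
  by rewrite (le_trans (flow_map_move rW ZW _ as_))// ler_wpM2l//; lra.
have gv z s : J z -> a <= s <= b -> has_velocity (g z) s (g' z s).
  by move=> _ /andP[as_ sb]; apply: ZW.2; exact: le_trans as_.
have hvel z s : J z -> a <= s <= b -> has_velocity (h z) s (h' z s).
  by move=> _ _; exact: autonomous_velocity.
have gha z : J z -> enorm (g z a - h z a) <= scheme_gap a.
  by move=> Jz; rewrite /h subrr flPhi.1; exact: ZY.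
(* A crude bound from the maximal speed; [gronwall_step] needs it only for finiteness. *)
have ghB z s : J z -> a <= s <= b -> enorm (g z s - h z s) <= M * dt + (scheme_gap a + M * dt).
  move=> Jz sab; rewrite (le_trans (ler_enorm_sub _ (g z a) _))// lerD//; first exact: gmove.
  rewrite (le_trans (ler_enorm_sub _ (Y z.2) _))// lerD//; first exact: ZY.
  by rewrite enormC; exact: hmove.
have gh' s r : a <= s <= b -> 0 <= r -> (forall z, J z -> enorm (g z s - h z s) <= r) ->
    forall z, J z -> enorm (g' z s - h' z s) <= (L + K) * (r + c).
  move=> sab r0 ghr z Jz; have [as_ sb] := andP sab.
  have sT : 0 <= s <= T by rewrite (le_trans a0 as_) (le_trans sb bT).
  have s0 : 0 <= s by case/andP: sT.
  (* The scheme's velocity is frozen at the start [a] of the step, so the current [mu s] is compared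
     with [mu3 a]. This lag of at most [dt] adds [M * dt] to the gap [r] at time [s]. *)
  have Wr : (Wp p (mu s) (mu3 a) <= (r + M * dt)%:E)%E.
    apply: (Wp_image_le (f := Z 0 s) (g := Y) p1 _ cpi piD) => //.
    - by rewrite addr_ge0// mulr_ge0// ltW.
    - exact: (flow_map_measurable rW ZW s0).
    - exact: (solution_transport n0 p1 T0 hv hmu ZW sT).
    - move=> x y xy; rewrite (le_trans (ler_enorm_sub _ (h (x, y) s) _))// lerD//.
        exact: (ghr (x, y)).
      exact: (hmove (x, y)).
  (* This identity fixes the value of [c]: the source K M dt is absorbed as a shift of the
     unknown. *)
  have -> : (L + K) * (r + c) = L * r + K * (r + M * dt).
    by rewrite /c; field; rewrite gt_eqF.
  rewrite /g' /h' /clamped_field (clamp_id sT).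
  rewrite (le_trans (ler_enorm_sub _ (v (mu s) (h z s)) _))// lerD//.
    by rewrite (le_trans (hypH_lip hv _ _ _))// ler_wpM2l//; exact: ghr.
  exact: (hypH_diff n0 p1 hv _ Wr).
move=> t tab; have [at_ tb] := andP tab.
exists (fun y => Phi (t - a) (Y y)); split.
- apply: (measurableT_comp _ mY).
  by apply: (autonomous_measurable L0 wl wM flPhi); rewrite subr_ge0.
- move=> A mA; rewrite muPhi// -/a /pushforward muY//.
  rewrite -[X in measurable X]setTI.
  by apply: (autonomous_measurable L0 wl wM flPhi) => //; rewrite subr_ge0.
- move=> x y xy.
  have := gronwall_step (ltW lambda0) c0 S0 gv hvel gha ghB gh' (z := (x, y)) xy tab.
  have -> // : scheme_gap t = (scheme_gap a + c) * expR (2 * (L + K) * (t - a)) - c.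
  rewrite /scheme_gap subrK -(mulrA (D + c) (expR _)) -expRD -mulrDr.
  by rewrite [a + _]addrC subrK.
Qed.

Lemma scheme_comparison t : 0 <= t <= T -> exists Y : 'rV[R]_n -> 'rV[R]_n,
  [/\ measurable_fun setT Y,
      forall A, measurable A -> mu3 t A = pushforward (mu3 0) Y A
    & forall x y, enorm (x - y) <= D -> enorm (Z 0 t x - Y y) <= scheme_gap t].
Proof.
have steps (i : nat) : (i <= 2 ^ k)%N -> forall s, 0 <= s <= i%:R * dt ->
    exists Y, transported s Y.
  elim: i => [_ s|i IH ik s /andP[s0 si]].
    rewrite mul0r -eq_le => /eqP <-; exists id; split => // x y xy.
    by rewrite ZW.1 /scheme_gap mulr0 expR0 mulr1 addrK.
  case: (leP s (i%:R * dt)) => [sa|/ltW sa].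
    by apply: IH; [exact: ltnW|rewrite s0].
  have [Y tY] : exists Y, transported (i%:R * dt) Y.
    by apply: IH; [exact: ltnW|rewrite lexx mulr_ge0// ltW].
  by apply: (scheme_step ik tY); rewrite sa.
move=> tT; apply: (steps (2 ^ k)%N) => //.
by rewrite natrX /dt mulrC divfK// expf_neq0.
Qed.

End scheme_comparison.

(** Only [x] is confined to the ball; [y] will be an image under the scheme, which then needs no
    support bound of its own. *)
Lemma uniform_on_normball {R : realType} {n : nat} (phi : 'rV[R]_n -> R) (r e : R) :
  contn phi -> 0 < e -> exists2 d : R, 0 < d &
    forall x y, `|x| <= r -> `|x - y| < d -> `|phi x - phi y| <= e.
Proof.
move=> cphi e0.
have /compact_near_coveringP cov := @compact_normball R n r.
have H : \forall d \near (0 : R)^'+, [set x : 'rV[R]_n | `|x| <= r] `<=`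
    [set x | forall y, `|x - y| < d -> `|phi x - phi y| <= e].
  apply: cov => x xr.
  have e2 : 0 < e / 2 by rewrite divr_gt0.
  have /cvgrPdist_lt/(_ _ e2)/nbhs_ballP[d /= d0 dP] := cphi x.
  have d2 : 0 < d / 2 by rewrite divr_gt0.
  exists (ball x (d / 2), [set s : R | s < d / 2]) => /=.
    by split; [exact: nbhsx_ballx|exact: nbhs_right_lt].
  move=> [z s] /= [xz sd] y zy; move: xz; rewrite -ball_normE/= => xz.
  have zd : `|x - z| < d by rewrite (splitr d) (lt_trans xz)// ltrDl.
  have yd : `|x - y| < d.
    have -> : x - y = (x - z) + (z - y) by rewrite addrA subrK.
    by rewrite (le_lt_trans (ler_normD _ _))// (splitr d) ltrD// (lt_trans zy).
  have h1 : `|phi x - phi z| < e / 2 by apply: dP; rewrite -ball_normE.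
  have h2 : `|phi x - phi y| < e / 2 by apply: dP; rewrite -ball_normE.
  have -> : phi z - phi y = (phi x - phi y) - (phi x - phi z) by ring.
  by rewrite (le_trans (ler_normB _ _))// (splitr e) lerD// ltW.
near (0 : R)^'+ => d; exists d; first by [].
by move=> x y xr; apply: (near H d).
Unshelve. all: end_near.
Qed.

(** * From the Gronwall bound to the stated constants *)

Section gap_bounds.
Context {R : realType} {n : nat}.
Variables (p T L M K : R) (v : Pp p n -> 'rV[R]_n -> 'rV[R]_n).
Hypotheses (n0 : (0 < n)%N) (p1 : 1 <= p) (T0 : 0 < T) (lambda0 : 0 < L + K).
Hypothesis hv : hypothesis_H v L M K.

Let L0 : 0 <= L := hypH_L_ge0 n0 hv.
Let M0 : 0 <= M := hypH_M_ge0 hv.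
Let K0 : 0 <= K := hypH_K_ge0 n0 p1 hv.

Lemma scheme_gap_mono (dx : R) (k : nat) (t : R) : 0 < dx -> 0 <= t <= T ->
  scheme_gap (n := n) T L M K dx k t <= scheme_gap (n := n) T L M K dx k T.
Proof.
move=> dx0 /andP[t0 tT]; rewrite /scheme_gap lerD2r ler_wpM2l//.
  by rewrite addr_ge0 ?divr_ge0 ?mulr_ge0 ?exprn_ge0 ?sqrtr_ge0// ltW.
by rewrite ler_expR ler_wpM2l// mulr_ge0// ltW.
Qed.

(** Write the gap as D E + c (E - 1), with E the exponential of 2 (L + K) T. The first term uses
    [expR_le_2e], since the maximum m satisfies 2 L <= m and 2 K <= m / 4; the second only enlarges
    the rate to 4 L + 4 K. *)
Lemma scheme_gap_le (dx : R) (k : nat) : 0 < dx ->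
  scheme_gap (n := n) T L M K dx k T <=
    dx * Num.sqrt n%:R * (2 * expR 1) ^ Num.ceil (T * Num.max (2 * L) (8 * K)) +
    4 * K * M * (T / 2 ^+ k) * ((expR (T * (4 * L + 4 * K)) - 1) / (4 * L + 4 * K)).
Proof.
move=> dx0; set X := T * _.
have X0 : 0 <= X by rewrite /X mulr_ge0 ?(ltW T0)// le_max mulr_ge0.
have h1 : expR (2 * ((L + K) * T)) <= (2 * expR 1) ^ Num.ceil X.
  apply: expR_le_2e => //.
  have : 2 * L <= Num.max (2 * L) (8 * K) by rewrite le_max lexx.
  have : 8 * K <= Num.max (2 * L) (8 * K) by rewrite le_max lexx orbT.
  rewrite /X; move: (Num.max _ _) => m hK hL.
  have : (2 * (L + K)) * T <= (m + m / 4) * T by rewrite ler_wpM2r ?(ltW T0)//; lra.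
  by lra.
have h2 : expR (2 * ((L + K) * T)) <= expR (T * (4 * L + 4 * K)).
  rewrite ler_expR; have : 0 <= (L + K) * T by rewrite mulr_ge0// ltW.
  by lra.
rewrite /scheme_gap -[2 * (L + K) * T]mulrA; set E := expR _ in h1 h2 *.
set F := expR _ in h2 *.
have D0 : 0 <= Num.sqrt n%:R * dx by rewrite mulr_ge0 ?sqrtr_ge0// ltW.
have h3 := ler_wpM2l D0 h1.
have KM0 : 0 <= K * M * (T / 2 ^+ k) / (L + K).
  by rewrite divr_ge0 ?mulr_ge0 ?invr_ge0 ?exprn_ge0// ltW.
have h4 := ler_wpM2l KM0 h2.
have -> : 4 * K * M * (T / 2 ^+ k) * ((F - 1) / (4 * L + 4 * K)) =
    K * M * (T / 2 ^+ k) / (L + K) * (F - 1).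
  by field; rewrite gt_eqF//= -mulrDr mulf_neq0// gt_eqF.
by rewrite [dx * _]mulrC; lra.
Qed.

Lemma scheme_gap_small (e : R) : 0 < e -> exists2 eta : R, 0 < eta &
  forall (dx : R) (k : nat), 0 < dx < eta -> T / 2 ^+ k < eta ->
    scheme_gap (n := n) T L M K dx k T <= e.
Proof.
(* [B] bounds the gap per unit of mesh: when [dx] and the time step are below [eta], D + c is at
   most eta times the first factor. *)
move=> e0; pose B := (Num.sqrt n%:R + K * M / (L + K)) * expR (2 * (L + K) * T).
have B0 : 0 <= B.
  by rewrite mulr_ge0 ?expR_ge0// addr_ge0 ?sqrtr_ge0// divr_ge0 ?mulr_ge0// ltW.
have B1 : 0 < B + 1 by rewrite ltr_wpDl.
exists (e / (B + 1)); first by rewrite divr_gt0.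
move=> dx k /andP[dx0 dxe] dte; set eta := e / (B + 1) in dxe dte.
have c0 : 0 <= K * M / (L + K) by rewrite divr_ge0 ?mulr_ge0// ltW.
have h1 : Num.sqrt n%:R * dx <= Num.sqrt n%:R * eta by rewrite ler_wpM2l ?sqrtr_ge0// ltW.
have h2 : K * M / (L + K) * (T / 2 ^+ k) <= K * M / (L + K) * eta by rewrite ler_wpM2l// ltW.
have cE : K * M * (T / 2 ^+ k) / (L + K) = K * M / (L + K) * (T / 2 ^+ k) by rewrite mulrAC.
have dt0 : 0 <= T / 2 ^+ k by rewrite divr_ge0 ?exprn_ge0// ltW.
have h3 : scheme_gap (n := n) T L M K dx k T <= B * eta.
  rewrite /scheme_gap cE lerBlDr (@le_trans _ _ (B * eta))//.
    by rewrite /B [leRHS]mulrAC ler_wpM2r ?expR_ge0// mulrDl lerD.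
  by rewrite lerDl mulr_ge0.
rewrite (le_trans h3)// /eta mulrCA ger_pMr// ler_pdivrMr// mul1r lerDl.
by [].
Qed.

End gap_bounds.

Unset Implicit Arguments.

Theorem proposition8 (R : realType) (n : nat) (p T L M K : R)
  (v : Pp p n -> 'rV[R]_n -> 'rV[R]_n) (mu0 : Pp p n) (mu : R -> Pp p n)
  (hn : (0 < n)%N) (hp : 1 <= p) (hT : 0 < T) (hLK : 0 < 4 * L + 4 * K)
  (hv : hypothesis_H v L M K) (hmu0 : Pac_c mu0)
  (hmu : is_solution v T mu0 mu) :
  (exists2 delta : R, 0 < delta &
     forall (o : 'rV[R]_n) (dx : R) (k : nat) (mu3 : R -> Pp p n),
       0 < dx -> T / 2 ^+ k < delta -> scheme3 v T mu0 o dx k mu3 ->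
       (dist_curve T mu mu3 <=
         (dx * Num.sqrt n%:R
            * (2 * expR 1) ^ Num.ceil (T * Num.max (2 * L) (8 * K))
          + 4 * K * M * (T / 2 ^+ k)
            * ((expR (T * (4 * L + 4 * K)) - 1) / (4 * L + 4 * K)))%:E)%E) /\
  (forall phi : 'rV[R]_n -> R,
     continuous phi -> (exists C : R, forall x, `|phi x| <= C) ->
     forall eps : R, 0 < eps ->
     exists2 eta : R, 0 < eta &
       forall (o : 'rV[R]_n) (dx : R) (k : nat) (mu3 : R -> Pp p n),
         0 < dx < eta -> T / 2 ^+ k < eta -> scheme3 v T mu0 o dx k mu3 ->
         forall t : R, t \in `[0, T] ->
           `|\int[mu3 t]_x phi x - \int[mu t]_x phi x| < eps).
Proof.
have lambda0 : 0 < L + K by lra.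
have rW := clamped_regular hn hp hT hv hmu.
have [Z ZW] := flow_map_exists rW.
have mZ t : 0 <= t <= T -> measurable_fun setT (Z 0 t).
  by case/andP=> t0 _; exact: (flow_map_measurable rW ZW t0).
split.
  exists 1 => // o dx k mu3 dx0 _ h3; apply: ge_ereal_sup => _ [t /= tT <-].
  rewrite in_itv/= in tT; have [t0 _] := andP tT.
  have [Y [mY muY ZY]] := scheme_comparison hn hp hT lambda0 hv hmu ZW dx0 h3 tT.
  have [pi cpi piD] := grid_coupling dx0 h3.1.
  apply: (@le_trans _ _ (scheme_gap (n := n) T L M K dx k t)%:E).
    apply: (Wp_image_le (f := Z 0 t) (g := Y) hp _ cpi piD) => //.
    - exact: (scheme_gap_ge0 hn hp hT lambda0 hv k dx0 t0).
    - exact: mZ.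
    - exact: (solution_transport hn hp hT hv hmu ZW tT).
  rewrite lee_fin (le_trans (scheme_gap_mono hn hp hT lambda0 hv k dx0 tT))//.
  exact: (scheme_gap_le hn hp hT lambda0 hv k dx0).
move=> phi cphi [C phiC] eps eps0.
have mphi : measurable_fun setT phi := continuous_measurable_rV cphi.
have [_ [S cS muS]] := hmu0.
have [B [_ /(_ (B + 1)) SB]] := compact_bounded cS.
have {}SB : forall x, S x -> `|x| <= B + 1 by apply: SB; rewrite ltrDl.
have e2 : 0 < eps / 2 by rewrite divr_gt0.
(* [mu0] is carried by the ball of radius [B + 1] and characteristics travel at most [M * T], so
   this ball contains their positions up to time [T]. *)
have [d d0 dP] := uniform_on_normball (B + 1 + M * T) cphi e2.
have d2 : 0 < d / 2 by rewrite divr_gt0.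
have [eta eta0 etaP] := scheme_gap_small hn hp hT lambda0 hv d2.
exists eta => // o dx k mu3 dxe dte h3 t; rewrite in_itv/= => tT.
have dx0 : 0 < dx by case/andP: dxe.
have [t0 tT'] := andP tT.
have [Y [mY muY ZY]] := scheme_comparison hn hp hT lambda0 hv hmu ZW dx0 h3 tT.
have [pi cpi piD] := grid_coupling dx0 h3.1.
rewrite distrC (@le_lt_trans _ _ (eps / 2))//; last by rewrite ltr_pdivrMr// ltr_pMr// ltr1n.
have mS : measurable S.
  have clS : closed S by exact: compact_closed (@norm_hausdorff _ _) cS.
  have := measurable_open_rV (closed_openC clS) => /measurableC.
  by rewrite setCK.
apply: (Rintegral_image_close (f := Z 0 t) (g := Y) (ltW e2) cpi piD mS muS _ mY _ muY mphi phiC).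
- exact: mZ.
- exact: (solution_transport hn hp hT hv hmu ZW tT).
move=> x y Sx xy; apply: dP.
  have := flow_map_move rW ZW x t0; rewrite subr0 => h1.
  have M0 : 0 <= M := hypH_M_ge0 hv.
  have -> : Z 0 t x = x + (Z 0 t x - x) by rewrite addrC subrK.
  rewrite (le_trans (ler_normD _ _))// lerD ?SB//.
  by rewrite (le_trans (normr_le_enorm _))// (le_trans h1)// ler_wpM2l.
rewrite (le_lt_trans (normr_le_enorm _))// (le_lt_trans (ZY _ _ xy))//.
rewrite (le_lt_trans (scheme_gap_mono hn hp hT lambda0 hv k dx0 tT))//.
rewrite (le_lt_trans (etaP _ _ dxe dte))//.
by rewrite ltr_pdivrMr// ltr_pMr// ltr1n.
Qed.
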